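(* Let $\mathcal{X}_1,\mathcal{X}_2$ be finite sets and $\{\rho^{B_1B_2}_{x_1,x_2}\}$ a classical-quantum interference channel (density operators on finite-dimensional $\mathcal{H}^{B_1}\otimes\mathcal{H}^{B_2}$). Suppose the channel has very strong interference: for all probability distributions $p_{X_1}$ on $\mathcal{X}_1$ and $p_{X_2}$ on $\mathcal{X}_2$, $$I(X_1;B_1|X_2)\le I(X_1;B_2),\qquad I(X_2;B_2|X_1)\le I(X_2;B_1),$$ evaluated on $\sum_{x_1,x_2}p_{X_1}(x_1)p_{X_2}(x_2)|x_1\rangle\langle x_1|\otimes|x_2\rangle\langle x_2|\otimes\rho^{B_1B_2}_{x_1,x_2}$. Then the capacity region of the channel is the union, over finite sets $\mathcal{Q}$ and distributions $p_Q$, $p_{X_1|Q}$, $p_{X_2|Q}$, of the sets of rate pairs $(R_1,R_2)$ satisfying $$R_1\le I(X_1;B_1|X_2Q)_\theta,\qquad R_2\le I(X_2;B_2|X_1Q)_\theta,$$ where $\theta=\sum_{q,x_1,x_2}p_Q(q)p_{X_1|Q}(x_1|q)p_{X_2|Q}(x_2|q)|q\rangle\langle q|^Q\otimes|x_1\rangle\langle x_1|^{X_1}\otimes|x_2\rangle\langle x_2|^{X_2}\otimes\rho^{B_1B_2}_{x_1,x_2}$.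
   Context: A cc-qq interference channel maps classical inputs $(x_1,x_2)$ to a state $\rho^{B_1B_2}_{x_1,x_2}$; used $n$ times memorylessly on codewords it outputs the tensor product state. An $(n,R_1,R_2,\epsilon)$ code consists of codebooks $\{x_1^n(m_1)\}_{m_1\in\mathcal{M}_1}$, $\{x_2^n(m_2)\}_{m_2\in\mathcal{M}_2}$ with $|\mathcal{M}_i|=2^{nR_i}$, a POVM $\{\Lambda_{m_1}\}$ on $B_1^n$ for Receiver 1 and a POVM $\{\Gamma_{m_2}\}$ on $B_2^n$ for Receiver 2, such that $\frac{1}{|\mathcal{M}_1||\mathcal{M}_2|}\sum_{m_1,m_2}\mathrm{Tr}\{(I-\Lambda_{m_1}\otimes\Gamma_{m_2})\rho_{x_1^n(m_1),x_2^n(m_2)}\}\le\epsilon$. A rate pair is achievable if for all $\epsilon,\delta>0$ and sufficiently large $n$ an $(n,R_1-\delta,R_2-\delta,\epsilon)$ code exists; the capacity region is the closure of the set of achievable rate pairs. Entropies are von Neumann entropies, conditional mutual informations $I(X;B|Y)=H(B|Y)-H(B|XY)$. *)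

(* Defs.v *)
From HB Require Import structures.
From mathcomp Require Import all_boot all_order all_algebra.
From mathcomp Require Import all_classical all_reals all_analysis.
From mathcomp Require Import complex.

Set Implicit Arguments.
Unset Strict Implicit.
Unset Printing Implicit Defensive.

Import Order.TTheory GRing.Theory Num.Theory.
Import numFieldNormedType.Exports.
Local Open Scope ring_scope.
Local Open Scope classical_set_scope.

Section QIC.
Variable R : realType.
Local Notation C := R[i].

Definition Op (T : finType) := T -> T -> C.

Definition op_mul (T : finType) (A B : Op T) : Op T :=
  fun i j => \sum_(k : T) A i k * B k j.
Definition op_id (T : finType) : Op T := fun i j => (i == j)%:R.
Definition op_sub (T : finType) (A B : Op T) : Op T := fun i j => A i j - B i j.
Definition op_tr (T : finType) (A : Op T) : C := \sum_(i : T) A i i.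
Definition op_tens (T1 T2 : finType) (A : Op T1) (B : Op T2) : Op (T1 * T2)%type :=
  fun i j => A i.1 j.1 * B i.2 j.2.

Definition psd (T : finType) (A : Op T) : Prop :=
  forall v : T -> C, 0 <= \sum_(i : T) \sum_(j : T) (v i)^*%C * A i j * v j.
Definition density (T : finType) (A : Op T) : Prop := psd A /\ op_tr A = 1.
Definition povm (T M : finType) (L : M -> Op T) : Prop :=
  (forall m, psd (L m)) /\ (forall i j, \sum_(m : M) L m i j = op_id i j).

Definition marg (T U V : finType) (f : T -> U) (g : T -> V) (A : Op T) : Op U :=
  fun u u' => \sum_(t : T | f t == u) \sum_(t' : T | (f t' == u') && (g t == g t'))
                 A t t'.

Definition mx_of (T : finType) (A : Op T) : 'M[C]_#|T| :=
  \matrix_(i, j) A (enum_val i) (enum_val j).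
Definition eigs n (M : 'M[C]_n) : seq C :=
  xget [::] [set s : seq C | char_poly M = \prod_(z <- s) ('X - z%:P)].
Definition log2 (x : R) : R := ln x / ln 2.
Definition negxlogx (x : R) : R := if x <= 0 then 0 else - (x * log2 x).
Definition entropy (T : finType) (A : Op T) : R :=
  \sum_(z <- eigs (mx_of A)) negxlogx (complex.Re z).

Definition is_pmf (T : finType) (p : T -> R) : Prop :=
  (forall t, 0 <= p t) /\ \sum_(t : T) p t = 1.


Section Channel.
Variables (X1 X2 B1 B2 : finType).
Variable rho : X1 -> X2 -> Op (B1 * B2)%type.

(* n uses of the channel on codewords c1, c2; the output space
   (B1 B2)^{(x) n} is written in the (canonically reordered) form
   B1^{(x) n} (x) B2^{(x) n}, with basis {ffun 'I_n -> B1} * {ffun 'I_n -> B2} *)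
Definition chan_n n (c1 : 'I_n -> X1) (c2 : 'I_n -> X2) :
    Op ({ffun 'I_n -> B1} * {ffun 'I_n -> B2})%type :=
  fun b b' => \prod_(i < n) rho (c1 i) (c2 i) (b.1 i, b.2 i) (b'.1 i, b'.2 i).

Definition code_exists (n k1 k2 : nat) (eps : R) : Prop :=
  exists (c1 : 'I_k1 -> 'I_n -> X1) (c2 : 'I_k2 -> 'I_n -> X2)
         (L : 'I_k1 -> Op {ffun 'I_n -> B1}) (G : 'I_k2 -> Op {ffun 'I_n -> B2}),
    povm L /\ povm G /\
    ((k1%:R * k2%:R)^-1 *
       \sum_(m1 < k1) \sum_(m2 < k2)
          op_tr (op_mul (op_sub (@op_id _) (op_tens (L m1) (G m2)))
                        (chan_n (c1 m1) (c2 m2))) <= eps%:C%C)%R.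

Definition nmsg (n : nat) (r : R) : nat := `|Num.ceil (2 `^ (n%:R * r))|%N.

Definition achievable (r : (R * R)%type) : Prop :=
  forall eps delta : R, 0 < eps -> 0 < delta ->
  exists N : nat, forall n : nat, (N <= n)%N ->
    code_exists n (nmsg n (r.1 - delta)) (nmsg n (r.2 - delta)) eps.

Definition capacity_region : set (R * R)%type := closure achievable.

Definition Hm (T U V : finType) (A : Op T) (f : T -> U) (g : T -> V) : R :=
  entropy (marg f g A).

Definition omega (p1 : X1 -> R) (p2 : X2 -> R) : Op (X1 * X2 * B1 * B2)%type :=
  fun t t' => ((t.1.1.1 == t'.1.1.1) && (t.1.1.2 == t'.1.1.2))%:R *
              (p1 t.1.1.1 * p2 t.1.1.2)%:C%C *
              rho t.1.1.1 t.1.1.2 (t.1.2, t.2) (t'.1.2, t'.2).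

Section OmegaInfo.
Variables (p1 : X1 -> R) (p2 : X2 -> R).
Local Notation w := (omega p1 p2).
Local Notation x1 t := t.1.1.1.
Local Notation x2 t := t.1.1.2.
Local Notation b1 t := t.1.2.
Local Notation b2 t := t.2.
Definition I_X1B1_X2 : R :=
  Hm w (fun t => (x2 t, b1 t)) (fun t => (x1 t, b2 t))
  - Hm w (fun t => x2 t) (fun t => (x1 t, b1 t, b2 t))
  - Hm w (fun t => (x1 t, x2 t, b1 t)) (fun t => b2 t)
  + Hm w (fun t => (x1 t, x2 t)) (fun t => (b1 t, b2 t)).
Definition I_X2B2_X1 : R :=
  Hm w (fun t => (x1 t, b2 t)) (fun t => (x2 t, b1 t))
  - Hm w (fun t => x1 t) (fun t => (x2 t, b1 t, b2 t))
  - Hm w (fun t => (x1 t, x2 t, b2 t)) (fun t => b1 t)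
  + Hm w (fun t => (x1 t, x2 t)) (fun t => (b1 t, b2 t)).
Definition I_X1B2 : R :=
  Hm w (fun t => x1 t) (fun t => (x2 t, b1 t, b2 t))
  + Hm w (fun t => b2 t) (fun t => (x1 t, x2 t, b1 t))
  - Hm w (fun t => (x1 t, b2 t)) (fun t => (x2 t, b1 t)).
Definition I_X2B1 : R :=
  Hm w (fun t => x2 t) (fun t => (x1 t, b1 t, b2 t))
  + Hm w (fun t => b1 t) (fun t => (x1 t, x2 t, b2 t))
  - Hm w (fun t => (x2 t, b1 t)) (fun t => (x1 t, b2 t)).
End OmegaInfo.

Definition very_strong_interference : Prop :=
  forall (p1 : X1 -> R) (p2 : X2 -> R), is_pmf p1 -> is_pmf p2 ->
    I_X1B1_X2 p1 p2 <= I_X1B2 p1 p2 /\ I_X2B2_X1 p1 p2 <= I_X2B1 p1 p2.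

Definition theta (Q : finType) (pQ : Q -> R) (p1 : Q -> X1 -> R) (p2 : Q -> X2 -> R) :
    Op (Q * X1 * X2 * B1 * B2)%type :=
  fun t t' => [&& t.1.1.1.1 == t'.1.1.1.1, t.1.1.1.2 == t'.1.1.1.2
                & t.1.1.2 == t'.1.1.2]%:R *
              (pQ t.1.1.1.1 * p1 t.1.1.1.1 t.1.1.1.2 * p2 t.1.1.1.1 t.1.1.2)%:C%C *
              rho t.1.1.1.2 t.1.1.2 (t.1.2, t.2) (t'.1.2, t'.2).

Section ThetaInfo.
Variables (Q : finType) (pQ : Q -> R) (p1 : Q -> X1 -> R) (p2 : Q -> X2 -> R).
Local Notation th := (theta pQ p1 p2).
Local Notation q t := t.1.1.1.1.
Local Notation x1 t := t.1.1.1.2.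
Local Notation x2 t := t.1.1.2.
Local Notation b1 t := t.1.2.
Local Notation b2 t := t.2.
Definition I_X1B1_X2Q : R :=
  Hm th (fun t => (q t, x2 t, b1 t)) (fun t => (x1 t, b2 t))
  - Hm th (fun t => (q t, x2 t)) (fun t => (x1 t, b1 t, b2 t))
  - Hm th (fun t => (q t, x1 t, x2 t, b1 t)) (fun t => b2 t)
  + Hm th (fun t => (q t, x1 t, x2 t)) (fun t => (b1 t, b2 t)).
Definition I_X2B2_X1Q : R :=
  Hm th (fun t => (q t, x1 t, b2 t)) (fun t => (x2 t, b1 t))
  - Hm th (fun t => (q t, x1 t)) (fun t => (x2 t, b1 t, b2 t))
  - Hm th (fun t => (q t, x1 t, x2 t, b2 t)) (fun t => b1 t)
  + Hm th (fun t => (q t, x1 t, x2 t)) (fun t => (b1 t, b2 t)).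
End ThetaInfo.

Definition vsi_region : set (R * R)%type :=
  [set r | exists (Q : finType) (pQ : Q -> R) (p1 : Q -> X1 -> R) (p2 : Q -> X2 -> R),
     [/\ is_pmf pQ, (forall q, is_pmf (p1 q)), (forall q, is_pmf (p2 q)),
         r.1 <= I_X1B1_X2Q pQ p1 p2 & r.2 <= I_X2B2_X1Q pQ p1 p2]].

End Channel.
End QIC.

(* Main.v *)
(** Achievability. Under very strong interference each receiver can first decode
    the other sender's message, treating its own sender as noise, and then decode
    its own message knowing the interfering codeword. It measures projectors one
    after the other; Gao's union bound controls the disturbance, so that the error
    is linear in the single-test errors. The test of [rho] against [sigma] projects
    onto the span of the images of the large eigenvectors of [rho] under a spectral
    projector of [sigma]. As the error is linear in the codebooks, both receivers
    are served by the same good realization of random codebooks drawn conditionally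
    on a time-sharing sequence.

    Converse. Average, over the codebooks, the Nussbaum-Szkola lower bound for the
    test between an output and its mean over the receiver's own messages. The
    relative entropies add up to [sum_i I(X;B|Y)] at the empirical input laws of
    coordinate [i], so the coordinate plays the role of the time-sharing variable.

    Closedness. By Caratheodory three values of the time-sharing variable suffice,
    so the parameters range over a compact set. The Holevo quantity is a concave
    function of the input law; approximate supergradients at the limit point
    give the upper semicontinuity needed to pass to the limit. *)

Require Import Defs.
From HB Require Import structures.
From mathcomp Require Import all_boot all_order all_algebra.
From mathcomp Require Import all_classical all_reals all_analysis.
From mathcomp Require Import complex.
From mathcomp Require Import ring lra.
Set Implicit Arguments.
Unset Strict Implicit.
Unset Printing Implicit Defensive.

Import Order.TTheory GRing.Theory Num.Theory.
Import numFieldNormedType.Exports.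
Local Open Scope ring_scope.
Local Open Scope sesquilinear_scope.
Local Open Scope complex_scope.

(** * Projectors and the quantum union bound *)

(** No operator logarithm is formed and no operator inequality beyond positivity is used. Two states
    are compared through the squared overlaps of their eigenvectors: weighted by the eigenvalues,
    these are classical joint laws, which factor over channel uses. Scalar estimates of [ln] and
    [expR] then do all the analytic work: typicality, positivity of the Holevo quantity, Klein's
    inequality and the converse.

    The converse shows only that the error of a code above the region stays over a fixed positive
    constant. That is enough, because achievability asks for every error level, and it needs a mean
    of log-likelihood ratios rather than a tail bound. The alternative hypothesis of each test is
    averaged letter by letter, not codeword by codeword, so that it is a product state and the bound
    becomes a sum over coordinates.

    Closedness is a real step: the capacity region is a closure, whereas the region of the theorem
    is a bare union over time-sharing alphabets of unbounded size. Continuity of the entropy is not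
    invoked; bounds linear in the input law replace it. *)

Section Matrices.
Variable R : realType.
Local Notation C := R[i].
Local Notation Rec := complex.Re.

Lemma adjmxM m n p (A : 'M[C]_(m, n)) (B : 'M[C]_(n, p)) :
  (A *m B)^t* = B^t* *m A^t*.
Proof. by rewrite trmx_mul map_mxM. Qed.

Lemma adjmxD m n (A B : 'M[C]_(m, n)) : (A + B)^t* = A^t* + B^t*.
Proof. by rewrite linearD map_mxD. Qed.

Lemma adjmxB m n (A B : 'M[C]_(m, n)) : (A - B)^t* = A^t* - B^t*.
Proof. by rewrite linearB map_mxB. Qed.

Lemma adjmxZ m n (x : R) (A : 'M[C]_(m, n)) : (x%:C *: A)^t* = x%:C *: A^t*.
Proof. by rewrite linearZ map_mxZ; congr (_ *: _); exact: conjc_real. Qed.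

Lemma adjmx1 n : (1%:M : 'M[C]_n)^t* = 1%:M.
Proof. by rewrite trmx1 map_mx1. Qed.

Lemma Re_sum (I : Type) (r : seq I) (P : pred I) (F : I -> C) :
  Rec (\sum_(i <- r | P i) F i) = \sum_(i <- r | P i) Rec (F i).
Proof. exact: (raddf_sum (@complex.Re R : Rcomplex R -> R)). Qed.

Lemma Re_mulr (x : R) (z : C) : Rec (x%:C * z) = x * Rec z.
Proof. by case: z => a b /=; rewrite mul0r subr0. Qed.

Definition nsqc (z : C) : R := Rec z ^+ 2 + complex.Im z ^+ 2.

Lemma nsqc_ge0 z : 0 <= nsqc z.
Proof. by rewrite addr_ge0 ?sqr_ge0. Qed.

Lemma nsqcE z : Rec (z^*%C * z) = nsqc z.
Proof. by case: z => a b; rewrite /nsqc /=; ring. Qed.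

Lemma mulcJ z : z^*%C * z = (nsqc z)%:C.
Proof. by case: z => a b; apply/eqP; rewrite eq_complex /nsqc /=; apply/andP; split; apply/eqP; ring. Qed.

Lemma nsqcM z w : nsqc (z * w) = nsqc z * nsqc w.
Proof. by case: z => a b; case: w => c d; rewrite /nsqc /=; ring. Qed.

Lemma nsqc1 : nsqc 1 = 1.
Proof. by rewrite /nsqc /= expr1n expr0n addr0. Qed.

Definition tre n (A : 'M[C]_n) : R := Rec (\tr A).

Lemma tre0 n : tre (0 : 'M[C]_n) = 0.
Proof. by rewrite /tre mxtrace0. Qed.

Lemma treD n (A B : 'M[C]_n) : tre (A + B) = tre A + tre B.
Proof. by rewrite /tre mxtraceD; case: (\tr A) => ? ?; case: (\tr B). Qed.

Lemma treN n (A : 'M[C]_n) : tre (- A) = - tre A.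
Proof. by rewrite /tre raddfN /=; case: (\tr A). Qed.

Lemma treB n (A B : 'M[C]_n) : tre (A - B) = tre A - tre B.
Proof. by rewrite treD treN. Qed.

Lemma treZ n (x : R) (A : 'M[C]_n) : tre (x%:C *: A) = x * tre A.
Proof. by rewrite /tre mxtraceZ Re_mulr. Qed.

Lemma tre_sum n (I : Type) (r : seq I) (P : pred I) (F : I -> 'M[C]_n) :
  tre (\sum_(i <- r | P i) F i) = \sum_(i <- r | P i) tre (F i).
Proof. by rewrite /tre (raddf_sum (@mxtrace C n)) Re_sum. Qed.

Lemma treC m n (A : 'M[C]_(m, n)) (B : 'M[C]_(n, m)) : tre (A *m B) = tre (B *m A).
Proof. by rewrite /tre mxtrace_mulC. Qed.

Lemma tre_adj n (A : 'M[C]_n) : tre (A^t*) = tre A.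
Proof.
rewrite /tre /mxtrace !Re_sum; apply: eq_bigr => i _; rewrite !mxE.
by case: (A i i).
Qed.

Definition ip m n (A B : 'M[C]_(m, n)) : R := tre (A^t* *m B).
Definition nsq m n (A : 'M[C]_(m, n)) : R := ip A A.

Lemma nsqE m n (A : 'M[C]_(m, n)) : nsq A = \sum_j \sum_i nsqc (A i j).
Proof.
rewrite /nsq /ip /tre /mxtrace Re_sum; apply: eq_bigr => j _.
rewrite !mxE Re_sum; apply: eq_bigr => i _; rewrite !mxE; exact: nsqcE.
Qed.

Lemma nsq_ge0 m n (A : 'M[C]_(m, n)) : 0 <= nsq A.
Proof. by rewrite nsqE; do 2![apply: sumr_ge0 => ? _]; exact: nsqc_ge0. Qed.

Lemma ipDr m n (A B D : 'M[C]_(m, n)) : ip A (B + D) = ip A B + ip A D.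
Proof. by rewrite /ip mulmxDr treD. Qed.

Lemma ipBr m n (A B D : 'M[C]_(m, n)) : ip A (B - D) = ip A B - ip A D.
Proof. by rewrite /ip mulmxBr treB. Qed.

Lemma ipC m n (A B : 'M[C]_(m, n)) : ip A B = ip B A.
Proof. by rewrite /ip -tre_adj adjmxM trmxCK. Qed.

Lemma nsqB m n (A B : 'M[C]_(m, n)) : nsq (A - B) = nsq A + nsq B - 2 * ip A B.
Proof.
rewrite /nsq ipBr (ipC (A - B) A) (ipC (A - B) B) !ipBr (ipC B A).
by rewrite -/(nsq A) -/(nsq B); ring.
Qed.

Lemma ip_le m n (A B : 'M[C]_(m, n)) : 2 * ip A B <= nsq A + nsq B.
Proof. by have := nsq_ge0 (A - B); rewrite nsqB; lra. Qed.

Lemma nsqZ m n (x : R) (A : 'M[C]_(m, n)) : nsq (x%:C *: A) = x ^+ 2 * nsq A.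
Proof. by rewrite /nsq /ip adjmxZ -scalemxAl -scalemxAr !treZ; ring. Qed.

Lemma ipZr m n (x : R) (A B : 'M[C]_(m, n)) : ip A (x%:C *: B) = x * ip A B.
Proof. by rewrite /ip -scalemxAr treZ. Qed.

(** AM-GM with unequal weights. In [union_bound] the inner product with the start loses at least
    half of the drop in squared norm; the weight 1/4 pays back only a quarter of the drop, so a
    quarter remains, whence the constant 4. *)
Lemma ip_le4 m n (A B : 'M[C]_(m, n)) : ip A B <= nsq A + nsq B / 4.
Proof.
have := ip_le A ((2^-1)%:C *: B); rewrite ipZr nsqZ expr2.
by have := nsq_ge0 A; lra.
Qed.

Definition proj n (P : 'M[C]_n) := P^t* = P /\ P *m P = P.

Lemma proj0 n : proj (0 : 'M[C]_n).
Proof. by split; rewrite ?mul0mx // trmx0 map_mx0. Qed.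

Lemma projC n (P : 'M[C]_n) : proj P -> proj (1%:M - P).
Proof.
case=> PH PP; split; first by rewrite adjmxB adjmx1 PH.
by rewrite mulmxBl mul1mx mulmxBr mulmx1 PP subrr subr0.
Qed.

Lemma ip_proj m n (P : 'M[C]_m) (A B : 'M[C]_(m, n)) : proj P ->
  ip A (P *m B) = ip (P *m A) (P *m B).
Proof. by case=> PH PP; rewrite /ip adjmxM PH -!mulmxA (mulmxA P P) PP. Qed.

Lemma nsq_proj m n (P : 'M[C]_m) (A : 'M[C]_(m, n)) : proj P ->
  nsq (P *m A) = ip A (P *m A).
Proof. by move=> hP; rewrite [RHS]ip_proj. Qed.

Lemma nsq_projC m n (P : 'M[C]_m) (A : 'M[C]_(m, n)) : proj P ->
  nsq ((1%:M - P) *m A) = nsq A - nsq (P *m A).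
Proof.
move=> hP; rewrite (nsq_proj _ (projC hP)) mulmxBl mul1mx ipBr.
by rewrite (nsq_proj _ hP).
Qed.

Lemma nsq_proj_le m n (P : 'M[C]_m) (A : 'M[C]_(m, n)) : proj P ->
  nsq (P *m A) <= nsq A.
Proof. by move=> hP; have := nsq_ge0 ((1%:M - P) *m A); rewrite nsq_projC //; lra. Qed.

Definition papply m n (s : seq 'M[C]_m) (A : 'M[C]_(m, n)) :=
  foldl (fun B P => P *m B) A s.

Lemma papply_cat m n (s1 s2 : seq 'M[C]_m) (A : 'M[C]_(m, n)) :
  papply (s1 ++ s2) A = papply s2 (papply s1 A).
Proof. exact: foldl_cat. Qed.

(* Gao's quantum union bound: each projector costs the inner product of [W] with the
   evolving state at most its failure amplitude, by AM-GM. *)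
Lemma union_bound m n (s : seq 'M[C]_m) (W : 'M[C]_(m, n)) :
  {in s, forall P, proj P} ->
  nsq W - nsq (papply s W) <= 4 * \sum_(P <- s) nsq ((1%:M - P) *m W).
Proof.
move=> hs.
have H (Y : 'M[C]_(m, n)) : ip W Y - ip W (papply s Y) <=
    \sum_(P <- s) nsq ((1%:M - P) *m W) + (nsq Y - nsq (papply s Y)) / 4.
  elim: s Y hs => [|P s IH] Y hs; first by rewrite big_nil /=; lra.
  rewrite big_cons /=.
  have hP : proj P by apply: hs; rewrite inE eqxx.
  have {IH} := IH (P *m Y) (fun Q hQ => hs Q (@mem_behead _ (P :: s) Q hQ)).
  have : ip W Y - ip W (P *m Y) <= nsq ((1%:M - P) *m W) + (nsq Y - nsq (P *m Y)) / 4.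
    rewrite -ipBr -nsq_projC //.
    rewrite (_ : Y - P *m Y = (1%:M - P) *m Y); last by rewrite mulmxBl mul1mx.
    by rewrite (ip_proj _ _ (projC hP)); exact: ip_le4.
  lra.
have := H W; have := ip_le W (papply s W); rewrite -/(nsq W); lra.
Qed.

(** Positivity as a Gram factorization of free inner dimension: sums stack the factors, and traces
    of products become squared norms. [psdm_psd] and [psd_psdm] link it to the quadratic form. *)
Definition psdm n (A : 'M[C]_n) := exists k (V : 'M[C]_(k, n)), A = V^t* *m V.

Lemma psdm_gram k n (V : 'M[C]_(k, n)) : psdm (V^t* *m V).
Proof. by exists k, V. Qed.

Lemma psdm0 n : psdm (0 : 'M[C]_n).
Proof. by exists 0%N, 0; rewrite mulmx0. Qed.

Lemma psdmD n (A B : 'M[C]_n) : psdm A -> psdm B -> psdm (A + B).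
Proof.
move=> [k [V ->]] [l [W ->]]; exists (k + l)%N, (col_mx V W).
by rewrite tr_col_mx map_row_mx mul_row_col.
Qed.

Lemma psdm_sum n (I : Type) (r : seq I) (P : pred I) (F : I -> 'M[C]_n) :
  (forall i, P i -> psdm (F i)) -> psdm (\sum_(i <- r | P i) F i).
Proof.
move=> h; apply: (big_ind (@psdm n)) => //; [exact: psdm0|exact: psdmD].
Qed.

Lemma psdmZ n (x : R) (A : 'M[C]_n) : 0 <= x -> psdm A -> psdm (x%:C *: A).
Proof.
move=> x0 [k [V ->]]; exists k, ((Num.sqrt x)%:C *: V).
rewrite adjmxZ -scalemxAl -scalemxAr scalerA; congr (_ *: _).
by rewrite -rmorphM /= -expr2 sqr_sqrtr.
Qed.

Lemma psdm_conj m n (A : 'M[C]_n) (B : 'M[C]_(n, m)) : psdm A -> psdm (B^t* *m A *m B).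
Proof. by move=> [k [V ->]]; exists k, (V *m B); rewrite adjmxM !mulmxA. Qed.

Lemma psdm_adj n (A : 'M[C]_n) : psdm A -> A^t* = A.
Proof. by move=> [k [V ->]]; rewrite adjmxM trmxCK. Qed.

Lemma psdm1 n : psdm (1%:M : 'M[C]_n).
Proof. by exists n, 1%:M; rewrite adjmx1 mulmx1. Qed.

Lemma mxtrace_gram m n (X : 'M[C]_(m, n)) : \tr (X^t* *m X) = (nsq X)%:C.
Proof.
rewrite nsqE rmorph_sum /mxtrace; apply: eq_bigr => j _; rewrite !mxE rmorph_sum.
by apply: eq_bigr => i _; rewrite !mxE; exact: mulcJ.
Qed.

(** Stated in [C] with a real cast, so that it gives nonnegativity and also realness; the latter
    turns the complex error criterion of a code into a real inequality. *)
Lemma mxtrace_psdm_mul n (A B : 'M[C]_n) : psdm A -> psdm B ->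
  exists k l (X : 'M[C]_(k, l)), \tr (A *m B) = (nsq X)%:C.
Proof.
move=> [k [V ->]] [l [W ->]]; exists l, k, (W *m V^t*).
by rewrite -mxtrace_gram adjmxM trmxCK -!mulmxA mxtrace_mulC -!mulmxA.
Qed.

Lemma tre_mul_ge0 n (A B : 'M[C]_n) : psdm A -> psdm B -> 0 <= tre (A *m B).
Proof.
by move=> hA hB; have [k [l [X]]] := mxtrace_psdm_mul hA hB; rewrite /tre => -> /=; exact: nsq_ge0.
Qed.

Lemma tre_mul_real n (A B : 'M[C]_n) : psdm A -> psdm B -> \tr (A *m B) = (tre (A *m B))%:C.
Proof.
by move=> hA hB; have [k [l [X]]] := mxtrace_psdm_mul hA hB; rewrite /tre => ->.
Qed.

Lemma tre_sqr m n (A : 'M[C]_(m, n)) k (W : 'M[C]_(n, k)) :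
  tre (A^t* *m A *m (W *m W^t*)) = nsq (A *m W).
Proof. by rewrite /nsq /ip adjmxM mulmxA treC -!mulmxA. Qed.

Definition povmm n (I : finType) (L : I -> 'M[C]_n) :=
  (forall i, psdm (L i)) /\ \sum_i L i = 1%:M.

Lemma povmm_compl n (I : finType) (L : I -> 'M[C]_n) i : povmm L -> psdm (1%:M - L i).
Proof.
case=> h1 <-; rewrite (bigD1 i) //= addrAC subrr add0r.
by apply: psdm_sum.
Qed.

End Matrices.

(** * Sequential decoding and hypothesis tests *)

Section Decoder.
Variable R : realType.
Local Notation C := R[i].

(** Failure of the first [k] tests. Together with the first-success operators [seqop P j], these are
    the Kraus operators of a sequential projective measurement; [seqop_sum] is their
    completeness. *)
Fixpoint zrest n (P : nat -> 'M[C]_n) k : 'M[C]_n :=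
  if k is k'.+1 then (1%:M - P k') *m zrest P k' else 1%:M.

Definition seqop n (P : nat -> 'M[C]_n) j := P j *m zrest P j.

Lemma seqop_sum n (P : nat -> 'M[C]_n) k : (forall j, proj (P j)) ->
  \sum_(j < k) (seqop P j)^t* *m seqop P j + (zrest P k)^t* *m zrest P k = 1%:M.
Proof.
move=> hP; elim: k => [|k IH]; first by rewrite big_ord0 add0r /= adjmx1 mulmx1.
rewrite big_ord_recr /= -[RHS]IH -addrA; congr (_ + _).
rewrite /seqop !adjmxM -!mulmxA.
have [h1 h2] := hP k; have [h3 h4] := projC (hP k).
rewrite h1 h3 (mulmxA (P k)) h2 (mulmxA (1%:M - P k)) h4.
by rewrite -mulmxDr -mulmxDl addrC subrK mul1mx.
Qed.

Lemma zrestE m n (P : nat -> 'M[C]_m) k (X : 'M[C]_(m, n)) :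
  zrest P k *m X = papply [seq 1%:M - P i | i <- iota 0 k] X.
Proof.
elim: k => [|k IH]; first by rewrite mul1mx.
by rewrite -addn1 iotaD add0n map_cat papply_cat addn1 /= -mulmxA IH.
Qed.

(** The sequential operators recurse on [nat], while messages are ordinals. Beyond the range the
    test is the zero projector, which never accepts. *)
Definition natext n k (P : 'I_k -> 'M[C]_n) (j : nat) : 'M[C]_n :=
  oapp P 0 (insub j).

Lemma natextE n k (P : 'I_k -> 'M[C]_n) (j : 'I_k) : natext P j = P j.
Proof. by rewrite /natext valK. Qed.

Lemma natext_proj n k (P : 'I_k -> 'M[C]_n) j : (forall j, proj (P j)) ->
  proj (natext P j).
Proof. by rewrite /natext; case: (insub j) => [i|] h /=; [exact: h|exact: proj0]. Qed.

Lemma sum_iota_neq n k (P : 'I_k -> 'M[C]_n) m (X : 'M[C]_(n, m)) (j : 'I_k) :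
  \sum_(i <- iota 0 j) nsq (natext P i *m X) <= \sum_(i | i != j) nsq (P i *m X).
Proof.
have -> : iota 0 j = index_iota 0 j by rewrite /index_iota subn0.
rewrite (big_nat_widen 0 j k) 1?ltnW // big_mkord.
under eq_bigr => i _ do rewrite natextE.
rewrite big_mkcond [leRHS]big_mkcond /=; apply: ler_sum => i _.
case: ifP => [lij|_]; last by case: ifP => // _; exact: nsq_ge0.
by rewrite ifT // neq_ltn lij.
Qed.

Lemma gram_sum_mul (I : finType) n (V : I -> 'M[C]_n) (Z W : 'M[C]_n) :
  \sum_a (V a)^t* *m V a + Z^t* *m Z = 1%:M ->
  \sum_a (V a *m W)^t* *m (V a *m W) + (Z *m W)^t* *m (Z *m W) = W^t* *m W.
Proof.
move=> h; have -> : W^t* *m W = W^t* *m (1%:M *m W) by rewrite mul1mx.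
rewrite -h mulmxDl mulmx_suml mulmxDr mulmx_sumr.
rewrite adjmxM -!mulmxA; congr (_ + _).
by apply: eq_bigr => a _; rewrite adjmxM -!mulmxA.
Qed.

(** Runs in which a stage accepts nothing are assigned to message 0, hence [0 < ka]. The positive
    remainder [M] is exposed because the error analysis keeps only the branch of the correct [b]. *)
Lemma two_stage_povm n ka kb (Pb : 'I_kb -> 'M[C]_n) (Pa : 'I_kb -> 'I_ka -> 'M[C]_n) :
  (0 < ka)%N -> (forall b, proj (Pb b)) -> (forall b a, proj (Pa b a)) ->
  exists L : 'I_ka -> 'M[C]_n, povmm L /\
    forall a b, exists2 M, psdm M &
      L a = (seqop (natext (Pa b)) a *m seqop (natext Pb) b)^t*
            *m (seqop (natext (Pa b)) a *m seqop (natext Pb) b) + M.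
Proof.
move=> ka0 hb ha.
pose W b := seqop (natext Pb) b; pose V (b : 'I_kb) a := seqop (natext (Pa b)) a.
pose rest := \sum_(b < kb) (zrest (natext (Pa b)) ka *m W b)^t* *m (zrest (natext (Pa b)) ka *m W b)
  + (zrest (natext Pb) kb)^t* *m zrest (natext Pb) kb.
have prest : psdm rest.
  by apply: psdmD; [apply: psdm_sum => ? _|]; exact: psdm_gram.
have pif a : psdm (if a == Ordinal ka0 then rest else 0).
  by case: ifP => _ //; exact: psdm0.
exists (fun a => \sum_(b < kb) (V b a *m W b)^t* *m (V b a *m W b)
   + (if a == Ordinal ka0 then rest else 0)); split; last first.
  move=> a b; exists (\sum_(i < kb | i != b) (V i a *m W i)^t* *m (V i a *m W i)
     + (if a == Ordinal ka0 then rest else 0)); last by rewrite (bigD1 b) //= -addrA.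
  by apply: psdmD (pif a); apply: psdm_sum => ? _; exact: psdm_gram.
split; first by move=> a; apply: psdmD (pif a); apply: psdm_sum => ? _; exact: psdm_gram.
have Erest : \sum_(a < ka) (if a == Ordinal ka0 then rest else 0) = rest.
  by rewrite -big_mkcond big_pred1_eq.
rewrite big_split Erest exchange_big /= /rest addrA -big_split /=.
rewrite -[RHS](@seqop_sum n (natext Pb) kb (fun j => natext_proj j hb)).
congr (_ + _); apply: eq_bigr => b _.
exact/gram_sum_mul/(@seqop_sum n (natext (Pa b)) ka (fun j => natext_proj j (ha b))).
Qed.

(** The correct branch is a single chain of projectors: the complements of the earlier tests, then
    the right test, in both stages. A complement fails with the amplitude with which a wrong test
    accepts, so [union_bound] yields exactly these terms. *)
Lemma two_stage_success n k ka kb (Pb : 'I_kb -> 'M[C]_n) (Pa : 'I_ka -> 'M[C]_n)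
    (a : 'I_ka) (b : 'I_kb) (X : 'M[C]_(n, k)) :
  (forall b, proj (Pb b)) -> (forall a, proj (Pa a)) ->
  nsq X - nsq (seqop (natext Pa) a *m seqop (natext Pb) b *m X) <=
    4 * (nsq ((1%:M - Pb b) *m X) + \sum_(b' | b' != b) nsq (Pb b' *m X)
         + nsq ((1%:M - Pa a) *m X) + \sum_(a' | a' != a) nsq (Pa a' *m X)).
Proof.
move=> hb ha; pose s := [seq 1%:M - natext Pb i | i <- iota 0 b] ++ [:: natext Pb b] ++
   [seq 1%:M - natext Pa i | i <- iota 0 a] ++ [:: natext Pa a].
have ps : {in s, forall P, proj P}.
  move=> P; rewrite !mem_cat !inE => /or4P[/mapP[i _ ->]|/eqP->|/mapP[i _ ->]|/eqP->].
  - exact/projC/natext_proj.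
  - exact/natext_proj.
  - exact/projC/natext_proj.
  - exact/natext_proj.
have -> : seqop (natext Pa) a *m seqop (natext Pb) b *m X = papply s X.
  by rewrite !papply_cat -!zrestE /papply /= /seqop -!mulmxA.
apply: le_trans (union_bound X ps) _; rewrite ler_pM2l ?ltr0n //.
rewrite /s !big_cat !big_seq1 /= !big_map !natextE -!addrA.
under eq_bigr => i _ do rewrite subKr.
under [X in _ + (_ + (X + _))]eq_bigr => i _ do rewrite subKr.
rewrite addrCA lerD2l; apply: lerD; first exact: sum_iota_neq.
by rewrite addrC lerD2l; exact: sum_iota_neq.
Qed.

(* First test the [Pb b] in order; after the first success [b], test the [Pa b a] in order. *)
Lemma two_stage_decoder n ka kb (Pb : 'I_kb -> 'M[C]_n) (Pa : 'I_kb -> 'I_ka -> 'M[C]_n) :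
  (0 < ka)%N -> (forall b, proj (Pb b)) -> (forall b a, proj (Pa b a)) ->
  exists L : 'I_ka -> 'M[C]_n, povmm L /\
    forall a b (rho : 'M[C]_n), psdm rho ->
      tre ((1%:M - L a) *m rho) <=
        4 * (tre ((1%:M - Pb b) *m rho) + \sum_(b' | b' != b) tre (Pb b' *m rho)
             + tre ((1%:M - Pa b a) *m rho) + \sum_(a' | a' != a) tre (Pa b a' *m rho)).
Proof.
move=> ka0 hb ha; have [L [hL LE]] := two_stage_povm ka0 hb ha.
exists L; split => // a b rho [k [Y rhoE]]; have [M hM {}LE] := LE a b.
have [X {}rhoE] : exists X : 'M[C]_(n, k), rho = X *m X^t* by exists (Y^t*); rewrite trmxCK.
rewrite rhoE {rho rhoE}.
have projE P : proj P -> tre (P *m (X *m X^t*)) = nsq (P *m X).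
  by case=> h1 h2; rewrite -tre_sqr h1 h2.
rewrite (projE _ (projC (hb b))) (projE _ (projC (ha b a))).
under eq_bigr => i _ do rewrite projE //.
under [X in _ <= _ * (_ + X)]eq_bigr => i _ do rewrite projE //.
apply: le_trans (two_stage_success a b X hb (ha b)).
rewrite mulmxBl mul1mx treB -tre_sqr; have -> : nsq X = tre (X *m X^t*) by rewrite treC.
rewrite lerD2l lerN2 LE mulmxDl treD lerDl.
by apply: tre_mul_ge0 => //; exists k, (X^t*); rewrite trmxCK.
Qed.

(** The index type is arbitrary, so that eigenbases of product and classical-quantum states keep
    their product indices. *)
Definition onb (K : finType) n (e : K -> 'cV[C]_n) :=
  (forall i j, (e i)^t* *m e j = ((i == j)%:R)%:M) /\
  \sum_k e k *m (e k)^t* = 1%:M.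

Definition eigm (K : finType) n (A : 'M[C]_n) (lam : K -> R) (e : K -> 'cV[C]_n) :=
  [/\ onb e, (forall k, 0 <= lam k) & A = \sum_k (lam k)%:C *: (e k *m (e k)^t*)].

Lemma tre_eigm (K : finType) n (A T : 'M[C]_n) (lam : K -> R) e : eigm A lam e ->
  tre (T^t* *m T *m A) = \sum_k lam k * nsq (T *m e k).
Proof.
case=> _ _ ->; rewrite mulmx_sumr tre_sum; apply: eq_bigr => k _.
by rewrite -scalemxAr treZ tre_sqr.
Qed.

Lemma tre_eigm_proj (K : finType) n (A P : 'M[C]_n) (lam : K -> R) e : eigm A lam e -> proj P ->
  tre (P *m A) = \sum_k lam k * nsq (P *m e k).
Proof. by move=> hA [h1 h2]; rewrite -(tre_eigm _ hA) h1 h2. Qed.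

Lemma nsq_onb (K : finType) n (e : K -> 'cV[C]_n) k : onb e -> nsq (e k) = 1.
Proof. by case=> h _; rewrite /nsq /ip h eqxx /tre mxtrace1. Qed.

Lemma tre_eigm1 (K : finType) n (A : 'M[C]_n) (lam : K -> R) e : eigm A lam e ->
  tre A = \sum_k lam k.
Proof.
move=> hA; have := tre_eigm 1%:M hA; rewrite adjmx1 !mul1mx => ->; case: hA => h _ _.
by apply: eq_bigr => k _; rewrite mul1mx (nsq_onb k h) mulr1.
Qed.

Lemma eigm_psdm (K : finType) n (A : 'M[C]_n) (lam : K -> R) e : eigm A lam e -> psdm A.
Proof.
case=> _ h ->; apply: psdm_sum => k _; apply: psdmZ => //.
by exists 1%N, ((e k)^t*); rewrite trmxCK.
Qed.

Lemma parseval (K : finType) n (e : K -> 'cV[C]_n) m (A : 'M[C]_(n, m)) : onb e ->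
  \sum_k nsq ((e k)^t* *m A) = nsq A.
Proof.
case=> _ h; have -> : nsq A = tre (A^t* *m (1%:M *m A)) by rewrite mul1mx.
rewrite -h mulmx_suml mulmx_sumr tre_sum.
by apply: eq_bigr => k _; rewrite /nsq /ip adjmxM trmxCK !mulmxA.
Qed.

Lemma nsq_adj m n (A : 'M[C]_(m, n)) : nsq (A^t*) = nsq A.
Proof. by rewrite /nsq /ip trmxCK treC. Qed.

Lemma sum_nsq_proj (K : finType) n (e : K -> 'cV[C]_n) P : onb e -> proj P ->
  \sum_k nsq (P *m e k) = tre P.
Proof.
move=> he hP; transitivity (nsq P); last by case: hP => h1 h2; rewrite /nsq /ip h1 h2.
rewrite -(parseval P he); apply: eq_bigr => k _.
by rewrite -[LHS]nsq_adj adjmxM; case: hP => -> _.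
Qed.

(** Gram-Schmidt in projector form: a new vector contributes the rank-one projector on its component
    outside [P]. A dependent vector contributes nothing, so the trace is only bounded by the
    length. *)
Lemma proj_span n (Q : 'M[C]_n) (s : seq 'cV[C]_n) : {in s, forall v, Q *m v = v} ->
  exists P, [/\ proj P, Q *m P = P, {in s, forall v, P *m v = v} & tre P <= (size s)%:R].
Proof.
elim: s => [|v s IH] hs.
  by exists 0; split; rewrite ?mulmx0 ?tre0 //; exact: proj0.
have [|P [hP QP Ps trP]] := IH.
  by move=> u us; apply: hs; rewrite inE us orbT.
have Qv : Q *m v = v by apply: hs; rewrite inE eqxx.
pose w := (1%:M - P) *m v.
have vE : v = w + P *m v by rewrite /w mulmxBl mul1mx subrK.
case: hP => PH PP.
have Pw : P *m w = 0 by rewrite /w mulmxA mulmxBr mulmx1 PP subrr mul0mx.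
have wP : w^t* *m P = 0 by rewrite -PH -adjmxM Pw trmx0 map_mx0.
have ww : w^t* *m w = ((nsq w)%:C)%:M.
  by rewrite -mxtrace_gram [LHS]mx11_scalar /mxtrace big_ord1.
have [w0|w0] := eqVneq (nsq w) 0.
  have /eqP wz : w == 0.
    clearbody w; apply/eqP/matrixP => i j; rewrite mxE; move: w0; rewrite nsqE.
    move/eqP; rewrite psumr_eq0; last by move=> ? _; apply: sumr_ge0 => ? _; exact: nsqc_ge0.
    move/allP/(_ j (mem_index_enum _))/eqP/eqP; rewrite psumr_eq0; last by move=> ? _; exact: nsqc_ge0.
    move/allP/(_ i (mem_index_enum _)); rewrite /nsqc paddr_eq0 ?sqr_ge0 // !sqrf_eq0.
    by case: (w i j) => a b /= /andP[/eqP -> /eqP ->].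
  exists P; split => //.
    by move=> u; rewrite inE => /orP[/eqP->|/Ps //]; rewrite {2}vE wz add0r.
  by apply: le_trans trP _; rewrite ler_nat /=.
have cw : ((nsq w)^-1)%:C * (nsq w)%:C = 1 :> C by rewrite -rmorphM mulVf.
exists (P + ((nsq w)^-1)%:C *: (w *m w^t*)); split.
- split; first by rewrite adjmxD adjmxZ adjmxM trmxCK PH.
  rewrite mulmxDl !mulmxDr PP -!scalemxAl -!scalemxAr mulmxA Pw mul0mx scaler0 addr0.
  rewrite -(mulmxA w) wP mulmx0 scaler0 add0r; congr (_ + _).
  rewrite mulmxA -(mulmxA w) ww mul_mx_scalar -scalemxAl !scalerA.
  by rewrite cw mulr1.
- rewrite mulmxDr QP -scalemxAr; congr (_ + _ *: _); rewrite mulmxA; congr (_ *m _).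
  by rewrite /w mulmxBl mul1mx mulmxBr Qv mulmxA QP.
- move=> u; rewrite inE => /orP[/eqP->|us]; rewrite mulmxDl -scalemxAl -mulmxA.
    rewrite {2}vE mulmxDr ww mulmxA wP mul0mx addr0 mul_mx_scalar scalerA cw scale1r.
    by rewrite addrC -vE.
  have -> : w^t* *m u = 0 by rewrite -(Ps _ us) mulmxA wP mul0mx.
    by rewrite mulmx0 scaler0 addr0 Ps.
rewrite treD treZ treC -/(ip w w) -/(nsq w) mulVf //= -natr1; lra.
Qed.

Lemma card_ge_level (K : finType) (lam : K -> R) a : 0 < a -> (forall k, 0 <= lam k) ->
  \sum_k lam k <= 1 -> (#|[pred k | a <= lam k]|)%:R <= a^-1.
Proof.
move=> a0 h h1; rewrite -(ler_pM2l a0) mulfV ?gt_eqF //; apply: le_trans h1.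
rewrite mulr_natr -sumr_const [leRHS](bigID [pred k | a <= lam k]) /=.
rewrite -[leLHS]addr0; apply: lerD; last by apply: sumr_ge0.
by apply: ler_sum => k.
Qed.

(* The projector is onto the span of the images, under the spectral projector
   [mu <= b] of [sigma], of the eigenvectors of [rho] with eigenvalue at least [a]. *)
Lemma projector_test (K J : finType) n (rho sigma : 'M[C]_n) (lam : K -> R) (mu : J -> R) e f a b :
  eigm rho lam e -> eigm sigma mu f -> tre rho = 1 -> 0 < a -> 0 <= b ->
  exists P, [/\ proj P, tre (P *m sigma) <= b / a &
    tre ((1%:M - P) *m rho) <= \sum_(k | lam k < a) lam k
       + \sum_(j | b < mu j) tre ((f j *m (f j)^t*) *m rho)].
Proof.
move=> hrho hsig tr1 a0 b0; have [he lam0 rhoE] := hrho; have [hf mu0 sigE] := hsig.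
pose Q := \sum_(j | mu j <= b) f j *m (f j)^t*.
have [fo f1] := hf.
have Qf j : Q *m f j = if mu j <= b then f j else 0.
  rewrite /Q mulmx_suml; under eq_bigr => i _ do rewrite -mulmxA fo.
  have [h|h] := boolP (mu j <= b).
    rewrite (bigD1 j) //= eqxx mulmx1 big1 ?addr0 // => i /andP[_ /negPf ->].
    by rewrite raddf0 mulmx0.
  rewrite big1 // => i hi; case: eqP => [ij|_]; last by rewrite raddf0 mulmx0.
  by move: h; rewrite -ij hi.
have hQ : proj Q.
  split.
    rewrite /Q -[X in X^t* = _]/(\sum_(j | mu j <= b) f j *m (f j)^t*) linear_sum map_mx_sum.
    by apply: eq_bigr => j _; rewrite adjmxM trmxCK.
  rewrite {2}/Q mulmx_sumr; apply: eq_bigr => j hj; by rewrite mulmxA Qf hj.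
pose s := [seq Q *m e k | k <- enum [pred k | a <= lam k]].
have [|P [hP QP Ps trP]] := @proj_span n Q s.
  by move=> v /mapP[k _ ->]; rewrite mulmxA; case: hQ => _ ->.
have PQ : P *m Q = P.
  by case: hP => <- _; case: hQ => <- _; rewrite -adjmxM QP.
exists P; split => //.
(* [P] lies under [Q], where [sigma] is at most [b], and its trace is at most the number of
   eigenvalues of [rho] above [a], itself at most [1/a]. *)
- rewrite (tre_eigm_proj hsig hP); apply: (@le_trans _ _ (\sum_j b * nsq (P *m f j))).
    apply: ler_sum => j _; have [h|h] := boolP (mu j <= b).
      by rewrite ler_wpM2r ?nsq_ge0.
    by rewrite -{1}PQ -mulmxA Qf (negPf h) mulmx0 /nsq /ip mulmx0 tre0 mulr0 mulr_ge0 // nsq_ge0.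
  rewrite -mulr_sumr (sum_nsq_proj hf hP) ler_wpM2l //; apply: le_trans trP _.
  rewrite size_map -cardE; apply: card_ge_level => //.
  by rewrite -(tre_eigm1 hrho) tr1.
have -> : \sum_(j | b < mu j) tre (f j *m (f j)^t* *m rho) = tre ((1%:M - Q) *m rho).
  rewrite -tre_sum -mulmx_suml; congr (tre (_ *m _)).
  rewrite /Q -f1 [in RHS](bigID (fun j => mu j <= b)) /= addrAC subrr add0r.
  by apply: eq_bigl => j; rewrite ltNge.
rewrite (tre_eigm_proj hrho (projC hP)) (tre_eigm_proj hrho (projC hQ)).
rewrite [X in _ <= X + _]big_mkcond -big_split /=; apply: ler_sum => k _.
(* Eigenvectors of [rho] with eigenvalue below [a] are charged in full. For the others [P] and [Q]
   agree on [e k], so only the mass removed by [Q] is lost. *)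
rewrite !nsq_projC // (nsq_onb k he); case: ifP => h.
  have := nsq_proj_le (e k) hQ; rewrite (nsq_onb k he) => h'.
  rewrite -[leLHS]addr0 lerD ?mulr_ge0 ?subr_ge0 //.
  by rewrite ler_piMr // lerBlDr lerDl nsq_ge0.
rewrite add0r; have -> // : P *m e k = Q *m e k.
rewrite -[in LHS]PQ -mulmxA Ps //; apply/mapP; exists k => //.
by rewrite mem_enum inE leNgt h.
Qed.

Lemma nsqD_le m n (A B : 'M[C]_(m, n)) : nsq (A + B) <= 2 * (nsq A + nsq B).
Proof.
have := nsq_ge0 (A - B); rewrite nsqB => h.
have -> : nsq (A + B) = nsq A + nsq B + 2 * ip A B.
  rewrite /nsq ipDr (ipC (A + B) A) (ipC (A + B) B) !ipDr (ipC B A).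
  by rewrite -/(nsq A) -/(nsq B); ring.
lra.
Qed.

Lemma min_mul_le (l u x y z : R) : 0 <= x -> 0 <= y -> 0 <= l -> 0 <= u ->
  z <= 2 * (x + y) -> 2^-1 * (Num.min l u * z) <= l * x + u * y.
Proof.
move=> x0 y0 l0 u0 hz; set m := Num.min l u.
have m1 : m <= l by rewrite ge_min lexx.
have m2 : m <= u by rewrite ge_min lexx orbT.
have m0 : 0 <= m by rewrite le_min l0 u0.
clearbody m; apply: (@le_trans _ _ (m * x + m * y)); last by rewrite lerD // ler_wpM2r.
by rewrite ler_pdivrMl // -mulrDr mulrCA ler_wpM2l.
Qed.

(* Nussbaum--Szkola lower bound on the errors of a quantum hypothesis test. *)
Lemma test_lower_bound (K J : finType) n (rho sigma T T' : 'M[C]_n) (lam : K -> R) (mu : J -> R) e f t :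
  eigm rho lam e -> eigm sigma mu f -> psdm T -> psdm T' -> T + T' = 1%:M -> 0 <= t ->
  2^-1 * (\sum_i \sum_j Num.min (lam i) (t * mu j) * nsq ((e i)^t* *m f j)) <=
    tre (T' *m rho) + t * tre (T *m sigma).
Proof.
move=> hrho hsig hT hT' TT1 t0; have [he lam0 rhoE] := hrho; have [hf mu0 sigE] := hsig.
have TH := psdm_adj hT; have TH' := psdm_adj hT'.
have T1 : T *m T + T *m T' = T by rewrite -mulmxDr TT1 mulmx1.
have T2 : T *m T + T' *m T = T by rewrite -mulmxDl TT1 mul1mx.
have T3 : T *m T' + T' *m T' = T' by rewrite -mulmxDl TT1 mul1mx.
have cTT : T *m T' = T' *m T by apply: (@addrI _ (T *m T)); rewrite T1 T2.
(* The test need not be projective. Since [T - T^2 = T' - T'^2 = T T'] is positive, replacing the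
   two effects by their squares only lowers the errors. *)
have pTT : psdm (T *m T').
  have -> : T *m T' = T^t* *m T' *m T + T'^t* *m T *m T'.
    rewrite TH TH' -[LHS]mulmx1 -TT1 mulmxDr; congr (_ + _).
    by rewrite cTT.
  by apply: psdmD; exact: psdm_conj.
have h1 : \sum_i lam i * nsq (T' *m e i) <= tre (T' *m rho).
  rewrite -(tre_eigm T' hrho) TH' -subr_ge0 -treB -mulmxBl.
  rewrite -{1}T3 addrK.
  by apply: tre_mul_ge0 => //; exact: eigm_psdm hrho.
have h2 : \sum_j mu j * nsq (T *m f j) <= tre (T *m sigma).
  rewrite -(tre_eigm T hsig) TH -subr_ge0 -treB -mulmxBl.
  rewrite -{1}T1 addrAC subrr add0r.
  by apply: tre_mul_ge0 => //; exact: eigm_psdm hsig.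
have h3 : t * \sum_j mu j * nsq (T *m f j) <= t * tre (T *m sigma) by rewrite ler_wpM2l.
apply: le_trans (lerD h1 h3).
(* Each squared norm is expanded in the other eigenbasis, so that both errors run over the same
   pairs. The overlap then splits by [T' + T = 1], and the square of a sum of two terms costs the
   factor 1/2. *)
under [X in _ <= X + _]eq_bigr => i _.
  rewrite -(parseval _ hf) mulr_sumr; under eq_bigr => j _.
    rewrite -nsq_adj adjmxM adjmxM TH' trmxCK; over.
  over.
rewrite [X in _ <= _ + X]mulr_sumr; under [X in _ <= _ + X]eq_bigr => j _.
  rewrite -(parseval _ he) !mulr_sumr; over.
rewrite [X in _ <= _ + X]exchange_big /= -big_split mulr_sumr /=; apply: ler_sum => i _.
rewrite -big_split mulr_sumr /=; apply: ler_sum => j _.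
have -> : (e i)^t* *m f j = (e i)^t* *m T' *m f j + (e i)^t* *m (T *m f j).
  by rewrite (mulmxA _ T) -mulmxDl -mulmxDr (addrC T') TT1 mulmx1.
have := nsqD_le ((e i)^t* *m T' *m f j) ((e i)^t* *m (T *m f j)).
by rewrite [t * (_ * _)]mulrA; apply: min_mul_le; rewrite ?nsq_ge0 ?mulr_ge0.
Qed.

End Decoder.

(** * Spectral decompositions of operators *)

Section Operators.
Variable R : realType.
Local Notation C := R[i].

Lemma big_enum_valT (T : finType) (V : nmodType) (F : T -> V) :
  \sum_(i < #|T|) F (enum_val i) = \sum_t F t.
Proof. by rewrite -(big_enum_val F); apply: eq_bigl. Qed.

(** A spectral decomposition by entries on the basis type itself: for tensor and n-fold products it
    is the entrywise product, with no reindexing by [enum_val]. *)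
Definition eigd (K T : finType) (A : Op R T) (lam : K -> R) (U : K -> T -> C) :=
  [/\ forall k, 0 <= lam k,
      forall k l, \sum_t (U k t)^*%C * U l t = (k == l)%:R,
      forall s t, \sum_k U k s * (U k t)^*%C = (s == t)%:R &
      forall s t, A s t = \sum_k (lam k)%:C * (U k s * (U k t)^*%C)].

Definition colv (K T : finType) (U : K -> T -> C) (k : K) : 'cV[C]_#|T| :=
  \col_i U k (enum_val i).

Lemma eigd_eigm (K T : finType) (A : Op R T) (lam : K -> R) U :
  eigd A lam U -> eigm (mx_of A) lam (colv U).
Proof.
case=> h1 h2 h3 h4; split => //; first split.
- move=> k l; apply/matrixP => i j; rewrite !ord1 !mxE eqxx mulr1n -h2 -[RHS]big_enum_valT.
  by apply: eq_bigr => x _; rewrite !mxE.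
- apply/matrixP => i j; rewrite summxE !mxE -(inj_eq enum_val_inj) -h3.
  by apply: eq_bigr => k _; rewrite !mxE big_ord1 !mxE.
- apply/matrixP => i j; rewrite summxE mxE h4; apply: eq_bigr => k _.
  by rewrite !mxE big_ord1 !mxE.
Qed.

(** Transition probabilities between two eigenbases, doubly stochastic by completeness of both;
    times the eigenvalues they form the Nussbaum-Szkola laws. *)
Definition overlap (K J T : finType) (U : K -> T -> C) (V : J -> T -> C) k j : R :=
  nsqc (\sum_t (U k t)^*%C * V j t).

Lemma nsq_overlap (K J T : finType) (U : K -> T -> C) (V : J -> T -> C) k j :
  nsq ((colv U k)^t* *m colv V j) = overlap U V k j.
Proof.
rewrite nsqE !big_ord1 !mxE /overlap -[in RHS]big_enum_valT; congr nsqc.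
by apply: eq_bigr => x _; rewrite !mxE.
Qed.

Lemma psdE (T : finType) (A : Op R T) (v : T -> C) :
  \sum_i \sum_j (v i)^*%C * A i j * v j =
  ((\col_i v (enum_val i))^t* *m mx_of A *m \col_i v (enum_val i)) 0 0.
Proof.
rewrite mxE exchange_big -big_enum_valT; apply: eq_bigr => j _.
rewrite !mxE mulr_suml -big_enum_valT; apply: eq_bigr => i _.
by rewrite !mxE.
Qed.

Lemma psd_qf (T : finType) (A : Op R T) : psd A -> forall v : 'cV[C]_#|T|,
  0 <= (v^t* *m mx_of A *m v) 0 0.
Proof.
move=> h v; have := h (fun t => v (enum_rank t) 0); rewrite psdE.
set w := \col_i _; suff -> : w = v by [].
by apply/matrixP => i j; rewrite ord1 mxE enum_valK.
Qed.

Lemma psdm_psd (T : finType) (A : Op R T) : psdm (mx_of A) -> psd A.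
Proof.
move=> [k [V E]] v; rewrite psdE E !mulmxA -mulmxA -adjmxM.
rewrite [X in 0 <= X](_ : _ = \tr ((V *m \col_i v (enum_val i))^t* *m (V *m \col_i v (enum_val i)))).
  by rewrite mxtrace_gram ler0c nsq_ge0.
by rewrite /mxtrace big_ord1.
Qed.

(** Polarization: real values at [u + w] and [u + i w] force the sesquilinear form to be Hermitian.
    It is used because [psd] speaks of the quadratic form alone. *)
Lemma qf_real_herm n (M : 'M[C]_n) : (forall v : 'cV[C]_n, (v^t* *m M *m v) 0 0 \is Num.real) ->
  M^t* = M.
Proof.
move=> h; pose b (u w : 'cV[C]_n) := (u^t* *m M *m w) 0 0.
have hb v : (b v v)^*%C = b v v by apply/CrealP; exact: h.
have bDl u v w : b (u + v) w = b u w + b v w by rewrite /b adjmxD !mulmxDl mxE.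
have bDr u v w : b u (v + w) = b u v + b u w by rewrite /b mulmxDr mxE.
have bZr u (x : C) w : b u (x *: w) = x * b u w by rewrite /b -scalemxAr mxE.
have bZl u (x : C) w : b (x *: u) w = x^*%C * b u w.
  rewrite /b; have -> : (x *: u)^t* = x^*%C *: u^t*.
    by apply/matrixP => i j; rewrite !mxE; exact: rmorphM.
  by rewrite -!scalemxAl mxE.
have bD u w (x : C) : b (u + x *: w) (u + x *: w) =
    b u u + x * b u w + x^*%C * b w u + x * x^*%C * b w w.
  rewrite bDl !bDr !bZr !bZl.
  by move: (b u u) (b u w) (b w u) (b w w) x^*%C => p q r s y; ring.
have bJ u w : (b u w)^*%C = b w u.
  have h1 := hb (u + 1 *: w); have h2 := hb (u + 'i%C *: w).
  move: h1 h2; rewrite !bD.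
  have := hb u; have := hb w; case: (b u u) => a1 a2; case: (b w w) => d1 d2.
  case: (b u w) => p1 p2; case: (b w u) => q1 q2.
  move=> [] e1 [] e2 /= [] e3 [] e4; apply/eqP; rewrite eq_complex /=.
  by apply/andP; split; apply/eqP; lra.
apply/matrixP => i j; rewrite !mxE.
have bE k l : M k l = b (delta_mx k 0) (delta_mx l 0).
  by rewrite /b trmx_delta map_delta_mx -mulmxA -rowE -colE !mxE.
by rewrite (bE j i) (bE i j); exact: bJ.
Qed.

Lemma psd_eigd (T : finType) (A : Op R T) : psd A ->
  exists (lam : T -> R) (U : T -> T -> C), eigd A lam U.
Proof.
move=> hA; have hq := psd_qf hA; pose M := mx_of A; have MH : M^t* = M.
  by apply: qf_real_herm => v; exact/ger0_real/hq.
have MN : M \is normalmx by apply/normalmxP; rewrite MH.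
have PE := invmx_unitary (spectral_unitarymx M).
have /orthomx_spectralP := MN; move: PE; set P := spectralmx M; set d := spectral_diag M => PE ME.
have PU : P *m P^t* = 1%:M by apply/unitarymxP; exact: spectral_unitarymx.
have PV : P^t* *m P = 1%:M by apply: mulmx1C.
rewrite PE {PE} in ME; clearbody P d.
have d0 i : 0 <= d 0 i.
  have -> : d 0 i = ((row i P)^t*^t* *m M *m (row i P)^t*) 0 0.
    have : (P *m M *m P^t*) i i = d 0 i.
      by rewrite ME !mulmxA PU mul1mx -mulmxA PU mulmx1 mxE eqxx mulr1n.
    by move=> <-; rewrite trmxCK -row_mul !mxE; apply: eq_bigr => k _; rewrite !mxE.
  exact: hq.
(* The rows of the unitary [P] are the adjoint eigenvectors, hence the conjugates. *)
exists (fun k => complex.Re (d 0 (enum_rank k))), (fun k t => (P (enum_rank k) (enum_rank t))^*%C).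
have dE i : d 0 i = (complex.Re (d 0 i))%:C.
  by have := d0 i; case: (d 0 i) => a b; rewrite lecE /= => /andP[/eqP -> _].
have rE (F : 'I_#|T| -> C) : \sum_(t : T) F (enum_rank t) = \sum_i F i.
  by rewrite -big_enum_valT; apply: eq_bigr => i _; rewrite enum_valK.
split.
- by move=> k; have := d0 (enum_rank k); rewrite dE ler0c.
- move=> k l; move/matrixP: PU => /(_ (enum_rank k) (enum_rank l)).
  rewrite !mxE (inj_eq enum_rank_inj) => <-.
  rewrite (rE (fun i => (P (enum_rank k) i)^*%C^*%C * (P (enum_rank l) i)^*%C)).
  by apply: eq_bigr => i _; rewrite conjcK !mxE.
- move=> s t; move/matrixP: PV => /(_ (enum_rank s) (enum_rank t)).
  rewrite !mxE (inj_eq enum_rank_inj) => <-.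
  rewrite (rE (fun i => (P i (enum_rank s))^*%C * (P i (enum_rank t))^*%C^*%C)).
  by apply: eq_bigr => i _; rewrite conjcK !mxE.
move=> s t; have -> : A s t = M (enum_rank s) (enum_rank t) by rewrite mxE !enum_rankK.
rewrite ME !mxE (rE (fun i => (complex.Re (d 0 i))%:C *
  ((P i (enum_rank s))^*%C * (P i (enum_rank t))^*%C^*%C))).
apply: eq_bigr => i _; rewrite -dE conjcK mul_mx_diag !mxE.
by rewrite mulrA [d 0 i * _]mulrC.
Qed.

Lemma eigd_psd (K T : finType) (A : Op R T) (lam : K -> R) U : eigd A lam U -> psd A.
Proof. by move/eigd_eigm/eigm_psdm/psdm_psd. Qed.

Lemma psd_psdm (T : finType) (A : Op R T) : psd A -> psdm (mx_of A).
Proof. by move/psd_eigd => [lam [U /eigd_eigm/eigm_psdm]]. Qed.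

Definition op_of (T : finType) (M : 'M[C]_#|T|) : Op R T :=
  fun s t => M (enum_rank s) (enum_rank t).

Lemma op_ofK (T : finType) (M : 'M[C]_#|T|) : mx_of (op_of M) = M.
Proof. by apply/matrixP => i j; rewrite mxE /op_of !enum_valK. Qed.

Lemma mx_of_id (T : finType) : mx_of (@op_id R T) = 1%:M.
Proof. by apply/matrixP => i j; rewrite !mxE /op_id (inj_eq enum_val_inj). Qed.

Lemma mx_of_sub (T : finType) (A B : Op R T) : mx_of (op_sub A B) = mx_of A - mx_of B.
Proof. by apply/matrixP => i j; rewrite !mxE. Qed.

Lemma mx_of_mul (T : finType) (A B : Op R T) : mx_of (op_mul A B) = mx_of A *m mx_of B.
Proof.
apply/matrixP => i j; rewrite !mxE /op_mul -big_enum_valT.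
by apply: eq_bigr => k _; rewrite !mxE.
Qed.

Lemma op_trE (T : finType) (A : Op R T) : op_tr A = \tr (mx_of A).
Proof. by rewrite /op_tr -big_enum_valT; apply: eq_bigr => k _; rewrite !mxE. Qed.

Lemma povm_povmm (T M : finType) (L : M -> Op R T) : povm L <-> povmm (fun m => mx_of (L m)).
Proof.
split=> -[h1 h2]; split.
- by move=> m; exact: psd_psdm.
- apply/matrixP => i j; rewrite summxE -mx_of_id mxE -h2.
  by apply: eq_bigr => m _; rewrite mxE.
- by move=> m; exact/psdm_psd/h1.
- move=> s t; move/matrixP: h2 => /(_ (enum_rank s) (enum_rank t)).
  rewrite summxE -mx_of_id mxE !enum_rankK => <-.
  by apply: eq_bigr => m _; rewrite mxE !enum_rankK.
Qed.

Lemma op_of_povm (T M : finType) (L : M -> 'M[C]_#|T|) : povmm L -> povm (fun m => op_of (L m)).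
Proof.
by move=> h; apply/povm_povmm; rewrite (_ : (fun _ => _) = L) //; apply/funext => m; rewrite op_ofK.
Qed.

Definition trop (T : finType) (A B : Op R T) : R := tre (mx_of A *m mx_of B).

Lemma op_tr_mul (T : finType) (A B : Op R T) : psd A -> psd B ->
  op_tr (op_mul A B) = (trop A B)%:C.
Proof.
by move=> hA hB; rewrite op_trE mx_of_mul; apply: tre_mul_real; exact: psd_psdm.
Qed.

Lemma trop_ge0 (T : finType) (A B : Op R T) : psd A -> psd B -> 0 <= trop A B.
Proof. by move=> hA hB; apply: tre_mul_ge0; exact: psd_psdm. Qed.

Lemma tropE (T : finType) (A B : Op R T) : trop A B = complex.Re (\sum_s \sum_t A s t * B t s).
Proof. by rewrite /trop /tre -mx_of_mul -op_trE. Qed.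

Lemma eigd_tens (K1 K2 T1 T2 : finType) (A : Op R T1) (B : Op R T2)
    (lam : K1 -> R) (mu : K2 -> R) U V :
  eigd A lam U -> eigd B mu V ->
  eigd (op_tens A B) (fun k : K1 * K2 => lam k.1 * mu k.2) (fun k t => U k.1 t.1 * V k.2 t.2).
Proof.
have pairE (I J : finType) (F : I -> C) (G : J -> C) :
    \sum_(p : I * J) F p.1 * G p.2 = (\sum_i F i) * (\sum_j G j).
  rewrite mulr_suml -(pair_bigA _ (fun i j => F i * G j)).
  by apply: eq_bigr => i _; rewrite mulr_sumr.
have eqE (I J : finType) (p q : I * J) : (p == q)%:R = (p.1 == q.1)%:R * (p.2 == q.2)%:R :> C.
  by rewrite -mulnb natrM.
move=> [a1 a2 a3 a4] [b1 b2 b3 b4]; split.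
- by move=> k; rewrite mulr_ge0.
- move=> k l; rewrite eqE -a2 -b2 -pairE.
  by apply: eq_bigr => t _; rewrite rmorphM; ring.
- move=> s t; rewrite eqE -a3 -b3 -pairE.
  by apply: eq_bigr => k _; rewrite rmorphM; ring.
- move=> s t; rewrite /op_tens a4 b4 -pairE.
  by apply: eq_bigr => k _; rewrite !rmorphM /=; ring.
Qed.

Lemma psd_tens (T1 T2 : finType) (A : Op R T1) (B : Op R T2) :
  psd A -> psd B -> psd (op_tens A B).
Proof.
move=> /psd_eigd[lam [U hA]] /psd_eigd[mu [V hB]].
exact: eigd_psd (eigd_tens hA hB).
Qed.

Definition prodop (n : nat) (T : finType) (A : 'I_n -> Op R T) : Op R {ffun 'I_n -> T} :=
  fun s t => \prod_i A i (s i) (t i).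

Definition prodv (n : nat) (K T : finType) (U : 'I_n -> K -> T -> C) :
  {ffun 'I_n -> K} -> {ffun 'I_n -> T} -> C := fun k t => \prod_i U i (k i) (t i).

Lemma prod_eqffun (F : comNzSemiRingType) (I T : finType) (f g : {ffun I -> T}) :
  \prod_i (f i == g i)%:R = (f == g)%:R :> F.
Proof.
have [->|fg] := eqVneq f g; first by rewrite big1 // => i _; rewrite eqxx.
have /existsP[i hi] : [exists i, f i != g i].
  apply: contraNT fg; rewrite negb_exists => /forallP h.
  by apply/eqP/ffunP => i; apply/eqP; have := h i; rewrite negbK.
by rewrite (bigD1 i) //= (negPf hi) mul0r.
Qed.

Lemma eigd_prod n (K T : finType) (A : 'I_n -> Op R T) (lam : 'I_n -> K -> R) U :
  (forall i, eigd (A i) (lam i) (U i)) ->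
  eigd (prodop A) (fun k : {ffun 'I_n -> K} => \prod_i lam i (k i)) (prodv U).
Proof.
move=> h; split.
- by move=> k; apply: prodr_ge0 => i _; case: (h i).
- move=> k l; rewrite -prod_eqffun.
  transitivity (\sum_(t : {ffun 'I_n -> T}) \prod_i ((U i (k i) (t i))^*%C * U i (l i) (t i))).
    by apply: eq_bigr => t _; rewrite big_split rmorph_prod.
  rewrite -(bigA_distr_bigA (fun i t => (U i (k i) t)^*%C * U i (l i) t)).
  by apply: eq_bigr => i _; case: (h i).
- move=> s t; rewrite -prod_eqffun.
  transitivity (\sum_(k : {ffun 'I_n -> K}) \prod_i (U i (k i) (s i) * (U i (k i) (t i))^*%C)).
    by apply: eq_bigr => k _; rewrite big_split rmorph_prod.
  rewrite -(bigA_distr_bigA (fun i k => U i k (s i) * (U i k (t i))^*%C)).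
  by apply: eq_bigr => i _; case: (h i).
- move=> s t; rewrite /prodop.
  transitivity (\sum_(k : {ffun 'I_n -> K}) \prod_i
      ((lam i (k i))%:C * (U i (k i) (s i) * (U i (k i) (t i))^*%C))).
    rewrite -(bigA_distr_bigA (fun i k => (lam i k)%:C * (U i k (s i) * (U i k (t i))^*%C))).
    by apply: eq_bigr => i _; case: (h i).
  by apply: eq_bigr => k _; rewrite !big_split !rmorph_prod.
Qed.

Lemma overlap_prod n (K J T : finType) (U : 'I_n -> K -> T -> C) (V : 'I_n -> J -> T -> C) k j :
  overlap (prodv U) (prodv V) k j = \prod_i overlap (U i) (V i) (k i) (j i).
Proof.
rewrite /overlap.
transitivity (nsqc (\prod_i \sum_t (U i (k i) t)^*%C * V i (j i) t)).
  rewrite bigA_distr_bigA; congr nsqc.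
  by apply: eq_bigr => t _; rewrite big_split rmorph_prod.
by apply: (big_morph (@nsqc R)); [exact: nsqcM|exact: nsqc1].
Qed.

Lemma eigd_tr (K T : finType) (A : Op R T) (lam : K -> R) U : eigd A lam U ->
  op_tr A = (\sum_k lam k)%:C.
Proof.
case=> _ h2 _ h4; rewrite /op_tr rmorph_sum.
under eq_bigr => t _ do rewrite h4.
rewrite exchange_big; apply: eq_bigr => k _ /=.
rewrite -[RHS]mulr1; have <- : \sum_t (U k t)^*%C * U k t = 1 by rewrite h2 eqxx.
by rewrite mulr_sumr; apply: eq_bigr => t _; rewrite [U k t * _]mulrC.
Qed.

Lemma density_eigd (T : finType) (A : Op R T) : density A ->
  exists (lam : T -> R) (U : T -> T -> C), eigd A lam U /\ \sum_k lam k = 1.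
Proof.
move=> [/psd_eigd[lam [U h]] htr]; exists lam, U; split=> //.
by move: htr; rewrite (eigd_tr h) => -[].
Qed.

Lemma density_tre (T : finType) (A : Op R T) : density A -> tre (mx_of A) = 1.
Proof. by case=> _; rewrite op_trE /tre => ->. Qed.

Lemma eigd_density (K T : finType) (A : Op R T) (lam : K -> R) U : eigd A lam U ->
  \sum_k lam k = 1 -> density A.
Proof. by move=> h h1; split; [exact: eigd_psd h | rewrite (eigd_tr h) h1]. Qed.

Lemma density_prod n (T : finType) (A : 'I_n -> Op R T) : (forall i, density (A i)) ->
  density (prodop A).
Proof.
move=> h; have [lam hl] := choice (fun i => density_eigd (h i)).
have [U hU] := choice hl.
apply: (eigd_density (eigd_prod (fun i => proj1 (hU i)))).
by rewrite -(bigA_distr_bigA lam) big1 // => i _; case: (hU i).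
Qed.

Definition ptr1 (T1 T2 : finType) (A : Op R (T1 * T2)%type) : Op R T1 :=
  fun s t => \sum_b A (s, b) (t, b).
Definition ptr2 (T1 T2 : finType) (A : Op R (T1 * T2)%type) : Op R T2 :=
  fun s t => \sum_b A (b, s) (b, t).

(** Compression to the image of [f]: a test vector on [S] is extended by zero. It serves the partial
    traces and the reordering of the output systems. *)
Lemma psd_comp (S T : finType) (f : S -> T) (A : Op R T) : injective f ->
  psd A -> psd (fun s t => A (f s) (f t)).
Proof.
move=> fi hA v; pose w t : C := if [pick s | f s == t] is Some s then v s else 0.
have wf s : w (f s) = v s.
  rewrite /w; case: pickP => [x /eqP/fi -> //|/(_ s)]; by rewrite eqxx.
have := hA w; congr (_ <= _).
have E (F : T -> C) : (forall t, w t = 0 -> F t = 0) -> \sum_t F t = \sum_s F (f s).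
  move=> hF; rewrite (bigID (mem (f @: predT))) /= addrC big1 ?add0r; last first.
    move=> t ht; apply: hF; rewrite /w; case: pickP => // x /eqP xE.
    by move: ht; rewrite -xE imset_f.
  by rewrite big_imset /=; [apply: eq_bigl|move=> ? ? _ _; exact: fi].
rewrite E => [|t wt]; last by apply: big1 => j _; rewrite wt conjc0 !mul0r.
apply: eq_bigr => i _; rewrite E => [|t wt]; last by rewrite wt mulr0.
by apply: eq_bigr => j _; rewrite !wf.
Qed.

Lemma psd_sum (T I : finType) (A : I -> Op R T) : (forall i, psd (A i)) ->
  psd (fun s t => \sum_i A i s t).
Proof.
move=> h v; suff -> : \sum_i \sum_j (v i)^*%C * (\sum_i0 A i0 i j) * v j =
  \sum_x \sum_i \sum_j (v i)^*%C * A x i j * v j by apply: sumr_ge0 => x _; exact: h.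
rewrite [RHS]exchange_big; apply: eq_bigr => i _ /=; rewrite [RHS]exchange_big; apply: eq_bigr => j _ /=.
by rewrite mulr_sumr mulr_suml.
Qed.

Lemma density_ptr1 (T1 T2 : finType) (A : Op R (T1 * T2)%type) : density A -> density (ptr1 A).
Proof.
case=> h1 h2; split.
  by apply: psd_sum => b; apply: (psd_comp (f := fun s : T1 => (s, b))) => // ? ? [].
by rewrite -h2 /op_tr /ptr1 pair_bigA; apply: eq_bigr => -[].
Qed.

Lemma density_ptr2 (T1 T2 : finType) (A : Op R (T1 * T2)%type) : density A -> density (ptr2 A).
Proof.
case=> h1 h2; split.
  by apply: psd_sum => b; apply: (psd_comp (f := fun s : T2 => (b, s))) => // ? ? [].
by rewrite -h2 /op_tr /ptr2 exchange_big pair_bigA; apply: eq_bigr => -[].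
Qed.

Lemma psdZ (T : finType) (A : Op R T) (p : R) : 0 <= p -> psd A ->
  psd (fun s t => p%:C * A s t).
Proof.
move=> p0 h v; suff -> : \sum_i \sum_j (v i)^*%C * (p%:C * A i j) * v j =
  p%:C * \sum_i \sum_j (v i)^*%C * A i j * v j by rewrite mulr_ge0 ?ler0c.
rewrite mulr_sumr; apply: eq_bigr => i _; rewrite mulr_sumr; apply: eq_bigr => j _; ring.
Qed.

Definition mixop (X T : finType) (p : X -> R) (tau : X -> Op R T) : Op R T :=
  fun s t => \sum_x (p x)%:C * tau x s t.

Lemma density_mix (X T : finType) (p : X -> R) (tau : X -> Op R T) : is_pmf p ->
  (forall x, density (tau x)) -> density (mixop p tau).
Proof.
move=> [p0 p1] h; split.
  by apply: psd_sum => x; apply: psdZ => //; case: (h x).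
rewrite /op_tr exchange_big /= -[RHS]/(1%:C) -p1 rmorph_sum; apply: eq_bigr => x _.
by rewrite -mulr_sumr; case: (h x) => _; rewrite /op_tr => ->; rewrite mulr1.
Qed.

End Operators.

(** * Entropies of classical-quantum states *)

Section Entropy.
Variable R : realType.
Local Notation C := R[i].

Lemma char_poly_conj (F : comNzRingType) n (E D E' : 'M[F]_n) : E *m E' = 1%:M ->
  char_poly (E *m D *m E') = char_poly D.
Proof.
move=> EE; pose p (M : 'M[F]_n) : 'M[{poly F}]_n := map_mx polyC M.
have pE : p E *m p E' = 1%:M by rewrite /p -map_mxM EE map_mx1.
rewrite /char_poly /char_poly_mx !map_mxM /= -/(p E) -/(p D) -/(p E').
have -> : 'X%:M - p E *m p D *m p E' = p E *m ('X%:M - p D) *m p E'.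
  by rewrite mulmxBr mulmxBl mul_mx_scalar -scalemxAl pE scalemx1.
by rewrite !det_mulmx mulrAC -det_mulmx pE det1 mul1r.
Qed.

Lemma char_poly_eigm (K : finType) n (A : 'M[C]_n) (lam : K -> R) e : eigm A lam e ->
  char_poly A = \prod_(z <- [seq (lam k)%:C | k <- enum K]) ('X - z%:P).
Proof.
case=> -[h1 h2] _ AE.
pose E : 'M[C]_(n, #|K|) := \matrix_(i, k) e (enum_val k) i 0.
pose D : 'M[C]_#|K| := diag_mx (\row_k (lam (enum_val k))%:C).
have E1 : E *m E^t* = 1%:M.
  apply/matrixP => i j; rewrite -h2 summxE !mxE -(big_enum_valT).
  by apply: eq_bigr => k _; rewrite !mxE big_ord1 !mxE.
have E2 : E^t* *m E = 1%:M.
  apply/matrixP => k l; rewrite !mxE -(inj_eq enum_val_inj).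
  have /matrixP/(_ 0 0) := h1 (enum_val k) (enum_val l); rewrite !mxE eqxx mulr1n => <-.
  by apply: eq_bigr => i _; rewrite !mxE.
have AED : A = E *m D *m E^t*.
  apply/matrixP => i j; rewrite AE summxE mul_mx_diag !mxE -big_enum_valT.
  apply: eq_bigr => k _; rewrite !mxE big_ord1 !mxE; ring.
(* [E] has a left and a right inverse, so it is square; rewriting with [Kn] makes the conjugation
   well typed. *)
have Kn : #|K| = n.
  by apply/eqP; rewrite eqn_leq (mulmx1_min E1) (mulmx1_min E2).
have -> : char_poly A = char_poly D.
  clear AE h1 h2; clearbody D E; rewrite AED; move: E D E1 E2 {AED}; rewrite Kn => E D E1 E2.
  exact: char_poly_conj.
rewrite char_poly_trig ?diag_mx_is_trig // big_map big_enum [RHS]big_enum_val.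
by apply: eq_bigr => i _; rewrite !mxE eqxx mulr1n.
Qed.

(** [eigs] picks some list of roots of the characteristic polynomial. Such lists agree up to order,
    so every spectral decomposition computes the entropy. *)
Lemma entropy_eigd (K T : finType) (A : Op R T) (lam : K -> R) U : eigd A lam U ->
  entropy A = \sum_k negxlogx (lam k).
Proof.
move=> /eigd_eigm/char_poly_eigm hc; rewrite /entropy.
have /(xgetPex [::]) : exists s, [set s : seq C | char_poly (mx_of A) =
    \prod_(z <- s) ('X - z%:P)]%classic s by eexists; exact: hc.
rewrite -/(eigs _) /= hc => /prod_XsubC_eq h.
by rewrite -(perm_big _ h) /= big_map big_enum.
Qed.

Lemma sum_pair (I J : finType) (V : nmodType) (F : I * J -> V) :
  \sum_p F p = \sum_i \sum_j F (i, j).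
Proof. by rewrite pair_bigA; apply: eq_bigr => -[]. Qed.

Lemma sum_delta (I : finType) (F : I -> C) i : \sum_j (i == j)%:R * F j = F i.
Proof.
rewrite (bigD1 i) //= eqxx mul1r big1 ?addr0 // => j /negPf h.
by rewrite eq_sym h mul0r.
Qed.

Definition cq (Z T : finType) (w : Z -> R) (tau : Z -> Op R T) : Op R (Z * T)%type :=
  fun p q => (p.1 == q.1)%:R * (w p.1)%:C * tau p.1 p.2 q.2.

Lemma eigd_cq (Z K T : finType) (w : Z -> R) (tau : Z -> Op R T) (lam : Z -> K -> R) U :
  (forall z, 0 <= w z) -> (forall z, eigd (tau z) (lam z) (U z)) ->
  eigd (cq w tau) (fun k : Z * K => w k.1 * lam k.1 k.2)
    (fun k p => (k.1 == p.1)%:R * U k.1 k.2 p.2).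
Proof.
move=> w0 h; split.
- by move=> k; rewrite mulr_ge0 //; case: (h k.1).
- move=> [z k] [y l]; rewrite sum_pair /= xpair_eqE.
  transitivity (\sum_x (z == x)%:R * ((y == x)%:R * \sum_t (U z k t)^*%C * U y l t)).
    apply: eq_bigr => x _; rewrite !mulr_sumr; apply: eq_bigr => t _.
    by rewrite rmorphM rmorph_nat; ring.
  rewrite sum_delta; have [->|zy] := eqVneq y z; last by rewrite mul0r.
  by rewrite mul1r; case: (h z).
- move=> [x s] [y t]; rewrite sum_pair /= xpair_eqE.
  transitivity (\sum_z (x == z)%:R * ((z == y)%:R * \sum_k U z k s * (U z k t)^*%C)).
    apply: eq_bigr => z _; rewrite !mulr_sumr; apply: eq_bigr => k _.
    by rewrite rmorphM rmorph_nat (eq_sym x); ring.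
  rewrite sum_delta; have [->|] := eqVneq x y; last by rewrite mul0r.
  by rewrite mul1r; case: (h y).
move=> [x s] [y t]; rewrite sum_pair /cq /=.
transitivity (\sum_z (x == z)%:R * ((z == y)%:R * ((w z)%:C *
    \sum_k (lam z k)%:C * (U z k s * (U z k t)^*%C)))); last first.
  apply: eq_bigr => z _; rewrite !mulr_sumr; apply: eq_bigr => k _.
  by rewrite !rmorphM rmorph_nat (eq_sym x) /=; ring.
by rewrite sum_delta mulrA; case: (h x) => _ _ _ ->.
Qed.

Lemma eigd_diag (Z : finType) (w : Z -> R) : (forall z, 0 <= w z) ->
  eigd (fun z y => (z == y)%:R * (w z)%:C) w (fun k z => (k == z)%:R).
Proof.
move=> w0; split => //.
- by move=> k l; under eq_bigr => t _ do rewrite rmorph_nat; rewrite sum_delta eq_sym.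
- move=> s t; transitivity (\sum_k (s == k)%:R * (k == t)%:R : C).
    by apply: eq_bigr => k _; rewrite rmorph_nat eq_sym.
  by rewrite sum_delta.
move=> s t; transitivity (\sum_k (s == k)%:R * ((k == t)%:R * (w k)%:C)).
  by rewrite sum_delta.
by apply: eq_bigr => k _; rewrite rmorph_nat (eq_sym s); ring.
Qed.

Lemma log2M (x y : R) : 0 < x -> 0 < y -> log2 (x * y) = log2 x + log2 y.
Proof. by move=> x0 y0; rewrite /log2 lnM ?posrE // mulrDl. Qed.

Lemma negxlogx0 : negxlogx 0 = 0 :> R.
Proof. by rewrite /negxlogx lexx. Qed.

Lemma negxlogxE (x : R) : 0 <= x -> negxlogx x = - (x * log2 x).
Proof.
rewrite /negxlogx; case: ltrgt0P => // -> _.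
by rewrite mul0r oppr0.
Qed.

Lemma negxlogxM (x y : R) : 0 <= x -> 0 <= y ->
  negxlogx (x * y) = x * negxlogx y + y * negxlogx x.
Proof.
rewrite le_eqVlt => /orP[/eqP <-|x0]; first by rewrite !mul0r negxlogx0 mulr0 addr0.
rewrite le_eqVlt => /orP[/eqP <-|y0]; first by rewrite mulr0 mul0r negxlogx0 mulr0 addr0.
rewrite !negxlogxE ?mulr_ge0 ?ltW // log2M //; ring.
Qed.

(** Chain rule for a classical register. Its first sum is the entropy of the register, which cancels
    in each mutual information. *)
Lemma entropy_cq (Z T : finType) (w : Z -> R) (tau : Z -> Op R T) :
  (forall z, 0 <= w z) -> (forall z, density (tau z)) ->
  entropy (cq w tau) = \sum_z negxlogx (w z) + \sum_z w z * entropy (tau z).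
Proof.
move=> w0 h; have [lam hl] := choice (fun z => density_eigd (h z)).
have [U hU] := choice hl.
rewrite (entropy_eigd (eigd_cq w0 (fun z => proj1 (hU z)))) sum_pair -big_split.
apply: eq_bigr => z _ /=; case: (hU z) => hz h1; rewrite (entropy_eigd hz) mulr_sumr.
rewrite -[X in X + _]mul1r -h1 mulr_suml -big_split; apply: eq_bigr => k _ /=.
by rewrite negxlogxM // 1?addrC //; case: hz.
Qed.

Lemma entropy_diag (Z : finType) (w : Z -> R) : (forall z, 0 <= w z) ->
  entropy (fun z y => (z == y)%:R * (w z)%:C) = \sum_z negxlogx (w z).
Proof. by move=> /eigd_diag/entropy_eigd. Qed.

(** The Holevo quantity of an ensemble. Averaged over an independent [Y] in [cond_chi], it is
    I(X;B|Y) for product inputs. *)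
Definition chi (X T : finType) (p : X -> R) (tau : X -> Op R T) : R :=
  entropy (mixop p tau) - \sum_x p x * entropy (tau x).

Definition cond_chi (X Y T : finType) (p : X -> R) (r : Y -> R) (tau : X -> Y -> Op R T) : R :=
  \sum_y r y * chi p (tau^~ y).

(** If [f] and [g] split the index into complementary parts that [h] glues together, [marg] is the
    partial trace over the second part. *)
Lemma margE (T U V : finType) (f : T -> U) (g : T -> V) (h : U -> V -> T) (A : Op R T) u u' :
  (forall u v, f (h u v) = u) -> (forall u v, g (h u v) = v) ->
  (forall t, h (f t) (g t) = t) ->
  marg f g A u u' = \sum_v A (h u v) (h u' v).
Proof.
move=> fh gh hfg; rewrite /marg.
rewrite (reindex_onto (h u) g) /=; last by move=> t /eqP <-.
rewrite (eq_bigl predT); last by move=> v; rewrite fh gh !eqxx.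
apply: eq_bigr => v _; rewrite (big_pred1 (h u' v)) // => t.
rewrite gh /=; apply/andP/eqP => [[/eqP <- /eqP ->]|->]; first by rewrite hfg.
by rewrite fh gh !eqxx.
Qed.

End Entropy.

(** * Mutual informations as Holevo quantities *)

Section Informations.
Variable R : realType.
Local Notation C := R[i].
Variables (X1 X2 B1 B2 : finType) (rho : X1 -> X2 -> Op R (B1 * B2)%type).
Hypothesis hrho : forall x1 x2, density (rho x1 x2).

Let rho1 x1 x2 := ptr1 (rho x1 x2).
Let rho2 x1 x2 := ptr2 (rho x1 x2).

Let tr_rho x1 x2 : \sum_b1 \sum_b2 rho x1 x2 (b1, b2) (b1, b2) = 1.
Proof. by have [_ <-] := hrho x1 x2; rewrite /op_tr sum_pair. Qed.

Section Theta.
Variables (Q : finType) (pQ : Q -> R) (p1 : Q -> X1 -> R) (p2 : Q -> X2 -> R).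
Hypotheses (hQ : is_pmf pQ) (h1 : forall q, is_pmf (p1 q)) (h2 : forall q, is_pmf (p2 q)).
Local Notation th := (theta rho pQ p1 p2).
Local Notation q t := t.1.1.1.1.
Local Notation x1 t := t.1.1.1.2.
Local Notation x2 t := t.1.1.2.
Local Notation b1 t := t.1.2.
Local Notation b2 t := t.2.

Let sum1 q0 (z : C) : \sum_x (p1 q0 x)%:C * z = z.
Proof. by rewrite -mulr_suml -rmorph_sum; case: (h1 q0) => _ ->; rewrite mul1r. Qed.
Let sum2 q0 (z : C) : \sum_x (p2 q0 x)%:C * z = z.
Proof. by rewrite -mulr_suml -rmorph_sum; case: (h2 q0) => _ ->; rewrite mul1r. Qed.

Let trm x1 x2 (z : C) : \sum_b1 \sum_b2 z * rho x1 x2 (b1, b2) (b1, b2) = z.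
Proof.
rewrite -[RHS]mulr1 -(tr_rho x1 x2) mulr_sumr; apply: eq_bigr => b _.
by rewrite mulr_sumr.
Qed.

Lemma marg_qx2b1 : marg (fun t => (q t, x2 t, b1 t)) (fun t => (x1 t, b2 t)) th =
  cq (fun z : Q * X2 => pQ z.1 * p2 z.1 z.2) (fun z => mixop (p1 z.1) (rho1^~ z.2)).
Proof.
apply/funext => -[[a c] d]; apply/funext => -[[a' c'] d'].
rewrite (margE (h := fun u v => (u.1.1, v.1, u.1.2, u.2, v.2))); try by repeat first [case | move=> ?].
rewrite sum_pair /cq /= /theta /= xpair_eqE /mixop mulr_sumr; apply: eq_bigr => x _.
rewrite eqxx /= /rho1 /ptr1 !mulr_sumr; apply: eq_bigr => b _.
by rewrite !rmorphM /=; ring.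
Qed.

Lemma marg_qx1b2 : marg (fun t => (q t, x1 t, b2 t)) (fun t => (x2 t, b1 t)) th =
  cq (fun z : Q * X1 => pQ z.1 * p1 z.1 z.2) (fun z => mixop (p2 z.1) (rho2 z.2)).
Proof.
apply/funext => -[[a c] d]; apply/funext => -[[a' c'] d'].
rewrite (margE (h := fun u v => (u.1.1, u.1.2, v.1, v.2, u.2))); try by repeat first [case | move=> ?].
rewrite sum_pair /cq /= /theta /= xpair_eqE /mixop mulr_sumr; apply: eq_bigr => x _.
rewrite eqxx andbT /= /rho2 /ptr2 !mulr_sumr; apply: eq_bigr => b _.
by rewrite !rmorphM /=; ring.
Qed.

Lemma marg_qx1x2b1 : marg (fun t => (q t, x1 t, x2 t, b1 t)) (fun t => b2 t) th =
  cq (fun z : Q * X1 * X2 => pQ z.1.1 * p1 z.1.1 z.1.2 * p2 z.1.1 z.2) (fun z => rho1 z.1.2 z.2).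
Proof.
apply/funext => -[[[a c] d] e]; apply/funext => -[[[a' c'] d'] e'].
rewrite (margE (h := fun u v => (u.1.1.1, u.1.1.2, u.1.2, u.2, v))); try by repeat first [case | move=> ?].
by rewrite /cq /= /theta /= !xpair_eqE -andbA /rho1 /ptr1 mulr_sumr.
Qed.

Lemma marg_qx1x2b2 : marg (fun t => (q t, x1 t, x2 t, b2 t)) (fun t => b1 t) th =
  cq (fun z : Q * X1 * X2 => pQ z.1.1 * p1 z.1.1 z.1.2 * p2 z.1.1 z.2) (fun z => rho2 z.1.2 z.2).
Proof.
apply/funext => -[[[a c] d] e]; apply/funext => -[[[a' c'] d'] e'].
rewrite (margE (h := fun u v => (u.1.1.1, u.1.1.2, u.1.2, v, u.2))); try by repeat first [case | move=> ?].
by rewrite /cq /= /theta /= !xpair_eqE -andbA /rho2 /ptr2 mulr_sumr.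
Qed.

Lemma marg_qx1x2 : marg (fun t => (q t, x1 t, x2 t)) (fun t => (b1 t, b2 t)) th =
  (fun z y : Q * X1 * X2 => (z == y)%:R * (pQ z.1.1 * p1 z.1.1 z.1.2 * p2 z.1.1 z.2)%:C).
Proof.
apply/funext => -[[a c] d]; apply/funext => -[[a' c'] d'].
rewrite (margE (h := fun u v => (u.1.1, u.1.2, u.2, v.1, v.2))); try by repeat first [case | move=> ?].
rewrite sum_pair /theta /= !xpair_eqE -andbA.
have [_|_] := boolP [&& _, _ & _]; first by rewrite mul1r; exact: trm.
by rewrite mul0r big1 // => b _; rewrite big1 // => b' _; rewrite mul0r.
Qed.

Lemma marg_qx2 : marg (fun t => (q t, x2 t)) (fun t => (x1 t, b1 t, b2 t)) th =
  (fun z y : Q * X2 => (z == y)%:R * (pQ z.1 * p2 z.1 z.2)%:C).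
Proof.
apply/funext => -[a c]; apply/funext => -[a' c'].
rewrite (margE (h := fun u v => (u.1, v.1.1, u.2, v.1.2, v.2))); try by repeat first [case | move=> ?].
rewrite !sum_pair /theta /= !xpair_eqE.
have [/andP[/eqP <- /eqP <-]|h] := boolP (_ && _).
  under eq_bigr => x _ do rewrite !eqxx trm mul1r mulrAC rmorphM mulrC.
  by rewrite sum1 mul1r.
by rewrite mul0r big1 // => x _; rewrite eqxx (negPf h) big1 // => b _; rewrite big1 // => b' _; rewrite !mul0r.
Qed.

Lemma marg_qx1 : marg (fun t => (q t, x1 t)) (fun t => (x2 t, b1 t, b2 t)) th =
  (fun z y : Q * X1 => (z == y)%:R * (pQ z.1 * p1 z.1 z.2)%:C).
Proof.
apply/funext => -[a c]; apply/funext => -[a' c'].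
rewrite (margE (h := fun u v => (u.1, u.2, v.1.1, v.1.2, v.2))); try by repeat first [case | move=> ?].
rewrite !sum_pair /theta /= !xpair_eqE.
have [/andP[/eqP <- /eqP <-]|h] := boolP (_ && _).
  under eq_bigr => x _ do rewrite !eqxx trm mul1r rmorphM mulrC.
  by rewrite sum2 mul1r.
by rewrite mul0r big1 // => x _; rewrite eqxx andbT (negPf h) big1 // => b _; rewrite big1 // => b' _; rewrite !mul0r.
Qed.

Let w1 z : 0 <= pQ z.1 * p1 z.1 z.2.
Proof. by rewrite mulr_ge0 //; [case: hQ|case: (h1 z.1)]. Qed.
Let w2 z : 0 <= pQ z.1 * p2 z.1 z.2.
Proof. by rewrite mulr_ge0 //; [case: hQ|case: (h2 z.1)]. Qed.
Let w3 z : 0 <= pQ z.1.1 * p1 z.1.1 z.1.2 * p2 z.1.1 z.2.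
Proof. by rewrite !mulr_ge0 //; [case: hQ|case: (h1 z.1.1)|case: (h2 z.1.1)]. Qed.

Lemma I_X1B1_X2QE : I_X1B1_X2Q rho pQ p1 p2 = \sum_q pQ q * cond_chi (p1 q) (p2 q) rho1.
Proof.
rewrite /I_X1B1_X2Q /Hm marg_qx2b1 marg_qx2 marg_qx1x2b1 marg_qx1x2.
rewrite !entropy_cq ?entropy_diag //; last 2 first.
- by move=> z; exact: density_ptr1.
- by move=> z; apply: density_mix => // x; exact: density_ptr1.
set S1 := \sum_z negxlogx _; set S2 := \sum_z negxlogx _.
transitivity (\sum_(z : Q * X2) pQ z.1 * p2 z.1 z.2 * entropy (mixop (p1 z.1) (rho1^~ z.2))
  - \sum_(z : Q * X1 * X2) pQ z.1.1 * p1 z.1.1 z.1.2 * p2 z.1.1 z.2 * entropy (rho1 z.1.2 z.2)).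
  ring.
rewrite !sum_pair -sumrB; apply: eq_bigr => a _; rewrite exchange_big /= -sumrB mulr_sumr.
apply: eq_bigr => b _; rewrite /chi mulrBr mulrBr mulrA !mulr_sumr; congr (_ - _).
by apply: eq_bigr => x _; ring.
Qed.

Lemma I_X2B2_X1QE : I_X2B2_X1Q rho pQ p1 p2 =
  \sum_q pQ q * cond_chi (p2 q) (p1 q) (fun x2 x1 => rho2 x1 x2).
Proof.
rewrite /I_X2B2_X1Q /Hm marg_qx1b2 marg_qx1 marg_qx1x2b2 marg_qx1x2.
rewrite !entropy_cq ?entropy_diag //; last 2 first.
- by move=> z; exact: density_ptr2.
- by move=> z; apply: density_mix => // x; exact: density_ptr2.
set S1 := \sum_z negxlogx _; set S2 := \sum_z negxlogx _.
transitivity (\sum_(z : Q * X1) pQ z.1 * p1 z.1 z.2 * entropy (mixop (p2 z.1) (rho2 z.2))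
  - \sum_(z : Q * X1 * X2) pQ z.1.1 * p1 z.1.1 z.1.2 * p2 z.1.1 z.2 * entropy (rho2 z.1.2 z.2)).
  ring.
rewrite !sum_pair -sumrB; apply: eq_bigr => a _; rewrite -sumrB mulr_sumr.
apply: eq_bigr => b _; rewrite /chi mulrBr mulrBr mulrA !mulr_sumr; congr (_ - _).
by apply: eq_bigr => x _; ring.
Qed.

End Theta.

Section Omega.
Variables (p1 : X1 -> R) (p2 : X2 -> R).
Hypotheses (h1 : is_pmf p1) (h2 : is_pmf p2).
Local Notation w := (omega rho p1 p2).
Local Notation x1 t := t.1.1.1.
Local Notation x2 t := t.1.1.2.
Local Notation b1 t := t.1.2.
Local Notation b2 t := t.2.

Let sum1 (z : C) : \sum_x (p1 x)%:C * z = z.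
Proof. by rewrite -mulr_suml -rmorph_sum; case: h1 => _ ->; rewrite mul1r. Qed.
Let sum2 (z : C) : \sum_x (p2 x)%:C * z = z.
Proof. by rewrite -mulr_suml -rmorph_sum; case: h2 => _ ->; rewrite mul1r. Qed.
Let trm x1 x2 (z : C) : \sum_b1 \sum_b2 z * rho x1 x2 (b1, b2) (b1, b2) = z.
Proof.
rewrite -[RHS]mulr1 -(tr_rho x1 x2) mulr_sumr; apply: eq_bigr => b _.
by rewrite mulr_sumr.
Qed.

Lemma marg_x2b1 : marg (fun t => (x2 t, b1 t)) (fun t => (x1 t, b2 t)) w =
  cq p2 (fun z => mixop p1 (rho1^~ z)).
Proof.
apply/funext => -[c d]; apply/funext => -[c' d'].
rewrite (margE (h := fun u v => (v.1, u.1, u.2, v.2))); try by repeat first [case | move=> ?].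
rewrite sum_pair /cq /= /omega /= /mixop mulr_sumr; apply: eq_bigr => x _.
rewrite eqxx /= /rho1 /ptr1 !mulr_sumr; apply: eq_bigr => b _.
by rewrite !rmorphM /=; ring.
Qed.

Lemma marg_x1b2 : marg (fun t => (x1 t, b2 t)) (fun t => (x2 t, b1 t)) w =
  cq p1 (fun z => mixop p2 (rho2 z)).
Proof.
apply/funext => -[c d]; apply/funext => -[c' d'].
rewrite (margE (h := fun u v => (u.1, v.1, v.2, u.2))); try by repeat first [case | move=> ?].
rewrite sum_pair /cq /= /omega /= /mixop mulr_sumr; apply: eq_bigr => x _.
rewrite eqxx andbT /= /rho2 /ptr2 !mulr_sumr; apply: eq_bigr => b _.
by rewrite !rmorphM /=; ring.
Qed.

Lemma marg_x1x2b1 : marg (fun t => (x1 t, x2 t, b1 t)) (fun t => b2 t) w =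
  cq (fun z : X1 * X2 => p1 z.1 * p2 z.2) (fun z => rho1 z.1 z.2).
Proof.
apply/funext => -[[c d] e]; apply/funext => -[[c' d'] e'].
rewrite (margE (h := fun u v => (u.1.1, u.1.2, u.2, v))); try by repeat first [case | move=> ?].
by rewrite /cq /= /omega /= !xpair_eqE /rho1 /ptr1 mulr_sumr.
Qed.

Lemma marg_x1x2b2 : marg (fun t => (x1 t, x2 t, b2 t)) (fun t => b1 t) w =
  cq (fun z : X1 * X2 => p1 z.1 * p2 z.2) (fun z => rho2 z.1 z.2).
Proof.
apply/funext => -[[c d] e]; apply/funext => -[[c' d'] e'].
rewrite (margE (h := fun u v => (u.1.1, u.1.2, v, u.2))); try by repeat first [case | move=> ?].
by rewrite /cq /= /omega /= !xpair_eqE /rho2 /ptr2 mulr_sumr.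
Qed.

Lemma marg_x1x2 : marg (fun t => (x1 t, x2 t)) (fun t => (b1 t, b2 t)) w =
  (fun z y : X1 * X2 => (z == y)%:R * (p1 z.1 * p2 z.2)%:C).
Proof.
apply/funext => -[c d]; apply/funext => -[c' d'].
rewrite (margE (h := fun u v => (u.1, u.2, v.1, v.2))); try by repeat first [case | move=> ?].
rewrite sum_pair /omega /= !xpair_eqE.
have [_|_] := boolP (_ && _); first by rewrite mul1r; exact: trm.
by rewrite mul0r big1 // => b _; rewrite big1 // => b' _; rewrite mul0r.
Qed.

Lemma marg_x2 : marg (fun t => x2 t) (fun t => (x1 t, b1 t, b2 t)) w =
  (fun z y : X2 => (z == y)%:R * (p2 z)%:C).
Proof.
apply/funext => c; apply/funext => c'.
rewrite (margE (h := fun u v => (v.1.1, u, v.1.2, v.2))); try by repeat first [case | move=> ?].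
rewrite !sum_pair /omega /=; have [_|h] := eqVneq c c'.
  under eq_bigr => x _ do rewrite !eqxx trm mul1r rmorphM.
  by rewrite sum1 mul1r.
by rewrite mul0r big1 // => x _; rewrite eqxx big1 // => b _; rewrite big1 // => b' _; rewrite !mul0r.
Qed.

Lemma marg_x1 : marg (fun t => x1 t) (fun t => (x2 t, b1 t, b2 t)) w =
  (fun z y : X1 => (z == y)%:R * (p1 z)%:C).
Proof.
apply/funext => c; apply/funext => c'.
rewrite (margE (h := fun u v => (u, v.1.1, v.1.2, v.2))); try by repeat first [case | move=> ?].
rewrite !sum_pair /omega /=; have [_|h] := eqVneq c c'.
  under eq_bigr => x _ do rewrite !eqxx trm mul1r rmorphM mulrC.
  by rewrite sum2 mul1r.
by rewrite mul0r big1 // => x _; rewrite big1 // => b _; rewrite big1 // => b' _; rewrite !mul0r.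
Qed.

Lemma marg_b2 : marg (fun t => b2 t) (fun t => (x1 t, x2 t, b1 t)) w =
  mixop p1 (fun x1 => mixop p2 (rho2 x1)).
Proof.
apply/funext => c; apply/funext => c'.
rewrite (margE (h := fun u v => (v.1.1, v.1.2, v.2, u))); try by repeat first [case | move=> ?].
rewrite !sum_pair /omega /mixop /=; apply: eq_bigr => x _; rewrite mulr_sumr; apply: eq_bigr => y _.
rewrite /rho2 /ptr2 !mulr_sumr; apply: eq_bigr => b _.
by rewrite !eqxx mul1r rmorphM mulrA.
Qed.

Lemma marg_b1 : marg (fun t => b1 t) (fun t => (x1 t, x2 t, b2 t)) w =
  mixop p2 (fun x2 => mixop p1 (rho1^~ x2)).
Proof.
apply/funext => c; apply/funext => c'.
rewrite (margE (h := fun u v => (v.1.1, v.1.2, u, v.2))); try by repeat first [case | move=> ?].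
rewrite !sum_pair exchange_big /omega /mixop /=; apply: eq_bigr => x _; rewrite mulr_sumr; apply: eq_bigr => y _.
rewrite /rho1 /ptr1 !mulr_sumr; apply: eq_bigr => b _.
by rewrite !eqxx mul1r rmorphM; ring.
Qed.

Let w1 z : 0 <= p1 z. Proof. by case: h1. Qed.
Let w2 z : 0 <= p2 z. Proof. by case: h2. Qed.
Let w3 z : 0 <= p1 z.1 * p2 z.2. Proof. by rewrite mulr_ge0. Qed.

Lemma I_X1B1_X2E : I_X1B1_X2 rho p1 p2 = cond_chi p1 p2 rho1.
Proof.
rewrite /I_X1B1_X2 /Hm marg_x2b1 marg_x2 marg_x1x2b1 marg_x1x2.
rewrite !entropy_cq ?entropy_diag //; last 2 first.
- by move=> z; exact: density_ptr1.
- by move=> z; apply: density_mix => // x; exact: density_ptr1.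
set S1 := \sum_z negxlogx _; set S2 := \sum_z negxlogx _.
transitivity (\sum_z p2 z * entropy (mixop p1 (rho1^~ z))
  - \sum_(z : X1 * X2) p1 z.1 * p2 z.2 * entropy (rho1 z.1 z.2)).
  ring.
rewrite !sum_pair exchange_big -sumrB; apply: eq_bigr => b _.
rewrite /chi mulrBr !mulr_sumr; congr (_ - _).
by apply: eq_bigr => x _ /=; ring.
Qed.

Lemma I_X2B2_X1E : I_X2B2_X1 rho p1 p2 = cond_chi p2 p1 (fun x2 x1 => rho2 x1 x2).
Proof.
rewrite /I_X2B2_X1 /Hm marg_x1b2 marg_x1 marg_x1x2b2 marg_x1x2.
rewrite !entropy_cq ?entropy_diag //; last 2 first.
- by move=> z; exact: density_ptr2.
- by move=> z; apply: density_mix => // x; exact: density_ptr2.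
set S1 := \sum_z negxlogx _; set S2 := \sum_z negxlogx _.
transitivity (\sum_z p1 z * entropy (mixop p2 (rho2 z))
  - \sum_(z : X1 * X2) p1 z.1 * p2 z.2 * entropy (rho2 z.1 z.2)).
  ring.
rewrite !sum_pair -sumrB; apply: eq_bigr => b _.
rewrite /chi mulrBr !mulr_sumr; congr (_ - _).
by apply: eq_bigr => x _ /=; ring.
Qed.

Lemma I_X1B2E : I_X1B2 rho p1 p2 = chi p1 (fun x1 => mixop p2 (rho2 x1)).
Proof.
rewrite /I_X1B2 /Hm marg_x1b2 marg_x1 marg_b2.
rewrite !entropy_cq ?entropy_diag //; last first.
  by move=> z; apply: density_mix => // x; exact: density_ptr2.
by rewrite /chi; ring.
Qed.

Lemma I_X2B1E : I_X2B1 rho p1 p2 = chi p2 (fun x2 => mixop p1 (rho1^~ x2)).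
Proof.
rewrite /I_X2B1 /Hm marg_x2b1 marg_x2 marg_b1.
rewrite !entropy_cq ?entropy_diag //; last first.
  by move=> z; apply: density_mix => // x; exact: density_ptr1.
by rewrite /chi; ring.
Qed.

End Omega.
End Informations.

(** * Typicality *)

Lemma ln2_gt0 (R : realType) : 0 < ln (2 : R).
Proof. by rewrite ln_gt0 // ltr1n. Qed.

Section Typicality.
Variable R : realType.

Let ln2_pos : 0 < ln (2 : R) := ln2_gt0 R.

Lemma invr_le_quadratic (x : R) : `|x| <= 2^-1 -> (1 - x)^-1 <= 1 + x + 2 * x ^+ 2.
Proof.
rewrite ler_norml => /andP[x1 x2].
have h : 0 < 1 - x by lra.
rewrite -(ler_pM2l h) mulfV ?gt_eqF // -subr_ge0.
have -> : (1 - x) * (1 + x + 2 * x ^+ 2) - 1 = x ^+ 2 * (1 - 2 * x) by ring.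
by rewrite mulr_ge0 ?sqr_ge0 //; lra.
Qed.

(** The scale for [weak_law]: [s * M] at most 1/2 keeps the Markov function in the range of
    [invr_le_quadratic], and the second-order term stays below the drift [s * d]. *)
Lemma small_scale (M d : R) : 1 <= M -> 0 < d ->
  exists2 s, 0 < s & s * M <= 2^-1 /\ 2 * (s * M) ^+ 2 < s * d.
Proof.
move=> M1 d0; pose c := 4 * M ^+ 2 * (d + 1).
have c0 : 0 < c by rewrite !mulr_gt0 ?exprn_gt0 //; lra.
exists (d / c); first by rewrite divr_gt0.
have sE : d / c * c = d by rewrite mulfVK // gt_eqF.
have s0 : 0 < d / c by rewrite divr_gt0.
clear c0; move: (d / c) s0 sE => s s0; rewrite {}/c => sE; split.
  have sM : 0 < s * M by rewrite mulr_gt0 //; lra.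
  rewrite leNgt; apply/negP => h.
  have : d < s * (4 * M ^+ 2 * (d + 1)); last by rewrite sE ltxx.
  have -> : s * (4 * M ^+ 2 * (d + 1)) = (s * M) * (M * (4 * (d + 1))) by ring.
  have h1 : 4 * (d + 1) <= M * (4 * (d + 1)) by rewrite ler_peMl //; lra.
  have h2 : (s * M) * (4 * (d + 1)) <= (s * M) * (M * (4 * (d + 1))) by rewrite ler_pM2l.
  have h3 : 2^-1 * (4 * (d + 1)) < (s * M) * (4 * (d + 1)) by rewrite ltr_pM2r //; lra.
  lra.
have -> : s * d = s * (s * (4 * M ^+ 2 * (d + 1))) by rewrite sE.
rewrite -subr_gt0.
have -> : s * (s * (4 * M ^+ 2 * (d + 1))) - 2 * (s * M) ^+ 2 = (s * M) ^+ 2 * (4 * d + 2) by ring.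
by rewrite mulr_gt0 ?exprn_gt0 ?mulr_gt0 //; lra.
Qed.

Lemma sum_shift n (F : 'I_n -> R) (c : R) : \sum_i (F i - c) = \sum_i F i - n%:R * c.
Proof. by rewrite sumrB sumr_const card_ord mulr_natl. Qed.

(* A large deviation bound through the multiplicative Markov function
   [1 / (1 - s g) >= exp (s g)], whose product moments factorize. *)
Lemma weak_law (K : finType) (w f : K -> R) (d : R) : is_pmf w -> 0 < d ->
  exists2 q : R, 0 <= q < 1 & forall n,
    \sum_(k : {ffun 'I_n -> K} | n%:R * (\sum_x w x * f x + d) <= \sum_i f (k i))
      \prod_i w (k i) <= q ^+ n.
Proof.
move=> [w0 w1] d0; have [m mE] : exists m, m = \sum_x w x * f x by eexists.
rewrite -mE; pose g x := f x - (m + d); pose M := 1 + \sum_x `|g x|.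
have gM x : `|g x| <= M.
  rewrite /M (bigD1 x) //=; have : 0 <= \sum_(i | i != x) `|g i| by apply: sumr_ge0.
  by have := normr_ge0 (g x); lra.
have M1 : 1 <= M by rewrite lerDl sumr_ge0.
have gm : \sum_x w x * g x = - d.
  rewrite /g; under eq_bigr => x _ do rewrite !mulrBr.
  by rewrite sumrB -mE -mulr_suml w1; ring.
have [s s0 [sM sd]] := small_scale M1 d0.
pose phi x := (1 - s * g x)^-1.
have sgM x : `|s * g x| <= s * M by rewrite normrM gtr0_norm // ler_pM2l.
have sg x : `|s * g x| <= 2^-1 by exact: le_trans (sgM x) sM.
have phi1 x : 0 < 1 - s * g x by have := sg x; rewrite ler_norml => /andP[_]; lra.
exists (\sum_x w x * phi x).
  apply/andP; split; first by apply: sumr_ge0 => x _; rewrite mulr_ge0 // invr_ge0 ltW.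
  (* The mean of [phi] is at most [1 - s d + 2 (s M)^2], which is below 1 by the choice of [s]. *)
  apply: (@le_lt_trans _ _ (\sum_x (w x + s * (w x * g x) + w x * (2 * (s * M) ^+ 2)))).
    apply: ler_sum => x _; have h := le_trans (invr_le_quadratic (sg x)) (lexx _).
    have h2 : (s * g x) ^+ 2 <= (s * M) ^+ 2.
      rewrite -[leLHS]real_normK ?num_real // ler_pXn2r ?nnegrE //.
      by rewrite (le_trans _ (sgM x)).
    have h3 : phi x <= 1 + s * g x + 2 * (s * M) ^+ 2 by rewrite /phi; lra.
    apply: le_trans (ler_wpM2l (w0 x) h3) _.
    by rewrite le_eqVlt; apply/orP; left; apply/eqP; ring.
  rewrite !big_split /= -mulr_sumr -mulr_suml w1 gm; lra.
move=> n; rewrite -[n in leRHS]card_ord -prodr_const.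
rewrite (eq_bigl predT) // bigA_distr_bigA /=.
rewrite big_mkcond; apply: ler_sum => k _.
have p0 : 0 <= \prod_i w (k i) by apply: prodr_ge0.
have q0 : 0 <= \prod_i phi (k i) by apply: prodr_ge0 => i _; rewrite invr_ge0 ltW.
rewrite big_split /=; case: ifP => [h|_]; last by rewrite mulr_ge0.
rewrite -[leLHS]mulr1 ler_wpM2l //.
(* On the event the sum of the [g (k i)] is nonnegative, so the product of the [1 - s g], at most
   the exponential of minus [s] times that sum, is at most 1 and its inverse dominates the
   indicator. *)
suff h1 : \prod_(i < n) (1 - s * g (k i)) <= 1.
  rewrite prodfV -[leLHS]invr1 lef_pV2 // posrE ?ltr01 //.
  by apply: prodr_gt0.
apply: (@le_trans _ _ (\prod_(i < n) expR (- (s * g (k i))))).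
  by apply: ler_prod => i _; rewrite ltW //= expR_ge1Dx.
rewrite -expR_sum expR_le1 sumrN oppr_le0 -mulr_sumr pmulr_rge0 //.
by rewrite sum_shift subr_ge0.
Qed.

Lemma log2_prod (I : finType) (x : I -> R) : (forall i, 0 < x i) ->
  log2 (\prod_i x i) = \sum_i log2 (x i).
Proof.
move=> h; suff [] : 0 < \prod_i x i /\ log2 (\prod_i x i) = \sum_i log2 (x i) by [].
apply: (big_rec2 (fun a b => 0 < a /\ log2 a = b)).
  by rewrite ltr01 /log2 ln1 mul0r.
by move=> i y1 y2 _ [y10 <-]; rewrite mulr_gt0 // log2M.
Qed.

Lemma ltr_powR2 (x y : R) : 0 < x -> (x < 2 `^ y) = (log2 x < y).
Proof.
by move=> x0; rewrite -ltr_ln ?posrE ?powR_gt0 // ln_powR /log2 ltr_pdivrMr.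
Qed.

Lemma ltr_powR2r (x y : R) : 0 < x -> (2 `^ y < x) = (y < log2 x).
Proof.
by move=> x0; rewrite -[LHS]ltr_ln ?posrE ?powR_gt0 // ln_powR /log2 ltr_pdivlMr.
Qed.

(** The sampled law [w] and the factor [x] are kept apart: in use [x] is an eigenvalue given letters
    that [w] also samples. Sequences of weight zero are discarded first, so only logarithms of
    positive numbers are added. *)
Lemma typical_low (K : finType) (w x : K -> R) (d : R) : is_pmf w -> 0 < d ->
  (forall k, 0 <= x k) -> (forall k, w k != 0 -> x k != 0) ->
  exists2 q : R, 0 <= q < 1 & forall n,
    \sum_(k : {ffun 'I_n -> K} |
        \prod_i x (k i) < 2 `^ (- (n%:R * (- (\sum_k w k * log2 (x k)) + d))))
      \prod_i w (k i) <= q ^+ n.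
Proof.
move=> hw d0 x0 wx; have [q hq h] := weak_law (fun k => - log2 (x k)) hw d0.
exists q => // n; apply: le_trans (h n); rewrite big_mkcond [leRHS]big_mkcond /=.
apply: ler_sum => k _; have [w0 _] := hw.
have p0 : 0 <= \prod_i w (k i) by apply: prodr_ge0.
case: ifP => [hk|_]; last by case: ifP.
have [->|pn0] := eqVneq (\prod_i w (k i)) 0; first by case: ifP.
rewrite ifT //.
have xk i : 0 < x (k i).
  rewrite lt_neqAle eq_sym x0 andbT wx //.
  by apply: contraNneq pn0 => wi; rewrite (bigD1 i) //= wi mul0r.
move: hk; rewrite ltr_powR2 ?prodr_gt0 // log2_prod // sumrN.
under [X in _ -> _ * (X + _) <= _]eq_bigr do rewrite mulrN.
by rewrite sumrN lerNr => /ltW.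
Qed.

Lemma typical_high (K : finType) (w x : K -> R) (d : R) : is_pmf w -> 0 < d ->
  (forall k, 0 <= x k) -> (forall k, w k != 0 -> x k != 0) ->
  exists2 q : R, 0 <= q < 1 & forall n,
    \sum_(k : {ffun 'I_n -> K} |
        2 `^ (- (n%:R * (- (\sum_k w k * log2 (x k)) - d))) < \prod_i x (k i))
      \prod_i w (k i) <= q ^+ n.
Proof.
move=> hw d0 x0 wx; have [q hq h] := weak_law (fun k => log2 (x k)) hw d0.
exists q => // n; apply: le_trans (h n); rewrite big_mkcond [leRHS]big_mkcond /=.
apply: ler_sum => k _; have [w0 _] := hw.
have p0 : 0 <= \prod_i w (k i) by apply: prodr_ge0.
case: ifP => [hk|_]; last by case: ifP.
have [->|pn0] := eqVneq (\prod_i w (k i)) 0; first by case: ifP.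
rewrite ifT //.
have xk i : 0 < x (k i).
  rewrite lt_neqAle eq_sym x0 andbT wx //.
  by apply: contraNneq pn0 => wi; rewrite (bigD1 i) //= wi mul0r.
by move: hk; rewrite ltr_powR2r ?prodr_gt0 // log2_prod // !(mulrDr, mulrN); lra.
Qed.

End Typicality.

(** * Achievability *)

Section Coding.
Variable R : realType.
Local Notation C := R[i].

Lemma sum_ffun_pair n (A B : finType) (V : nmodType) (F : {ffun 'I_n -> A * B} -> V) :
  \sum_f F f = \sum_(a : {ffun 'I_n -> A}) \sum_(b : {ffun 'I_n -> B}) F [ffun i => (a i, b i)].
Proof.
rewrite pair_bigA (reindex (fun p : {ffun 'I_n -> A} * {ffun 'I_n -> B} =>
  [ffun i => (p.1 i, p.2 i)])) //.
exists (fun f : {ffun 'I_n -> A * B} => ([ffun i => (f i).1], [ffun i => (f i).2])) => [[a b] _|f _].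
  by congr (_, _); apply/ffunP => i; rewrite !ffunE.
by apply/ffunP => i; rewrite !ffunE; case: (f i).
Qed.

(** Independent letters turn the average over codewords into a product of mixtures, whose spectrum
    [eigd_prod] provides. *)
Lemma mx_of_prodop_mix n (Y T : finType) (p : 'I_n -> Y -> R) (tau : 'I_n -> Y -> Op R T) :
  mx_of (prodop (fun i => mixop (p i) (tau i))) =
  \sum_(y : {ffun 'I_n -> Y}) (\prod_i p i (y i))%:C *: mx_of (prodop (fun i => tau i (y i))).
Proof.
apply/matrixP => s t; rewrite summxE !mxE /prodop /mixop bigA_distr_bigA.
by apply: eq_bigr => y _; rewrite !mxE big_split rmorph_prod.
Qed.

Lemma tre_ketbra_eigm (K : finType) n (A : 'M[C]_n) (lam : K -> R) e k : eigm A lam e ->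
  tre (e k *m (e k)^t* *m A) = lam k.
Proof.
case=> -[h1 _] _ ->; rewrite mulmx_sumr tre_sum (bigD1 k) //= big1 ?addr0 => [|j /negPf jk].
  rewrite -scalemxAr treZ -mulmxA (mulmxA _ (e k)) h1 eqxx mul1mx treC h1 eqxx.
  by rewrite /tre mxtrace1 mulr1.
rewrite -scalemxAr treZ -mulmxA (mulmxA _ (e j)) h1 eq_sym jk.
by rewrite raddf0 mul0mx mulmx0 tre0 mulr0.
Qed.

Lemma powR2_div (x y : R) : 2 `^ x / 2 `^ y = 2 `^ (x - y).
Proof. by rewrite -powRN -powRD // pnatr_eq0 implybT. Qed.

Lemma pmf_dep (Z Y : finType) (pZ : Z -> R) (p : Z -> Y -> R) : is_pmf pZ ->
  (forall z, is_pmf (p z)) -> is_pmf (fun k : Z * Y => pZ k.1 * p k.1 k.2).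
Proof.
move=> [z0 z1] h; split; first by move=> k; rewrite mulr_ge0 //; case: (h k.1).
rewrite sum_pair -[RHS]z1; apply: eq_bigr => z _ /=.
by rewrite -mulr_sumr; case: (h z) => _ ->; rewrite mulr1.
Qed.

Lemma pmf_prod n (Y : finType) (p : 'I_n -> Y -> R) : (forall i, is_pmf (p i)) ->
  is_pmf (fun y : {ffun 'I_n -> Y} => \prod_i p i (y i)).
Proof.
move=> h; split; first by move=> y; apply: prodr_ge0 => i _; case: (h i).
by rewrite -(bigA_distr_bigA p) big1 // => i _; case: (h i).
Qed.

Lemma entropy_log2 (K T : finType) (A : Op R T) (lam : K -> R) U : eigd A lam U ->
  entropy A = - \sum_k lam k * log2 (lam k).
Proof.
move=> h; rewrite (entropy_eigd h) -sumrN; apply: eq_bigr => k _.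
by rewrite negxlogxE //; case: h.
Qed.

Lemma eigd_pmf (K T : finType) (A : Op R T) (lam : K -> R) U : eigd A lam U -> density A ->
  is_pmf lam.
Proof.
move=> h [_ h1]; split; first by case: h.
by move: h1; rewrite (eigd_tr h) => -[].
Qed.

(* Conditionally on [z], the projectors test the states indexed by [y] against their average. *)
Lemma conditional_tests (Z Y T : finType) (pZ : Z -> R) (p : Z -> Y -> R)
    (tau : Z -> Y -> Op R T) (d : R) :
  is_pmf pZ -> (forall z, is_pmf (p z)) -> (forall z y, density (tau z y)) -> 0 < d ->
  exists2 q : R, 0 <= q < 1 & forall n,
    exists P : {ffun 'I_n -> Z} -> {ffun 'I_n -> Y} -> 'M[C]_#|{ffun 'I_n -> T}|,
    [/\ forall z y, proj (P z y),
        forall (z : {ffun 'I_n -> Z}) y, tre (P z y *m mx_of (prodop (fun i => mixop (p (z i)) (tau (z i))))) <=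
          2 `^ (- (n%:R * (\sum_z pZ z * chi (p z) (tau z) - 2 * d))) &
        \sum_(z : {ffun 'I_n -> Z}) \sum_(y : {ffun 'I_n -> Y}) (\prod_i pZ (z i)) * (\prod_i p (z i) (y i)) *
          tre ((1%:M - P z y) *m mx_of (prodop (fun i => tau (z i) (y i)))) <= 2 * q ^+ n].
Proof.
move=> hZ hp htau d0.
have hmix z : density (mixop (p z) (tau z)) by exact: density_mix.
have [lam hlam] := choice (fun k : Z * Y => density_eigd (htau k.1 k.2)).
have [U hU] := choice hlam => {hlam}.
have [mu hmu] := choice (fun z => density_eigd (hmix z)).
have [V hV] := choice hmu => {hmu}.
(* Joint laws of the letters and of the eigenvector label, for the individual states and for the
   mixtures; the mean logarithms of their eigenvalues are minus the conditional entropies [S1] and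
   [S2]. *)
pose w1 (k : Z * Y * T) := pZ k.1.1 * p k.1.1 k.1.2 * lam k.1 k.2.
pose w2 (k : Z * T) := pZ k.1 * mu k.1 k.2.
have hw1 : is_pmf w1.
  apply: (pmf_dep (pmf_dep hZ hp)) => k; split; last by case: (hU k).
  by case: (hU k) => -[].
have hw2 : is_pmf w2.
  apply: (pmf_dep hZ) => z; split; last by case: (hV z).
  by case: (hV z) => -[].
have [||q1 hq1 hlow] := @typical_low R _ w1 (fun k => lam k.1 k.2) d hw1 d0.
- by move=> k; case: (hU k.1) => -[].
- by move=> k; apply: contraNneq => kE; rewrite /w1 kE mulr0.
have [||q2 hq2 hhigh] := @typical_high R _ w2 (fun k => mu k.1 k.2) d hw2 d0.
- by move=> k; case: (hV k.1) => -[].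
- by move=> k; apply: contraNneq => kE; rewrite /w2 kE mulr0.
pose S1 := \sum_z pZ z * \sum_y p z y * entropy (tau z y).
pose S2 := \sum_z pZ z * entropy (mixop (p z) (tau z)).
have S1E : - \sum_k w1 k * log2 (lam k.1 k.2) = S1.
  rewrite -sumrN !sum_pair; apply: eq_bigr => z _; rewrite mulr_sumr; apply: eq_bigr => y _ /=.
  rewrite (entropy_log2 (proj1 (hU (z, y)))) mulrA mulrN mulr_sumr -sumrN.
  by apply: eq_bigr => k _; rewrite /w1 /= !mulrA.
have S2E : - \sum_k w2 k * log2 (mu k.1 k.2) = S2.
  rewrite -sumrN !sum_pair; apply: eq_bigr => z _ /=.
  rewrite (entropy_log2 (proj1 (hV z))) mulrN mulr_sumr -sumrN.
  by apply: eq_bigr => k _; rewrite /w2 /= !mulrA.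
have SE : S2 - S1 = \sum_z pZ z * chi (p z) (tau z).
  by rewrite /S1 /S2 -sumrB; apply: eq_bigr => z _; rewrite -mulrBr.
rewrite {}S1E in hlow; rewrite {}S2E in hhigh; rewrite -{}SE; clearbody S1 S2.
pose q := Num.max q1 q2.
have [/andP[q10 q11] /andP[q20 q21]] := (hq1, hq2).
exists q; first by rewrite le_max q10 /= gt_max q11 q21.
(* The thresholds sit [d] beyond the two entropies, so that [b / a] has the exponent [n] times the
   Holevo quantity minus [2 d]. *)
move=> n; pose a : R := 2 `^ (- (n%:R * (S1 + d))); pose b : R := 2 `^ (- (n%:R * (S2 - d))).
have a0 : 0 < a by rewrite powR_gt0.
have b0 : 0 <= b by rewrite powR_ge0.
pose F1 (z : {ffun 'I_n -> Z}) (y : {ffun 'I_n -> Y}) :=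
  eigd_eigm (eigd_prod (fun i => proj1 (hU (z i, y i)))).
pose F2 (z : {ffun 'I_n -> Z}) := eigd_eigm (eigd_prod (fun i => proj1 (hV (z i)))).
have htr (z : {ffun 'I_n -> Z}) (y : {ffun 'I_n -> Y}) :
    tre (mx_of (prodop (fun i => tau (z i) (y i)))) = 1.
  exact/density_tre/density_prod.
have [P hP] := choice (fun zy : {ffun 'I_n -> Z} * {ffun 'I_n -> Y} =>
  projector_test (F1 zy.1 zy.2) (F2 zy.1) (htr zy.1 zy.2) a0 b0).
exists (fun z y => P (z, y)); split => [z y|z y|]; first by case: (hP (z, y)).
  case: (hP (z, y)) => _ /= h _; apply: le_trans h _.
  rewrite /b /a powR2_div le_eqVlt; apply/orP; left; apply/eqP; congr (_ `^ _); ring.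
have pZ0 (z : {ffun 'I_n -> Z}) : 0 <= \prod_i pZ (z i).
  by apply: prodr_ge0 => i _; case: hZ.
have pY0 (z : {ffun 'I_n -> Z}) (y : {ffun 'I_n -> Y}) : 0 <= \prod_i p (z i) (y i).
  by apply: prodr_ge0 => i _; case: (hp (z i)).
apply: le_trans (_ : q1 ^+ n + q2 ^+ n <= _); last first.
  rewrite mulr_natl mulr2n; apply: lerD; apply: lerXn2r; rewrite ?nnegrE //.
  - by rewrite le_max q10.
  - by rewrite le_max lexx.
  - by rewrite le_max q10.
  - by rewrite le_max lexx orbT.
apply: le_trans (lerD (hlow n) (hhigh n)).
rewrite [X in _ <= X + _]big_mkcond [X in _ <= _ + X]big_mkcond !sum_ffun_pair -big_split /=.
apply: ler_sum => z _.
pose A y := \sum_(k : {ffun 'I_n -> T} | \prod_i lam (z i, y i) (k i) < a) \prod_i lam (z i, y i) (k i).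
pose f j := colv (prodv (fun i => V (z i))) j.
pose B (y : {ffun 'I_n -> Y}) := \sum_(j : {ffun 'I_n -> T} | b < \prod_i mu (z i) (j i))
  tre (f j *m (f j)^t* *m mx_of (prodop (fun i => tau (z i) (y i)))).
apply: (@le_trans _ _ (\sum_(y : {ffun 'I_n -> Y}) \prod_i pZ (z i) * \prod_i p (z i) (y i) * (A y + B y))).
  apply: ler_sum => y _; rewrite ler_wpM2l ?mulr_ge0 //.
  by case: (hP (z, y)).
rewrite le_eqVlt; apply/orP; left; apply/eqP.
under [X in X = _]eq_bigr => y _ do rewrite mulrDr.
rewrite big_split /=; congr (_ + _).
  apply: eq_bigr => y _; rewrite /A mulr_sumr big_mkcond; apply: eq_bigr => k _.
  have -> : \prod_i lam ([ffun i0 => ([ffun i1 => (z i1, y i1)] i0, k i0)] i).1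
     ([ffun i0 => ([ffun i1 => (z i1, y i1)] i0, k i0)] i).2 = \prod_i lam (z i, y i) (k i).
    by apply: eq_bigr => i _; rewrite ffunE /= ffunE.
  case: ifP => // _; rewrite -!big_split; apply: eq_bigr => i _ /=.
  by rewrite !ffunE.
(* Averaging over [y] turns the state into the mixture, whose weight on its own eigenvector [j] is
   the eigenvalue; this leaves the tail bounded by [hhigh]. *)
transitivity (\prod_i pZ (z i) * \sum_(j : {ffun 'I_n -> T} | b < \prod_i mu (z i) (j i)) \prod_i mu (z i) (j i)).
  transitivity (\prod_i pZ (z i) * \sum_(y : {ffun 'I_n -> Y}) \prod_i p (z i) (y i) * B y).
    by rewrite mulr_sumr; apply: eq_bigr => y _; rewrite mulrA.
  congr (_ * _); rewrite /B; under eq_bigr => y _ do rewrite mulr_sumr.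
  rewrite exchange_big /=; apply: eq_bigr => j _.
  rewrite -(tre_ketbra_eigm j (F2 z)) mx_of_prodop_mix mulmx_sumr tre_sum.
  by apply: eq_bigr => y _; rewrite -scalemxAr treZ.
rewrite mulr_sumr big_mkcond; apply: eq_bigr => k _.
have -> : \prod_i mu ([ffun i0 => (z i0, k i0)] i).1 ([ffun i0 => (z i0, k i0)] i).2 =
   \prod_i mu (z i) (k i) by apply: eq_bigr => i _; rewrite ffunE.
by case: ifP => // _; rewrite -big_split; apply: eq_bigr => i _ /=; rewrite ffunE.
Qed.

Lemma sum_prod_ffun (k : nat) (U : finType) (P G : 'I_k -> U -> R) :
  \sum_(c : {ffun 'I_k -> U}) (\prod_m P m (c m)) * \prod_m G m (c m) =
  \prod_m \sum_u P m u * G m u.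
Proof.
rewrite bigA_distr_bigA; apply: eq_bigr => c _.
by rewrite -big_split.
Qed.

(** A factor 1 at every other index puts the integrand in product form. The index is a message in
    random coding and a channel use in the converse. *)
Lemma avg_coord (k : nat) (U : finType) (P : 'I_k -> U -> R) (F : U -> R) (m : 'I_k) :
  (forall m, is_pmf (P m)) ->
  \sum_(c : {ffun 'I_k -> U}) (\prod_m P m (c m)) * F (c m) = \sum_u P m u * F u.
Proof.
move=> hP; pose G i u := if i == m then F u else 1.
transitivity (\sum_(c : {ffun 'I_k -> U}) (\prod_m P m (c m)) * \prod_i G i (c i)).
  apply: eq_bigr => c _; congr (_ * _); rewrite (bigD1 m) //= /G eqxx big1 ?mulr1 //.
  by move=> i /negPf ->.
rewrite sum_prod_ffun (bigD1 m) //= /G eqxx [X in _ * X]big1 ?mulr1 // => i /negPf ->.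
by case: (hP i) => _ P1; rewrite -[RHS]P1; apply: eq_bigr => u _; rewrite mulr1.
Qed.

Lemma avg_codebook1 (k : nat) (U : finType) (P : U -> R) (F : U -> R) (m : 'I_k) :
  is_pmf P ->
  \sum_(c : {ffun 'I_k -> U}) (\prod_m P (c m)) * F (c m) = \sum_u P u * F u.
Proof. by move=> hP; exact: (@avg_coord k U (fun=> P) F m (fun=> hP)). Qed.

(** Independence of two codewords: expanding [F] over the values at [m] and [m'] by indicators makes
    every term a product over messages. *)
Lemma avg_codebook2 (k : nat) (U : finType) (P : U -> R) (F : U -> U -> R) (m m' : 'I_k) :
  is_pmf P -> m' != m ->
  \sum_(c : {ffun 'I_k -> U}) (\prod_m P (c m)) * F (c m) (c m') =
  \sum_u \sum_v P u * P v * F u v.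
Proof.
move=> [_ P1] mm; pose G (u v : U) i (x : U) : R :=
  if i == m then (x == u)%:R else if i == m' then (x == v)%:R else 1.
have sumd (u : U) : \sum_x P x * (x == u)%:R = P u.
  rewrite (bigD1 u) //= eqxx mulr1 big1 ?addr0 // => x /negPf ->; by rewrite mulr0.
transitivity (\sum_u \sum_v F u v *
    \sum_(c : {ffun 'I_k -> U}) (\prod_m P (c m)) * \prod_i G u v i (c i)).
  have GE u v (c : {ffun 'I_k -> U}) : \prod_i G u v i (c i) = (c m == u)%:R * (c m' == v)%:R.
    rewrite (bigD1 m) //= (bigD1 m') //= /G eqxx (negPf mm) eqxx big1 ?mulr1 //.
    by move=> i /andP[/negPf -> /negPf ->].
  under [RHS]eq_bigr => u _ do under eq_bigr => v _ do rewrite mulr_sumr.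
  under [RHS]eq_bigr => u _ do rewrite exchange_big.
  rewrite [RHS]exchange_big; apply: eq_bigr => c _ /=.
  under [RHS]eq_bigr => u _ do under eq_bigr => v _ do rewrite GE.
  rewrite (bigD1 (c m)) //= [X in _ = _ + X]big1 => [|u /negPf uc]; last first.
    by rewrite big1 // => v _; rewrite eq_sym uc mul0r !mulr0.
  rewrite addr0 (bigD1 (c m')) //= [X in _ = _ + X]big1 => [|v /negPf vc]; last first.
    by rewrite (eq_sym (c m')) vc !mulr0.
  by rewrite !eqxx addr0 !mulr1 mulrC.
apply: eq_bigr => u _; apply: eq_bigr => v _; rewrite (sum_prod_ffun (fun=> P)).
rewrite (bigD1 m) //= (bigD1 m') //= /G eqxx (negPf mm) eqxx !sumd big1 ?mulr1 1?mulrC //.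
move=> i /andP[/negPf -> /negPf ->].
by rewrite -[RHS]P1; apply: eq_bigr => x _; rewrite mulr1.
Qed.

Lemma sum_offdiag_const (k : nat) (m : 'I_k) (x : R) :
  \sum_(m' < k | m' != m) x = (k%:R - 1) * x.
Proof.
have : \sum_(m' < k) x = x + \sum_(m' < k | m' != m) x by rewrite (bigD1 m).
by rewrite sumr_const card_ord mulrBl mul1r mulr_natl => ->; rewrite addrAC subrr add0r.
Qed.

Definition avgop (U : finType) n (P : U -> R) (rho : U -> 'M[C]_n) : 'M[C]_n :=
  \sum_u (P u)%:C *: rho u.

Lemma tre_avgop (U : finType) n (P : U -> R) (rho : U -> 'M[C]_n) (A : 'M[C]_n) :
  tre (A *m avgop P rho) = \sum_u P u * tre (A *m rho u).
Proof. by rewrite mulmx_sumr tre_sum; apply: eq_bigr => u _; rewrite -scalemxAr treZ. Qed.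

(** A wrong codeword is independent of the output, so its test meets an averaged state: over both
    inputs in the first stage, over [a] with [b] fixed in the second. The correct codewords
    contribute the errors of the tests themselves. *)
Lemma random_coding (Ua Ub : finType) n (Pa : Ua -> R) (Pb : Ub -> R)
    (rho : Ua -> Ub -> 'M[C]_n) (Qb : Ub -> 'M[C]_n) (Qa : Ub -> Ua -> 'M[C]_n) ba bb ka kb :
  is_pmf Pa -> is_pmf Pb -> (forall a b, psdm (rho a b)) ->
  (forall b, proj (Qb b)) -> (forall b a, proj (Qa b a)) ->
  (forall b, tre (Qb b *m avgop Pb (fun b => avgop Pa (rho^~ b))) <= bb) ->
  (forall b a, tre (Qa b a *m avgop Pa (rho^~ b)) <= ba) ->
  (0 < ka)%N ->
  exists L : {ffun 'I_ka -> Ua} -> {ffun 'I_kb -> Ub} -> 'I_ka -> 'M[C]_n,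
    (forall ca cb, povmm (L ca cb)) /\ forall ma mb,
    \sum_(ca : {ffun 'I_ka -> Ua}) \sum_(cb : {ffun 'I_kb -> Ub}) (\prod_m Pa (ca m)) * (\prod_m Pb (cb m)) *
        tre ((1%:M - L ca cb ma) *m rho (ca ma) (cb mb)) <=
      4 * (\sum_b Pb b * tre ((1%:M - Qb b) *m avgop Pa (rho^~ b)) + (kb%:R - 1) * bb
           + \sum_b \sum_a Pb b * Pa a * tre ((1%:M - Qa b a) *m rho a b) + (ka%:R - 1) * ba).
Proof.
move=> hPa hPb hrho hQb hQa hbb hba ka0.
have [L hL] := choice (fun c : {ffun 'I_ka -> Ua} * {ffun 'I_kb -> Ub} =>
  two_stage_decoder ka0 (fun b => hQb (c.2 b)) (fun b a => hQa (c.2 b) (c.1 a))).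
exists (fun ca cb => L (ca, cb)); split=> [ca cb|ma mb]; first by case: (hL (ca, cb)).
have Pa0 (c : {ffun 'I_ka -> Ua}) : 0 <= \prod_m Pa (c m).
  by apply: prodr_ge0 => m _; case: hPa.
have Pb0 (c : {ffun 'I_kb -> Ub}) : 0 <= \prod_m Pb (c m).
  by apply: prodr_ge0 => m _; case: hPb.
have [sPa sPb] := (pmf_prod (fun _ : 'I_ka => hPa), pmf_prod (fun _ : 'I_kb => hPb)).
pose E (F : {ffun 'I_ka -> Ua} -> {ffun 'I_kb -> Ub} -> R) :=
  \sum_(ca : {ffun 'I_ka -> Ua}) \sum_(cb : {ffun 'I_kb -> Ub}) (\prod_m Pa (ca m)) * (\prod_m Pb (cb m)) * F ca cb.
have ED F G : E (fun a b => F a b + G a b) = E F + E G.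
  rewrite /E -big_split; apply: eq_bigr => a _; rewrite -big_split; apply: eq_bigr => b _.
  by rewrite mulrDr.
have EZ x F : E (fun a b => x * F a b) = x * E F.
  rewrite /E mulr_sumr; apply: eq_bigr => a _; rewrite mulr_sumr; apply: eq_bigr => b _; ring.
have Es (I : finType) (p : pred I) F : E (fun a b => \sum_(i | p i) F i a b) = \sum_(i | p i) E (F i).
  rewrite /E [RHS]exchange_big; apply: eq_bigr => a _; rewrite [RHS]exchange_big; apply: eq_bigr => b _.
  by rewrite mulr_sumr.
have EP (F : {ffun 'I_ka -> Ua} -> {ffun 'I_kb -> Ub} -> R) : E F =
    \sum_(cb : {ffun 'I_kb -> Ub}) (\prod_m Pb (cb m)) *
      \sum_(ca : {ffun 'I_ka -> Ua}) (\prod_m Pa (ca m)) * F ca cb.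
  rewrite /E exchange_big; apply: eq_bigr => b _; rewrite mulr_sumr; apply: eq_bigr => a _; ring.
apply: (@le_trans _ _ (E (fun ca cb =>
   4 * (tre ((1%:M - Qb (cb mb)) *m rho (ca ma) (cb mb))
        + \sum_(b' | b' != mb) tre (Qb (cb b') *m rho (ca ma) (cb mb))
        + tre ((1%:M - Qa (cb mb) (ca ma)) *m rho (ca ma) (cb mb))
        + \sum_(a' | a' != ma) tre (Qa (cb mb) (ca a') *m rho (ca ma) (cb mb)))))).
  apply: ler_sum => ca _; apply: ler_sum => cb _; rewrite ler_wpM2l ?mulr_ge0 //.
  by case: (hL (ca, cb)) => _; apply.
rewrite EZ !ED !Es ler_wpM2l //; apply: lerD; [apply: lerD; [apply: lerD|]|].
- rewrite EP; under eq_bigr => cb _ do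
    rewrite (avg_codebook1 (fun a => tre ((1%:M - Qb (cb mb)) *m rho a (cb mb))) ma hPa) -tre_avgop.
  by rewrite (avg_codebook1 (fun b => tre ((1%:M - Qb b) *m avgop Pa (rho^~ b))) mb hPb).
- rewrite -(sum_offdiag_const mb); apply: ler_sum => b' hb'; rewrite EP.
  under eq_bigr => cb _ do
    rewrite (avg_codebook1 (fun a => tre (Qb (cb b') *m rho a (cb mb))) ma hPa) -tre_avgop.
  rewrite (avg_codebook2 (fun b c => tre (Qb c *m avgop Pa (rho^~ b))) hPb hb') exchange_big /=.
  under eq_bigr => c _ do under eq_bigr => b _ do rewrite [Pb b * _]mulrC -mulrA.
  under eq_bigr => c _ do rewrite -mulr_sumr -tre_avgop.
  have [p0 p1] := hPb; rewrite -[leRHS]mul1r -p1 mulr_suml; apply: ler_sum => c _.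
  by rewrite ler_wpM2l.
- rewrite EP; under eq_bigr => cb _ do
    rewrite (avg_codebook1 (fun a => tre ((1%:M - Qa (cb mb) a) *m rho a (cb mb))) ma hPa).
  rewrite (avg_codebook1 (fun b => \sum_a Pa a * tre ((1%:M - Qa b a) *m rho a b)) mb hPb).
  rewrite le_eqVlt; apply/orP; left; apply/eqP; apply: eq_bigr => b _; rewrite mulr_sumr.
  by apply: eq_bigr => a _; rewrite mulrA.
- rewrite -(sum_offdiag_const ma); apply: ler_sum => a' ha'; rewrite EP.
  under eq_bigr => cb _ do
    rewrite (avg_codebook2 (fun a c => tre (Qa (cb mb) c *m rho a (cb mb))) hPa ha').
  rewrite (avg_codebook1 (fun b => \sum_u \sum_v Pa u * Pa v * tre (Qa b v *m rho u b)) mb hPb).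
  have [p0 p1] := hPb; rewrite -[leRHS]mul1r -p1 mulr_suml; apply: ler_sum => b _.
  rewrite ler_wpM2l // exchange_big /=.
  under eq_bigr => c _ do under eq_bigr => u _ do rewrite [Pa u * _]mulrC -mulrA.
  under eq_bigr => c _ do rewrite -mulr_sumr -tre_avgop.
  have [q0 q1] := hPa; rewrite -[leRHS]mul1r -q1 mulr_suml; apply: ler_sum => c _.
  by rewrite ler_wpM2l.
Qed.

End Coding.

(** * Random coding for one receiver *)

Section Receiver.
Variable R : realType.
Local Notation C := R[i].

Lemma eventually_expr (r e : R) : 0 <= r < 1 -> 0 < e ->
  exists N : nat, forall n, (N <= n)%N -> r ^+ n <= e.
Proof.
move=> /andP[r0 r1] e0.
have /cvgrPdist_lt/(_ e e0) : ((r ^+ n) @[n --> \oo] --> (0 : R))%classic.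
  by apply: cvg_expr; rewrite ger0_norm.
case=> N _ hN; exists N => n /hN /=.
by rewrite sub0r normrN ger0_norm ?exprn_ge0 // => /ltW.
Qed.

Lemma sum_const_ord n (x : R) : \sum_(i < n) x = n%:R * x.
Proof. by rewrite sumr_const card_ord mulr_natl. Qed.

Lemma powR2_nat (n : nat) (x : R) : 2 `^ (n%:R * x) = (2 `^ x) ^+ n.
Proof. by rewrite mulrC powRrM powR_mulrn // powR_ge0. Qed.

Lemma powR2_lt1 (x : R) : x < 0 -> 0 <= 2 `^ x < 1.
Proof. by move=> x0; rewrite powR_ge0 ltr_powR2r // /log2 ln1 mul0r. Qed.

(** The rates are conditional on the time-sharing letter: the interferer is decoded with [pa]
    averaged out, the own message with [b] known. Stated for abstract inputs, it applies to both
    receivers with the senders exchanged. *)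
Lemma receiver_coding (Q Xa Xb T : finType) (pQ : Q -> R) (pa : Q -> Xa -> R)
    (pb : Q -> Xb -> R) (sigma : Xa -> Xb -> Op R T) (Ra Rb eps : R) :
  is_pmf pQ -> (forall q, is_pmf (pa q)) -> (forall q, is_pmf (pb q)) ->
  (forall a b, density (sigma a b)) ->
  Ra < \sum_q pQ q * cond_chi (pa q) (pb q) sigma ->
  Rb < \sum_q pQ q * chi (pb q) (fun b => mixop (pa q) (sigma^~ b)) -> 0 < eps ->
  exists N : nat, forall n, (N <= n)%N -> forall ka kb : nat, (0 < ka)%N ->
    ka%:R - 1 <= 2 `^ (n%:R * Ra) -> kb%:R - 1 <= 2 `^ (n%:R * Rb) ->
  exists L : {ffun 'I_n -> Q} -> {ffun 'I_ka -> {ffun 'I_n -> Xa}} ->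
      {ffun 'I_kb -> {ffun 'I_n -> Xb}} -> 'I_ka -> 'M[C]_#|{ffun 'I_n -> T}|,
    (forall q ca cb, povmm (L q ca cb)) /\ forall ma mb,
    \sum_(q : {ffun 'I_n -> Q}) (\prod_i pQ (q i)) *
      \sum_(ca : {ffun 'I_ka -> {ffun 'I_n -> Xa}}) \sum_(cb : {ffun 'I_kb -> {ffun 'I_n -> Xb}})
        (\prod_m \prod_i pa (q i) (ca m i)) * (\prod_m \prod_i pb (q i) (cb m i)) *
        tre ((1%:M - L q ca cb ma) *m mx_of (prodop (fun i => sigma (ca ma i) (cb mb i)))) <= eps.
Proof.
move=> hQ ha hb hs; set Ia := \sum_q _; set Ib := \sum_q _ => hRa hRb e0.
(* The tests give up [2 * da] of the exponent, half of the gap; the other half makes the union bound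
   over messages decay. *)
pose da := (Ia - Ra) / 4; pose db := (Ib - Rb) / 4.
have da0 : 0 < da by rewrite divr_gt0 // subr_gt0.
have db0 : 0 < db by rewrite divr_gt0 // subr_gt0.
have hmix q b : density (mixop (pa q) (sigma^~ b)) by apply: density_mix.
have [qB hqB testB] := conditional_tests hQ hb hmix db0.
have hZ : is_pmf (fun k : Q * Xb => pQ k.1 * pb k.1 k.2) by exact: pmf_dep.
(* Once decoded, the interfering codeword joins the time-sharing sequence as the conditioning
   variable. *)
have [qA hqA testA] := @conditional_tests R _ _ _ _ (fun z : Q * Xb => pa z.1)
  (fun z a => sigma a z.2) da hZ (fun z => ha z.1) (fun z a => hs a z.2) da0.
have IaE : \sum_(z : Q * Xb) pQ z.1 * pb z.1 z.2 * chi (pa z.1) (sigma^~ z.2) = Ia.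
  rewrite sum_pair; apply: eq_bigr => q _; rewrite /cond_chi mulr_sumr.
  by apply: eq_bigr => b _; rewrite mulrA.
have hga : Ra - (Ia - 2 * da) < 0 by rewrite /da; clearbody Ia; lra.
have hgb : Rb - (Ib - 2 * db) < 0 by rewrite /db; clearbody Ib; lra.
rewrite {}IaE in testA; rewrite -/Ib in testB; clearbody Ia Ib da db.
(* Two test errors of [2 * e] and two union-bound terms of [e], times the constant 4 of the
   decoder. *)
pose e := eps / 24; have e1 : 0 < e by rewrite divr_gt0.
have [N1 hN1] := eventually_expr hqA e1.
have [N2 hN2] := eventually_expr hqB e1.
have [N3 hN3] := eventually_expr (powR2_lt1 hga) e1.
have [N4 hN4] := eventually_expr (powR2_lt1 hgb) e1.
exists (maxn (maxn N1 N2) (maxn N3 N4)) => n.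
rewrite !geq_max => /andP[/andP[/hN1 h1 /hN2 h2] /andP[/hN3 h3 /hN4 h4]] ka kb ka0 hka hkb.
have [PB [PBp PBs PBe]] := testB n; have [PA [PAp PAs PAe]] := testA n.
pose zz (q : {ffun 'I_n -> Q}) (b : {ffun 'I_n -> Xb}) := [ffun i => (q i, b i)].
have av q (b : {ffun 'I_n -> Xb}) :
    avgop (fun a : {ffun 'I_n -> Xa} => \prod_i pa (q i) (a i))
      (fun a : {ffun 'I_n -> Xa} => mx_of (prodop (fun i => sigma (a i) (b i)))) =
    mx_of (prodop (fun i => mixop (pa (q i)) (sigma^~ (b i)))).
  by rewrite mx_of_prodop_mix.
have av2 (q : {ffun 'I_n -> Q}) : avgop (fun b : {ffun 'I_n -> Xb} => \prod_i pb (q i) (b i))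
      (fun b : {ffun 'I_n -> Xb} => mx_of (prodop (fun i => mixop (pa (q i)) (sigma^~ (b i))))) =
    mx_of (prodop (fun i => mixop (pb (q i)) (fun x => mixop (pa (q i)) (sigma^~ x)))).
  by rewrite mx_of_prodop_mix.
have rc (q : {ffun 'I_n -> Q}) := @random_coding R {ffun 'I_n -> Xa} {ffun 'I_n -> Xb} _
  (fun a => \prod_i pa (q i) (a i)) (fun b => \prod_i pb (q i) (b i))
  (fun a b => mx_of (prodop (fun i => sigma (a i) (b i)))) (PB q) (fun b => PA (zz q b))
  (2 `^ (- (n%:R * (Ia - 2 * da)))) (2 `^ (- (n%:R * (Ib - 2 * db)))) ka kb
  (pmf_prod (fun i => ha (q i))) (pmf_prod (fun i => hb (q i)))
  (fun a b => psd_psdm (proj1 (density_prod (fun i => hs (a i) (b i)))))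
  (PBp q) (fun b => PAp (zz q b)).
have {}rc (q : {ffun 'I_n -> Q}) : exists L : {ffun 'I_ka -> {ffun 'I_n -> Xa}} ->
    {ffun 'I_kb -> {ffun 'I_n -> Xb}} -> 'I_ka -> 'M[C]_#|{ffun 'I_n -> T}|,
    (forall ca cb, povmm (L ca cb)) /\ forall ma mb,
    \sum_(ca : {ffun 'I_ka -> {ffun 'I_n -> Xa}}) \sum_(cb : {ffun 'I_kb -> {ffun 'I_n -> Xb}})
        (\prod_m \prod_i pa (q i) (ca m i)) * (\prod_m \prod_i pb (q i) (cb m i)) *
        tre ((1%:M - L ca cb ma) *m mx_of (prodop (fun i => sigma (ca ma i) (cb mb i)))) <=
    4 * (\sum_(b : {ffun 'I_n -> Xb}) \prod_i pb (q i) (b i) *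
            tre ((1%:M - PB q b) *m mx_of (prodop (fun i => mixop (pa (q i)) (sigma^~ (b i))))) + e +
         \sum_(b : {ffun 'I_n -> Xb}) \sum_(a : {ffun 'I_n -> Xa})
            \prod_i pb (q i) (b i) * \prod_i pa (q i) (a i) *
            tre ((1%:M - PA (zz q b) a) *m mx_of (prodop (fun i => sigma (a i) (b i)))) + e).
  have [||//|L [hL1 hL2]] := rc q.
  - move=> b; under [X in avgop _ X]eq_fun => x do rewrite av.
    by rewrite av2; exact: PBs.
  - move=> b a; rewrite av; have := PAs (zz q b) a.
    rewrite (_ : prodop _ = prodop (fun i => mixop (pa (q i)) (sigma^~ (b i)))) //.
    by congr prodop; apply/funext => i; rewrite /zz ffunE.
  exists L; split=> // ma mb; apply: le_trans (hL2 ma mb) _; rewrite ler_wpM2l //.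
  under [X in X + _ + _ + _ <= _]eq_bigr => b _ do rewrite av.
  have aux (k Rx I : R) : k <= 2 `^ (n%:R * Rx) -> (2 `^ (Rx - I)) ^+ n <= e ->
      k * 2 `^ (- (n%:R * I)) <= e.
    move=> hk; apply: le_trans; rewrite -powR2_nat mulrBr -powR2_div ler_pdivlMr ?powR_gt0 //.
    by rewrite -mulrA -powRD ?pnatr_eq0 ?implybT // addNr powRr0 mulr1.
  by rewrite !lerD //; [exact: aux hkb h4|exact: aux hka h3].
have [L hL] := choice rc; exists L; split=> [q|ma mb]; first by case: (hL q).
have [wq0 wq1] := pmf_prod (fun _ : 'I_n => hQ).
apply: le_trans (_ : \sum_(q : {ffun 'I_n -> Q}) (\prod_i pQ (q i)) *
   (4 * (\sum_(b : {ffun 'I_n -> Xb}) \prod_i pb (q i) (b i) *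
            tre ((1%:M - PB q b) *m mx_of (prodop (fun i => mixop (pa (q i)) (sigma^~ (b i))))) + e +
         \sum_(b : {ffun 'I_n -> Xb}) \sum_(a : {ffun 'I_n -> Xa})
            \prod_i pb (q i) (b i) * \prod_i pa (q i) (a i) *
            tre ((1%:M - PA (zz q b) a) *m mx_of (prodop (fun i => sigma (a i) (b i)))) + e)) <= _).
  by apply: ler_sum => q _; rewrite ler_wpM2l //; case: (hL q).
under eq_bigr => q _ do rewrite mulrCA.
rewrite -mulr_sumr; under eq_bigr => q _ do rewrite !mulrDr.
rewrite !big_split /= -!mulr_suml wq1 mul1r.
have E1 : \sum_(q : {ffun 'I_n -> Q}) (\prod_i pQ (q i)) * \sum_(b : {ffun 'I_n -> Xb}) \prod_i pb (q i) (b i) *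
            tre ((1%:M - PB q b) *m mx_of (prodop (fun i => mixop (pa (q i)) (sigma^~ (b i)))))
    <= 2 * e.
  apply: le_trans (_ : 2 * qB ^+ n <= _); last by rewrite ler_wpM2l.
  apply: le_trans PBe; rewrite le_eqVlt; apply/orP; left; apply/eqP; apply: eq_bigr => q _.
  by rewrite mulr_sumr; apply: eq_bigr => b _; rewrite mulrA.
have E2 : \sum_(q : {ffun 'I_n -> Q}) (\prod_i pQ (q i)) *
       \sum_(b : {ffun 'I_n -> Xb}) \sum_(a : {ffun 'I_n -> Xa})
            \prod_i pb (q i) (b i) * \prod_i pa (q i) (a i) *
            tre ((1%:M - PA (zz q b) a) *m mx_of (prodop (fun i => sigma (a i) (b i)))) <= 2 * e.
  apply: le_trans (_ : 2 * qA ^+ n <= _); last by rewrite ler_wpM2l.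
  apply: le_trans PAe; rewrite sum_ffun_pair le_eqVlt; apply/orP; left; apply/eqP.
  apply: eq_bigr => q _; rewrite mulr_sumr; apply: eq_bigr => b _; rewrite mulr_sumr.
  apply: eq_bigr => a _; rewrite -/(zz q b).
  have -> : prodop (fun i => sigma (a i) (zz q b i).2) = prodop (fun i => sigma (a i) (b i)).
    by congr prodop; apply/funext => i; rewrite ffunE.
  have -> : \prod_i pa (zz q b i).1 (a i) = \prod_i pa (q i) (a i).
    by apply: eq_bigr => i _; rewrite ffunE.
  have -> : \prod_i (pQ (zz q b i).1 * pb (zz q b i).1 (zz q b i).2) =
      (\prod_i pQ (q i)) * \prod_i pb (q i) (b i).
    by rewrite -big_split; apply: eq_bigr => i _; rewrite ffunE.
  by rewrite !mulrA.
have eE : 4 * (2 * e + e + 2 * e + e) = eps by rewrite /e; field.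
rewrite -[leRHS]eE ler_wpM2l // !lerD //.
Qed.

End Receiver.

(** * Joint error and errors of the single receivers *)

Section Errors.
Variable R : realType.

Lemma mx_ofD (T : finType) (A B : Op R T) :
  mx_of (fun s t => A s t + B s t) = mx_of A + mx_of B.
Proof. by apply/matrixP => i j; rewrite !mxE. Qed.

Lemma tropDl (T : finType) (A B D : Op R T) :
  trop (fun s t => A s t + B s t) D = trop A D + trop B D.
Proof. by rewrite /trop mx_ofD mulmxDl treD. Qed.

Lemma psdD (T : finType) (A B : Op R T) : psd A -> psd B -> psd (fun s t => A s t + B s t).
Proof. by move=> hA hB; apply: psdm_psd; rewrite mx_ofD; apply: psdmD; exact: psd_psdm. Qed.

Lemma psd_id (T : finType) : psd (@op_id R T).
Proof. by apply: psdm_psd; rewrite mx_of_id; exact: psdm1. Qed.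

Lemma op_id_pair (T1 T2 : finType) (s t : T1 * T2) :
  op_id R s t = op_id R s.1 t.1 * op_id R s.2 t.2.
Proof. by rewrite /op_id -natrM mulnb. Qed.

Variables (T1 T2 : finType).
Implicit Types (L : Op R T1) (G : Op R T2) (rho : Op R (T1 * T2)%type).

Lemma trop_tens1 L rho : trop (op_tens L (@op_id R T2)) rho = trop L (ptr1 rho).
Proof.
rewrite !tropE; congr complex.Re; rewrite sum_pair; apply: eq_bigr => s _.
rewrite exchange_big /= sum_pair; apply: eq_bigr => t _.
rewrite /ptr1 mulr_sumr; apply: eq_bigr => b _.
transitivity (\sum_b' (b == b')%:R * (L s t * rho (t, b) (s, b'))); last by rewrite sum_delta.
by apply: eq_bigr => b' _; rewrite /op_tens /op_id /= eq_sym; ring.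
Qed.

Lemma trop_tens2 G rho : trop (op_tens (@op_id R T1) G) rho = trop G (ptr2 rho).
Proof.
rewrite !tropE; congr complex.Re; rewrite sum_pair exchange_big; apply: eq_bigr => s _.
rewrite exchange_big /= sum_pair exchange_big; apply: eq_bigr => t _.
rewrite /ptr2 mulr_sumr; apply: eq_bigr => b _ /=.
transitivity (\sum_b' (b == b')%:R * (G s t * rho (b, t) (b', s))); last by rewrite sum_delta.
by apply: eq_bigr => b' _; rewrite /op_tens /op_id /= eq_sym; ring.
Qed.

Let cL L := op_sub (@op_id R T1) L.
Let cG G := op_sub (@op_id R T2) G.

Lemma errE L G : op_sub (@op_id R _) (op_tens L G) =
  (fun s t => op_tens (cL L) (@op_id R T2) s t + op_tens L (cG G) s t).
Proof.
apply/funext => s; apply/funext => t.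
by rewrite /op_sub /op_tens /cL /cG /op_sub op_id_pair; ring.
Qed.

Lemma err_psd L G : psd L -> psd G -> psd (cL L) -> psd (cG G) ->
  psd (op_sub (@op_id R _) (op_tens L G)).
Proof.
by move=> hL hG hL' hG'; rewrite errE; apply: psdD; apply: psd_tens => //; exact: psd_id.
Qed.

(** Dropping the positive term with [L] and the complement of [G] leaves the error of Receiver 1 on
    its reduced output; this is what the converse needs. *)
Lemma err_ge1 L G rho : psd L -> psd (cG G) -> psd rho ->
  trop (cL L) (ptr1 rho) <= trop (op_sub (@op_id R _) (op_tens L G)) rho.
Proof.
move=> hL hG hr; rewrite errE tropDl trop_tens1 lerDl.
by apply: trop_ge0 => //; apply: psd_tens.
Qed.

Lemma err_ge2 L G rho : psd (cL L) -> psd G -> psd rho ->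
  trop (cG G) (ptr2 rho) <= trop (op_sub (@op_id R _) (op_tens L G)) rho.
Proof.
move=> hL hG hr; have -> : op_sub (@op_id R _) (op_tens L G) =
    (fun s t => op_tens (@op_id R T1) (cG G) s t + op_tens (cL L) G s t).
  apply/funext => s; apply/funext => t.
  by rewrite /op_sub /op_tens /cL /cG /op_sub op_id_pair; ring.
by rewrite tropDl trop_tens2 lerDl; apply: trop_ge0 => //; apply: psd_tens.
Qed.

(** The sum of the two single errors exceeds the joint error by the double failure, the tensor
    product of both complements, which is positive. *)
Lemma err_le L G rho : psd (cL L) -> psd (cG G) -> psd rho ->
  trop (op_sub (@op_id R _) (op_tens L G)) rho <=
    trop (cL L) (ptr1 rho) + trop (cG G) (ptr2 rho).
Proof.
move=> hL hG hr; rewrite -trop_tens1 -trop_tens2 -tropDl.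
set A := op_sub _ _; set B := fun s t => _ + _.
have -> : B = (fun s t => A s t + op_tens (cL L) (cG G) s t).
  apply/funext => s; apply/funext => t.
  by rewrite /A /B /op_sub /op_tens /cL /cG /op_sub op_id_pair; ring.
by rewrite tropDl lerDl; apply: trop_ge0 => //; apply: psd_tens.
Qed.

Lemma trop_compl (T : finType) (L D : Op R T) :
  trop (op_sub (@op_id R T) L) D = tre ((1%:M - mx_of L) *m mx_of D).
Proof. by rewrite /trop mx_of_sub mx_of_id. Qed.

Lemma povm_compl (T M : finType) (L : M -> Op R T) m : povm L -> psd (op_sub (@op_id R T) (L m)).
Proof.
by move/povm_povmm => h; apply: psdm_psd; rewrite mx_of_sub mx_of_id; exact: (povmm_compl m h).
Qed.

End Errors.

(** * From codes for each receiver to codes for the channel *)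

Section Channel.
Variable R : realType.
Variables (X1 X2 B1 B2 : finType) (rho : X1 -> X2 -> Op R (B1 * B2)%type).
Hypothesis hrho : forall x1 x2, density (rho x1 x2).

Lemma ptr1_chan n (c1 : 'I_n -> X1) (c2 : 'I_n -> X2) :
  ptr1 (chan_n rho c1 c2) = prodop (fun i => ptr1 (rho (c1 i) (c2 i))).
Proof.
apply/funext => s; apply/funext => t.
by rewrite /ptr1 /chan_n /prodop bigA_distr_bigA.
Qed.

Lemma ptr2_chan n (c1 : 'I_n -> X1) (c2 : 'I_n -> X2) :
  ptr2 (chan_n rho c1 c2) = prodop (fun i => ptr2 (rho (c1 i) (c2 i))).
Proof.
apply/funext => s; apply/funext => t.
by rewrite /ptr2 /chan_n /prodop bigA_distr_bigA.
Qed.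

(** Along the injection [f], which interleaves the two output strings, the channel output is a
    compression of a product of densities. *)
Lemma psd_chan n (c1 : 'I_n -> X1) (c2 : 'I_n -> X2) : psd (chan_n rho c1 c2).
Proof.
pose f (b : {ffun 'I_n -> B1} * {ffun 'I_n -> B2}) : {ffun 'I_n -> B1 * B2} :=
  [ffun i => (b.1 i, b.2 i)].
have -> : chan_n rho c1 c2 = (fun s t => prodop (fun i => rho (c1 i) (c2 i)) (f s) (f t)).
  apply/funext => s; apply/funext => t.
  by apply: eq_bigr => i _; rewrite !ffunE.
apply: psd_comp; last by case: (density_prod (fun i => hrho (c1 i) (c2 i))).
move=> [a b] [c d] /ffunP h; congr (_, _); apply/ffunP => i; have := h i; rewrite !ffunE;
  by case.
Qed.

Lemma avg_exists (T : finType) (w F : T -> R) (e : R) : is_pmf w ->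
  \sum_t w t * F t <= e -> exists t, F t <= e.
Proof.
move=> [w0 w1] h; apply: contrapT => hn.
have hF t : e < F t by rewrite ltNge; apply/negP => ht; apply: hn; exists t.
have : \sum_t w t * e <= \sum_t w t * F t.
  by apply: ler_sum => t _; rewrite ler_wpM2l // ltW.
rewrite -mulr_suml w1 mul1r => h1.
have /eqP : \sum_t w t * (F t - e) = 0.
  apply/eqP; rewrite eq_le; apply/andP; split.
    under eq_bigr do rewrite mulrBr; rewrite sumrB -mulr_suml w1 mul1r; lra.
  by apply: sumr_ge0 => t _; rewrite mulr_ge0 // subr_ge0 ltW.
rewrite psumr_eq0 => [/allP h0|t _]; last by rewrite mulr_ge0 // subr_ge0 ltW.
have : \sum_t w t = 0.
  apply: big1 => t _; have := h0 t (mem_index_enum t); rewrite /= mulf_eq0 => /orP[/eqP //|].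
  by rewrite subr_eq0 => /eqP Fe; have := hF t; rewrite Fe ltxx.
by rewrite w1 => /eqP; rewrite oner_eq0.
Qed.

Lemma nmsg_gt0 n (r : R) : (0 < nmsg n r)%N.
Proof. by rewrite /nmsg absz_gt0 gt_eqF // ceil_gt0 powR_gt0. Qed.

Lemma nmsgE n (r : R) : (nmsg n r)%:R = (Num.ceil (2 `^ (n%:R * r)))%:~R :> R.
Proof.
rewrite /nmsg -[in RHS](gez0_abs (m := Num.ceil _)) //.
by rewrite ceil_ge0 (lt_le_trans _ (powR_ge0 _ _)) // ltrN10.
Qed.

(** Rounding up adds less than one message, and a union bound over the wrong messages counts one
    fewer than all. *)
Lemma nmsg_le n (r : R) : (nmsg n r)%:R - 1 <= 2 `^ (n%:R * r).
Proof. by rewrite nmsgE; have := ceilB1_lt (2 `^ (n%:R * r)); rewrite intrB => /ltW. Qed.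

Lemma nmsg_ge n (r : R) : 2 `^ (n%:R * r) <= (nmsg n r)%:R.
Proof. by rewrite nmsgE ceil_ge. Qed.

Lemma vsi_region_achievable : very_strong_interference rho ->
  (vsi_region rho `<=` achievable rho)%classic.
Proof.
move=> hvsi [r1 r2] [Q [pQ [p1 [p2 [hQ h1 h2 /= hr1 hr2]]]]] eps delta e0 d0 /=.
pose sg1 x1 x2 := ptr1 (rho x1 x2); pose sg2 x2 x1 := ptr2 (rho x1 x2).
have hs1 x1 x2 : density (sg1 x1 x2) by exact: density_ptr1.
have hs2 x2 x1 : density (sg2 x2 x1) by exact: density_ptr2.
rewrite I_X1B1_X2QE // -/sg1 in hr1; rewrite I_X2B2_X1QE // -/sg2 in hr2.
have pQ0 q : 0 <= pQ q by case: hQ.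
(* Very strong interference is used here, for each time-sharing letter: a rate that Receiver 2 can
   decode knowing [X1] is also decodable by Receiver 1 with its own sender as noise. *)
have i1 : r2 <= \sum_q pQ q * chi (p2 q) (fun b => mixop (p1 q) (sg1^~ b)).
  apply: le_trans hr2 _; apply: ler_sum => q _; rewrite ler_wpM2l //.
  by have [_] := hvsi _ _ (h1 q) (h2 q); rewrite I_X2B2_X1E // I_X2B1E.
have i2 : r1 <= \sum_q pQ q * chi (p1 q) (fun b => mixop (p2 q) (sg2^~ b)).
  apply: le_trans hr1 _; apply: ler_sum => q _; rewrite ler_wpM2l //.
  by have [+ _] := hvsi _ _ (h1 q) (h2 q); rewrite I_X1B1_X2E // I_X1B2E.
have sub_lt r I : r <= I -> r - delta < I by move=> h; rewrite ltrBlDr (le_lt_trans h) // ltrDl.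
have e2 : 0 < eps / 2 by rewrite divr_gt0.
have [N1 hN1] := receiver_coding hQ h1 h2 hs1 (sub_lt _ _ hr1) (sub_lt _ _ i1) e2.
have [N2 hN2] := receiver_coding hQ h2 h1 hs2 (sub_lt _ _ hr2) (sub_lt _ _ i2) e2.
exists (maxn N1 N2) => n; rewrite geq_max => /andP[/hN1 {}hN1 /hN2 {}hN2].
set k1 := nmsg n _; set k2 := nmsg n _.
have [L [hL eL]] := hN1 k1 k2 (nmsg_gt0 _ _) (nmsg_le _ _) (nmsg_le _ _).
have [G [hG eG]] := hN2 k2 k1 (nmsg_gt0 _ _) (nmsg_le _ _) (nmsg_le _ _).
have k10 : 0 < k1%:R :> R by rewrite ltr0n nmsg_gt0.
have k20 : 0 < k2%:R :> R by rewrite ltr0n nmsg_gt0.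
clearbody k1 k2.
(* One sample space for both receivers: the time-sharing sequence and the two codebooks. The sum of
   both errors is averaged, so a single sample is good for the pair. *)
pose W := ({ffun 'I_n -> Q} * ({ffun 'I_k1 -> {ffun 'I_n -> X1}} * {ffun 'I_k2 -> {ffun 'I_n -> X2}}))%type.
pose w (x : W) : R := (\prod_i pQ (x.1 i)) *
  ((\prod_m \prod_i p1 (x.1 i) (x.2.1 m i)) * (\prod_m \prod_i p2 (x.1 i) (x.2.2 m i))).
pose u1 (q : {ffun 'I_n -> Q}) (c : {ffun 'I_k1 -> {ffun 'I_n -> X1}}) := \prod_m \prod_i p1 (q i) (c m i).
pose u2 (q : {ffun 'I_n -> Q}) (c : {ffun 'I_k2 -> {ffun 'I_n -> X2}}) := \prod_m \prod_i p2 (q i) (c m i).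
have hu1 q : is_pmf (u1 q).
  apply: (@pmf_prod _ _ _ (fun (_ : 'I_k1) (u : {ffun 'I_n -> X1}) => \prod_i p1 (q i) (u i))) => _.
  exact: (pmf_prod (fun i => h1 (q i))).
have hu2 q : is_pmf (u2 q).
  apply: (@pmf_prod _ _ _ (fun (_ : 'I_k2) (u : {ffun 'I_n -> X2}) => \prod_i p2 (q i) (u i))) => _.
  exact: (pmf_prod (fun i => h2 (q i))).
have hw : is_pmf w.
  apply: (@pmf_dep _ _ _ _ (fun q c => u1 q c.1 * u2 q c.2) (pmf_prod (fun _ : 'I_n => hQ))) => q.
  exact: (@pmf_dep _ _ _ _ (fun _ => u2 q) (hu1 q) (fun _ => hu2 q)).
pose e1 (x : W) m1 m2 := tre ((1%:M - L x.1 x.2.1 x.2.2 m1) *m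
   mx_of (prodop (fun i => sg1 (x.2.1 m1 i) (x.2.2 m2 i)))).
pose f2 (x : W) m1 m2 := tre ((1%:M - G x.1 x.2.2 x.2.1 m2) *m
   mx_of (prodop (fun i => sg2 (x.2.2 m2 i) (x.2.1 m1 i)))).
have a1 m1 m2 : \sum_x w x * e1 x m1 m2 <= eps / 2.
  apply: le_trans (eL m1 m2); rewrite sum_pair le_eqVlt; apply/orP; left; apply/eqP.
  apply: eq_bigr => q _; rewrite sum_pair mulr_sumr; apply: eq_bigr => c _.
  by rewrite mulr_sumr; apply: eq_bigr => c' _; rewrite [RHS]mulrA.
have a2 m1 m2 : \sum_x w x * f2 x m1 m2 <= eps / 2.
  apply: le_trans (eG m2 m1); rewrite sum_pair le_eqVlt; apply/orP; left; apply/eqP.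
  apply: eq_bigr => q _; rewrite sum_pair mulr_sumr exchange_big; apply: eq_bigr => c _.
  by rewrite mulr_sumr; apply: eq_bigr => c' _ /=; rewrite /w /= /f2 /=; ring.
have [[q [c1 c2]] hx] : exists x, (k1%:R * k2%:R)^-1 * \sum_m1 \sum_m2 (e1 x m1 m2 + f2 x m1 m2) <= eps.
  apply: (avg_exists hw).
  under eq_bigr => x _ do rewrite mulrCA mulr_sumr.
  rewrite -mulr_sumr exchange_big /=.
  under eq_bigr => m1 _ do under eq_bigr => x _ do rewrite mulr_sumr.
  under eq_bigr => m1 _ do rewrite exchange_big /=.
  rewrite ler_pdivrMl ?mulr_gt0 //.
  apply: le_trans (_ : \sum_(m1 < k1) \sum_(m2 < k2) eps <= _); last first.
    by rewrite !sum_const_ord mulrA.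
  apply: ler_sum => m1 _; apply: ler_sum => m2 _.
  under eq_bigr => x _ do rewrite mulrDr.
  by rewrite big_split /= [leRHS]splitr lerD.
exists (fun m i => c1 m i), (fun m i => c2 m i), (fun m => op_of (L q c1 c2 m)), (fun m => op_of (G q c2 c1 m)).
have pL := op_of_povm (hL q c1 c2); have pG := op_of_povm (hG q c2 c1).
split=> //; split=> //.
have errR m1 m2 := op_tr_mul (err_psd (proj1 pL m1) (proj1 pG m2) (povm_compl m1 pL) (povm_compl m2 pG))
  (psd_chan (c1 m1) (c2 m2)).
under eq_bigr => m1 _ do under eq_bigr => m2 _ do rewrite errR.
under eq_bigr => m1 _ do rewrite -rmorph_sum.
rewrite -rmorph_sum -!(rmorph_nat (real_complex R)) -rmorphM -fmorphV -rmorphM lecR.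
apply: le_trans hx; rewrite ler_wpM2l ?invr_ge0 ?mulr_ge0 //; try exact: ltW.
apply: ler_sum => m1 _; apply: ler_sum => m2 _.
apply: le_trans (err_le (povm_compl m1 pL) (povm_compl m2 pG) (psd_chan (c1 m1) (c2 m2))) _.
by rewrite !trop_compl ptr1_chan ptr2_chan !op_ofK.
Qed.

End Channel.

(** * Converse *)

Section Relative.
Variable R : realType.
Local Notation C := R[i].

Let ln2_pos : 0 < ln (2 : R) := ln2_gt0 R.

(** The inequality [ln x <= x - 1] at [x = q / p]. Summed over a joint law it gives nonnegativity of
    relative entropy, also against weights that are not normalized. *)
Lemma log2_gap (p q : R) : 0 < p -> 0 < q -> (p - q) / ln 2 <= p * (log2 p - log2 q).
Proof.
move=> p0 q0; rewrite /log2 -mulrBl mulrA ler_pM2r ?invr_gt0 //.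
have h : ln (1 + (q / p - 1)) <= q / p - 1.
  by apply: le_ln1Dx; rewrite ltrBDr addNr divr_gt0.
move: h; rewrite addrCA subrr addr0 ln_div ?posrE // => h.
have : p * (ln q - ln p) <= p * (q / p - 1) by rewrite ler_pM2l.
have -> : p * (q / p - 1) = q - p by field; rewrite gt_eqF.
by move: (ln p) (ln q) => u v; rewrite !mulrBr; lra.
Qed.

(** A pointwise Markov inequality for the log-likelihood ratio. If [p > t q], the ratio exceeds
    [log2 t] and the left side is nonpositive; otherwise the term [q / ln 2] absorbs a possibly
    negative logarithm. *)
Lemma min_log2_bound (p q t : R) : 0 <= p -> 0 <= q -> (p != 0 -> q != 0) -> 1 < t ->
  p - (p * (log2 p - log2 q) + q / ln 2) / log2 t <= Num.min p (t * q).
Proof.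
move=> p0 q0 pq t1; have lt0 : 0 < log2 t by rewrite divr_gt0 // ln_gt0.
have t0 : 0 < t by exact: lt_trans t1.
have c0 : 0 <= q / ln 2 by rewrite divr_ge0 // ltW.
have tq0 : 0 <= t * q by rewrite mulr_ge0 // ltW.
have [p00|pn0] := eqVneq p 0.
  by rewrite p00 !mul0r !add0r min_l // oppr_le0; exact: divr_ge0 c0 (ltW lt0).
have {}p0 : 0 < p by rewrite lt_neqAle eq_sym pn0.
have {pq} q0' : 0 < q by rewrite lt_neqAle eq_sym pq.
case: (leP p (t * q)) => h.
  rewrite lerBlDr lerDl divr_ge0 ?(ltW lt0) //.
  have := log2_gap p0 q0'; rewrite mulrBl => g.
  have : 0 <= p / ln 2 by rewrite divr_ge0 // ltW.
  lra.
apply: le_trans tq0; rewrite subr_le0 ler_pdivlMr //.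
have h2 : log2 t <= log2 p - log2 q.
  rewrite lerBrDr -log2M // /log2 ler_pM2r ?invr_gt0 // ler_ln ?posrE ?mulr_gt0 //.
  exact: ltW.
by rewrite -[leLHS]addr0 lerD // ler_pM2l.
Qed.

Lemma sum_overlap_r (K J T : finType) (A B : Op R T) (lam : K -> R) (mu : J -> R) U V k :
  eigd A lam U -> eigd B mu V -> \sum_j overlap U V k j = 1.
Proof.
move=> /eigd_eigm[hU _ _] /eigd_eigm[hV _ _].
under eq_bigr => j _ do rewrite -nsq_overlap -nsq_adj adjmxM trmxCK.
by rewrite (parseval _ hV) (nsq_onb _ hU).
Qed.

Lemma sum_overlap_l (K J T : finType) (A B : Op R T) (lam : K -> R) (mu : J -> R) U V j :
  eigd A lam U -> eigd B mu V -> \sum_k overlap U V k j = 1.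
Proof.
move=> /eigd_eigm[hU _ _] /eigd_eigm[hV _ _].
under eq_bigr => k _ do rewrite -nsq_overlap.
by rewrite (parseval _ hU) (nsq_onb _ hV).
Qed.

Lemma overlap_ge0 (K J T : finType) (U : K -> T -> C) (V : J -> T -> C) k j :
  0 <= overlap U V k j.
Proof. exact: nsqc_ge0. Qed.

Lemma sum_lam_overlap (K J T : finType) (A : Op R T) (lam : K -> R) U (V : J -> T -> C) j :
  eigd A lam U ->
  \sum_k lam k * overlap U V k j = tre (colv V j *m (colv V j)^t* *m mx_of A).
Proof.
move=> /eigd_eigm hA.
have -> : colv V j *m (colv V j)^t* = (colv V j)^t*^t* *m (colv V j)^t* by rewrite trmxCK.
case: (hA) => _ _ ->; rewrite mulmx_sumr tre_sum; apply: eq_bigr => k _.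
by rewrite -scalemxAr treZ tre_sqr -nsq_overlap -[in RHS]nsq_adj adjmxM trmxCK.
Qed.

Section Average.
Variables (X T : finType) (p : X -> R) (tau : X -> Op R T).
Variables (lam : X -> T -> R) (U : X -> T -> T -> C) (mu : T -> R) (V : T -> T -> C).
Hypotheses (hp : is_pmf p) (hU : forall x, eigd (tau x) (lam x) (U x)).
Hypothesis hV : eigd (mixop p tau) mu V.

(** The spectrum of the mixture is the average of the second marginals of the Nussbaum-Szkola laws,
    which makes the formula for [chi] exact rather than a bound. *)
Lemma mix_eigenvalue j : mu j = \sum_x p x * \sum_k lam x k * overlap (U x) V k j.
Proof.
rewrite -(tre_ketbra_eigm j (eigd_eigm hV)).
have -> : mx_of (mixop p tau) = \sum_x (p x)%:C *: mx_of (tau x).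
  by apply/matrixP => s t; rewrite summxE !mxE; apply: eq_bigr => x _; rewrite !mxE.
rewrite mulmx_sumr tre_sum; apply: eq_bigr => x _.
by rewrite -scalemxAr treZ (sum_lam_overlap _ _ (hU x)).
Qed.

(** Absolute continuity: the mixture dominates each state of positive probability, so wherever the
    weight is nonzero [mu j] is positive. *)
Lemma mix_eigenvalue_neq0 x k j : 0 < p x -> lam x k * overlap (U x) V k j != 0 -> mu j != 0.
Proof.
move=> px; apply: contraNneq => mu0.
have lam0 y l : 0 <= lam y l by case: (hU y).
have s0 y : 0 <= \sum_k lam y k * overlap (U y) V k j.
  by apply: sumr_ge0 => l _; rewrite mulr_ge0 // overlap_ge0.
have : p x * (lam x k * overlap (U x) V k j) <= 0.
  rewrite -mu0 mix_eigenvalue (bigD1 x) //= -[leLHS]addr0 lerD //.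
    rewrite ler_pM2l // (bigD1 k) //= lerDl.
    by apply: sumr_ge0 => l _; rewrite mulr_ge0 // overlap_ge0.
  by apply: sumr_ge0 => y _; rewrite mulr_ge0 //; case: hp.
rewrite pmulr_rle0 // => h; rewrite eq_le h /=.
by rewrite mulr_ge0 // overlap_ge0.
Qed.

(* The Holevo quantity is the average relative entropy of the Nussbaum--Szkola distributions. *)
Definition ns_rel x : R :=
  \sum_k \sum_j lam x k * overlap (U x) V k j * (log2 (lam x k) - log2 (mu j)).

Lemma chi_ns_rel : chi p tau = \sum_x p x * ns_rel x.
Proof.
have E x : ns_rel x = - entropy (tau x) -
    \sum_j (\sum_k lam x k * overlap (U x) V k j) * log2 (mu j).
  rewrite (entropy_log2 (hU x)) opprK /ns_rel.
  under eq_bigr => k _ do under eq_bigr => j _ do rewrite mulrBr.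
  under eq_bigr => k _ do rewrite sumrB.
  rewrite sumrB; congr (_ - _).
    apply: eq_bigr => k _; rewrite -mulr_suml -mulr_sumr.
    by rewrite (sum_overlap_r _ (hU x) hV) mulr1.
  by rewrite exchange_big; apply: eq_bigr => j _; rewrite mulr_suml.
under eq_bigr => x _ do rewrite E mulrBr mulrN.
rewrite sumrB sumrN /chi addrC; congr (_ + _).
rewrite (entropy_log2 hV); congr (- _).
under [RHS]eq_bigr => x _ do rewrite mulr_sumr.
rewrite exchange_big; apply: eq_bigr => j _ /=.
by rewrite {1}mix_eigenvalue mulr_suml; apply: eq_bigr => x _; rewrite -mulrA.
Qed.

Lemma ns_rel_ge0 x : (forall x, density (tau x)) -> 0 < p x -> 0 <= ns_rel x.
Proof.
move=> hd px; have [_ l1] := eigd_pmf (hU x) (hd x).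
have [_ m1] := eigd_pmf hV (density_mix hp hd).
have lam0 l : 0 <= lam x l by case: (hU x).
have mu0 j : 0 <= mu j by case: hV.
have -> : 0 = \sum_k \sum_j (lam x k * overlap (U x) V k j - mu j * overlap (U x) V k j) / ln 2.
  under eq_bigr => k _ do rewrite -mulr_suml sumrB -mulr_sumr (sum_overlap_r k (hU x) hV) mulr1.
  rewrite -mulr_suml sumrB l1 exchange_big.
  under eq_bigr => j _ do rewrite -mulr_sumr (sum_overlap_l j (hU x) hV) mulr1.
  by rewrite m1 subrr mul0r.
apply: ler_sum => k _; apply: ler_sum => j _.
have o0 := overlap_ge0 (U x) V k j.
have [l0|ln0] := eqVneq (lam x k) 0.
  by rewrite l0 !mul0r sub0r mulNr oppr_le0 divr_ge0 ?mulr_ge0 ?(ltW (ln2_gt0 _)).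
have [oz|on0] := eqVneq (overlap (U x) V k j) 0.
  by rewrite oz !mulr0 subrr !mul0r.
have mn0 : mu j != 0 by apply: (mix_eigenvalue_neq0 (k := k) px); rewrite mulf_neq0.
rewrite -mulrBl mulrAC [leRHS]mulrAC ler_wpM2r //; apply: log2_gap.
  by rewrite lt_neqAle eq_sym ln0 lam0.
by rewrite lt_neqAle eq_sym mn0 mu0.
Qed.

End Average.

Lemma chi_ge0 (X T : finType) (p : X -> R) (tau : X -> Op R T) : is_pmf p ->
  (forall x, density (tau x)) -> 0 <= chi p tau.
Proof.
move=> hp hd; have [lam hlam] := choice (fun x => density_eigd (hd x)).
have [U hU] := choice hlam; have [mu [V [hV _]]] := density_eigd (density_mix hp hd).
rewrite (chi_ns_rel (fun x => proj1 (hU x)) hV); apply: sumr_ge0 => x _.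
have [p0 _] := hp; have [->|px] := eqVneq (p x) 0; first by rewrite mul0r.
have px0 : 0 < p x by rewrite lt_neqAle eq_sym px p0.
by rewrite mulr_ge0 // (ns_rel_ge0 hp (fun x => proj1 (hU x)) hV hd px0).
Qed.

(** [min_log2_bound] averaged over product overlaps. The log-likelihood ratio is a sum over
    coordinates, so its mean is the sum of the single-letter means, while the correction stays
    [1 / ln 2] for every [n] because the product spectrum has mass 1. *)
Lemma prod_test_bound n (T : finType) (rho sg : 'I_n -> Op R T) (lam mu : 'I_n -> T -> R) U V t :
  (forall i, density (rho i)) -> (forall i, density (sg i)) ->
  (forall i, eigd (rho i) (lam i) (U i)) -> (forall i, eigd (sg i) (mu i) (V i)) ->
  (forall i k j, lam i k * overlap (U i) (V i) k j != 0 -> mu i j != 0) -> 1 < t ->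
  1 - (\sum_i \sum_k \sum_j lam i k * overlap (U i) (V i) k j * (log2 (lam i k) - log2 (mu i j))
        + (ln 2)^-1) / log2 t <=
  \sum_(k : {ffun 'I_n -> T}) \sum_(j : {ffun 'I_n -> T})
    Num.min (\prod_i lam i (k i)) (t * \prod_i mu i (j i)) * overlap (prodv U) (prodv V) k j.
Proof.
move=> hr hs hU hV hac t1; pose O := overlap (prodv U) (prodv V).
have eU := eigd_prod hU; have eV := eigd_prod hV.
have [Lam0 Lam1] := eigd_pmf eU (density_prod hr).
have [Mu0 Mu1] := eigd_pmf eV (density_prod hs).
pose Lam (k : {ffun 'I_n -> T}) := \prod_i lam i (k i).
pose Mu (k : {ffun 'I_n -> T}) := \prod_i mu i (k i).
have OE k j : O k j = \prod_i overlap (U i) (V i) (k i) (j i) by exact: overlap_prod.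
have sO k : \sum_j O k j = 1 by exact: (sum_overlap_r k eU eV).
have sO' j : \sum_k O k j = 1 by exact: (sum_overlap_l j eU eV).
have O0 k j : 0 <= O k j by exact: overlap_ge0.
have w0 i (x : T * T) : 0 <= lam i x.1 * overlap (U i) (V i) x.1 x.2.
  by rewrite mulr_ge0 ?overlap_ge0 //; case: (hU i).
have hw i : is_pmf (fun x : T * T => lam i x.1 * overlap (U i) (V i) x.1 x.2).
  split; first exact: w0.
  rewrite sum_pair /=; under eq_bigr => k _ do rewrite -mulr_sumr (sum_overlap_r k (hU i) (hV i)) mulr1.
  by case: (eigd_pmf (hU i) (hr i)).
have nz k j i : Lam k * O k j != 0 -> lam i (k i) != 0 /\ mu i (j i) != 0.
  rewrite OE /Lam -big_split /= => h.
  have h1 : lam i (k i) * overlap (U i) (V i) (k i) (j i) != 0.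
    by apply: contraNneq h => z; rewrite (bigD1 i) //= z mul0r.
  by split; [apply: contraNneq h1 => ->; rewrite mul0r|exact: hac h1].
have pos (a : T -> R) : (forall x, 0 <= a x) -> forall x, a x != 0 -> 0 < a x.
  by move=> a0 x ax; rewrite lt_neqAle eq_sym ax a0.
have lam0 i k : 0 <= lam i k by case: (hU i).
have mu0 i k : 0 <= mu i k by case: (hV i).
have DE : \sum_k \sum_j Lam k * O k j * (log2 (Lam k) - log2 (Mu j)) =
    \sum_i \sum_k \sum_j lam i k * overlap (U i) (V i) k j * (log2 (lam i k) - log2 (mu i j)).
  transitivity (\sum_(f : {ffun 'I_n -> T * T})
     (\prod_i (lam i (f i).1 * overlap (U i) (V i) (f i).1 (f i).2)) *
     \sum_i (log2 (lam i (f i).1) - log2 (mu i (f i).2))).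
    rewrite sum_ffun_pair; apply: eq_bigr => k _; apply: eq_bigr => j _.
    under [in RHS]eq_bigr => i _ do rewrite ffunE /=.
    under [X in _ = _ * X]eq_bigr => i _ do rewrite ffunE /=.
    (* The logarithm of the product splits only if all factors are positive; elsewhere the weight
       vanishes. *)
    rewrite big_split /= -OE -/(Lam k); have [->|h] := eqVneq (Lam k * O k j) 0.
      by rewrite !mul0r.
    congr (_ * _); rewrite sumrB !log2_prod // => i; [apply: pos (mu0 i) _ _|apply: pos (lam0 i) _ _];
      by case: (nz k j i h).
  under eq_bigr => f _ do rewrite mulr_sumr.
  rewrite exchange_big; apply: eq_bigr => i _ /=.
  rewrite (@avg_coord _ _ _ (fun i x => lam i x.1 * overlap (U i) (V i) x.1 x.2)
    (fun x => log2 (lam i x.1) - log2 (mu i x.2)) i hw).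
  by rewrite sum_pair.
rewrite -{}DE.
apply: (@le_trans _ _ (\sum_k \sum_j
   (Lam k - (Lam k * (log2 (Lam k) - log2 (Mu j)) + Mu j / ln 2) / log2 t) * O k j)).
  rewrite le_eqVlt; apply/orP; left; apply/eqP.
  transitivity (\sum_k \sum_j (Lam k * O k j - (Lam k * O k j * (log2 (Lam k) - log2 (Mu j))
     + Mu j * O k j / ln 2) / log2 t)); last first.
    by apply: eq_bigr => k _; apply: eq_bigr => j _; ring.
  under [RHS]eq_bigr => k _ do rewrite sumrB -mulr_sumr sO mulr1 -mulr_suml big_split /=.
  rewrite [RHS]sumrB Lam1 -mulr_suml big_split /=; congr (_ - (_ + _) / _).
  rewrite exchange_big /=.
  under eq_bigr => j _ do rewrite -mulr_suml -mulr_sumr sO' mulr1.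
  by rewrite -mulr_suml Mu1 mul1r.
apply: ler_sum => k _; apply: ler_sum => j _; rewrite -/(O k j).
have [->|on0] := eqVneq (O k j) 0; first by rewrite !mulr0.
rewrite ler_wpM2r //; apply: min_log2_bound => //; [exact: Lam0|exact: Mu0|move=> lk].
apply/prodf_neq0 => i _.
by case: (nz k j i _) => //; rewrite mulf_neq0.
Qed.

(** The law of letter [i] of a uniformly drawn codeword. *)
Definition emp k n (X : finType) (c : 'I_k -> 'I_n -> X) (i : 'I_n) (x : X) : R :=
  k%:R^-1 * \sum_m (c m i == x)%:R.

Lemma emp_avg k n (X : finType) (c : 'I_k -> 'I_n -> X) i (F : X -> R) :
  k%:R^-1 * \sum_m F (c m i) = \sum_x emp c i x * F x.
Proof.
rewrite /emp; under [RHS]eq_bigr => x _ do rewrite -mulrA mulr_suml.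
rewrite -mulr_sumr exchange_big; congr (_ * _); apply: eq_bigr => m _ /=.
rewrite (bigD1 (c m i)) //= eqxx mul1r big1 ?addr0 // => x /negPf xc.
by rewrite eq_sym xc mul0r.
Qed.

Lemma emp_pmf k n (X : finType) (c : 'I_k -> 'I_n -> X) i : (0 < k)%N -> is_pmf (emp c i).
Proof.
move=> k0; split; first by move=> x; rewrite mulr_ge0 ?invr_ge0 ?ler0n // sumr_ge0.
have := emp_avg c i (fun=> 1); rewrite sumr_const card_ord mulVf ?pnatr_eq0 -?lt0n // => ->.
by apply: eq_bigr => x _; rewrite mulr1.
Qed.

Lemma emp_gt0 k n (X : finType) (c : 'I_k -> 'I_n -> X) i m : 0 < emp c i (c m i).
Proof.
rewrite mulr_gt0 ?invr_gt0 ?ltr0n ?(leq_ltn_trans _ (ltn_ord m)) //.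
by rewrite (bigD1 m) //= eqxx ltr_wpDr ?sumr_ge0.
Qed.

(** For every message pair, [L a] is read as a test of the output against [sg b], the product over
    coordinates of the output averaged with the empirical law of the own letter. The average over
    pairs brings in [cond_chi] through [chi_ns_rel]. *)
Lemma one_shot_converse (X Y T : finType) (sigma : X -> Y -> Op R T) n ka kb
    (ca : 'I_ka -> 'I_n -> X) (cb : 'I_kb -> 'I_n -> Y)
    (L : 'I_ka -> 'M[C]_#|{ffun 'I_n -> T}|) (t : R) :
  (forall x y, density (sigma x y)) -> povmm L -> (0 < ka)%N -> (0 < kb)%N -> 1 < t ->
  2^-1 * (1 - (\sum_i cond_chi (emp ca i) (emp cb i) sigma + (ln 2)^-1) / log2 t) <=
  (ka%:R * kb%:R)^-1 * (\sum_a \sum_b tre ((1%:M - L a) *m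
      mx_of (prodop (fun i => sigma (ca a i) (cb b i))))) + t / ka%:R.
Proof.
move=> hs hL ka0 kb0 t1.
have hmix i y : density (mixop (emp ca i) (sigma^~ y)).
  by apply: density_mix => //; exact: emp_pmf.
have [lam hlam] := choice (fun z : X * Y => density_eigd (hs z.1 z.2)).
have [U hU] := choice hlam => {hlam}.
have [mu hmu] := choice (fun z : 'I_n * Y => density_eigd (hmix z.1 z.2)).
have [V hV] := choice hmu => {hmu}.
have hU' y x : eigd (sigma x y) (lam (x, y)) (U (x, y)) by case: (hU (x, y)).
have hV' i y : eigd (mixop (emp ca i) (sigma^~ y)) (mu (i, y)) (V (i, y)) by case: (hV (i, y)).
pose D i x y := ns_rel (fun x => lam (x, y)) (fun x => U (x, y)) (mu (i, y)) (V (i, y)) x.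
pose sg b := prodop (fun i => mixop (emp ca i) (sigma^~ (cb b i))).
have key a b : 2^-1 * (1 - (\sum_i D i (ca a i) (cb b i) + (ln 2)^-1) / log2 t) <=
    tre ((1%:M - L a) *m mx_of (prodop (fun i => sigma (ca a i) (cb b i)))) + t * tre (L a *m mx_of (sg b)).
  have h1 := @prod_test_bound n T (fun i => sigma (ca a i) (cb b i)) (fun i => mixop (emp ca i) (sigma^~ (cb b i)))
    (fun i => lam (ca a i, cb b i)) (fun i => mu (i, cb b i)) (fun i => U (ca a i, cb b i)) (fun i => V (i, cb b i)) t
    (fun i => hs _ _) (fun i => hmix _ _) (fun i => hU' _ _) (fun i => hV' _ _)
    (fun i k j => @mix_eigenvalue_neq0 _ _ _ _ _ _ _ _ (emp_pmf ca i ka0) (hU' (cb b i)) (hV' i (cb b i))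
       _ k j (emp_gt0 ca i a)) t1.
  have h2 := test_lower_bound (eigd_eigm (eigd_prod (fun i => hU' (cb b i) (ca a i))))
    (eigd_eigm (eigd_prod (fun i => hV' i (cb b i)))) (proj1 hL a) (povmm_compl a hL)
    (subrKC _ _) (le_trans ler01 (ltW t1)).
  apply: le_trans h2; rewrite ler_pM2l ?invr_gt0 //; apply: le_trans h1 _.
  rewrite le_eqVlt; apply/orP; left; apply/eqP.
  by apply: eq_bigr => k _; apply: eq_bigr => j _; rewrite nsq_overlap.
have kaR : 0 < ka%:R :> R by rewrite ltr0n.
have kbR : 0 < kb%:R :> R by rewrite ltr0n.
have uR : 0 < (ka%:R * kb%:R)^-1 :> R by rewrite invr_gt0 mulr_gt0.
have avg1 : (ka%:R * kb%:R)^-1 * (\sum_(a < ka) \sum_(b < kb) 1) = 1 :> R.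
  by rewrite !sum_const_ord mulr1 mulVf // gt_eqF // mulr_gt0.
have avgD : (ka%:R * kb%:R)^-1 * (\sum_a \sum_b \sum_i D i (ca a i) (cb b i)) =
    \sum_i cond_chi (emp ca i) (emp cb i) sigma.
  have -> : \sum_a \sum_b \sum_i D i (ca a i) (cb b i) = \sum_i \sum_b \sum_a D i (ca a i) (cb b i).
    rewrite exchange_big; under eq_bigr => b _ do rewrite exchange_big.
    by rewrite exchange_big.
  rewrite mulr_sumr; apply: eq_bigr => i _; rewrite invfM [_^-1 * _^-1]mulrC -mulrA mulr_sumr.
  under eq_bigr => b _ do rewrite (emp_avg ca i (fun x => D i x (cb b i))).
  rewrite (emp_avg cb i (fun y => \sum_x emp ca i x * D i x y)); apply: eq_bigr => y _.
  by rewrite (chi_ns_rel (hU' y) (hV' i y)).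
(* The state [sg b] does not depend on [a], so by completeness the acceptance probabilities of all
   [a] sum to 1; only the fraction [1 / ka] remains. *)
have avgS : (ka%:R * kb%:R)^-1 * (\sum_a \sum_b t * tre (L a *m mx_of (sg b))) = t / ka%:R.
  rewrite exchange_big /=.
  have -> : \sum_b \sum_a t * tre (L a *m mx_of (sg b)) = kb%:R * t.
    rewrite -sum_const_ord; apply: eq_bigr => b _.
    rewrite -mulr_sumr -tre_sum -mulmx_suml; case: hL => _ ->; rewrite mul1mx.
    by rewrite (density_tre (density_prod (fun i => hmix i (cb b i)))) mulr1.
  by field; rewrite !gt_eqF.
rewrite -avgS -mulrDr -avgD.
have : (ka%:R * kb%:R)^-1 * (\sum_a \sum_b 2^-1 * (1 - (\sum_i D i (ca a i) (cb b i) + (ln 2)^-1) / log2 t)) <=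
   (ka%:R * kb%:R)^-1 * (\sum_a \sum_b (tre ((1%:M - L a) *m mx_of (prodop (fun i => sigma (ca a i) (cb b i)))) + t * tre (L a *m mx_of (sg b)))).
  rewrite ler_pM2l //; apply: ler_sum => a _; apply: ler_sum => b _; exact: key.
under [X in _ <= _ * X -> _]eq_bigr => a _ do rewrite big_split /=.
rewrite [X in _ <= _ * X -> _]big_split /=; apply: le_trans.
rewrite le_eqVlt; apply/orP; left; apply/eqP.
under [X in _ = _ * X]eq_bigr => a _ do rewrite -mulr_sumr sumrB -mulr_suml big_split /=.
rewrite -mulr_sumr sumrB -mulr_suml big_split /=.
transitivity (2^-1 * ((ka%:R * kb%:R)^-1 * (\sum_(a < ka) \sum_(b < kb) 1) -
   ((ka%:R * kb%:R)^-1 * (\sum_a \sum_b \sum_i D i (ca a i) (cb b i)) +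
    (ka%:R * kb%:R)^-1 * (\sum_(a < ka) \sum_(b < kb) 1) * (ln 2)^-1) / log2 t)).
  by rewrite avg1 mul1r.
have -> : \sum_(a < ka) \sum_(b < kb) (ln 2)^-1 = (\sum_(a < ka) \sum_(b < kb) 1) * (ln 2)^-1 :> R.
  by rewrite mulr_suml; apply: eq_bigr => a _; rewrite mulr_suml; apply: eq_bigr => b _; rewrite mul1r.
by ring.
Qed.

Lemma log2_powR (x : R) : log2 (2 `^ x) = x.
Proof. by rewrite /log2 ln_powR mulfK // gt_eqF. Qed.

(** The slack [eta / 4] in the number of messages is the rate loss allowed by the instance of
    [achievable] to which this is applied; [eps] is fixed before the block length. *)
Lemma receiver_converse (X Y T : finType) (sigma : X -> Y -> Op R T) (r eta : R) :
  (forall x y, density (sigma x y)) -> 0 < eta ->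
  exists2 eps : R, 0 < eps & exists N : nat, forall n, (N <= n)%N -> (0 < n)%N ->
  forall ka kb (ca : 'I_ka -> 'I_n -> X) (cb : 'I_kb -> 'I_n -> Y)
    (L : 'I_ka -> 'M[C]_#|{ffun 'I_n -> T}|),
  povmm L -> (0 < ka)%N -> (0 < kb)%N -> 2 `^ (n%:R * (r - eta / 4)) <= ka%:R ->
  (ka%:R * kb%:R)^-1 * (\sum_a \sum_b tre ((1%:M - L a) *m
      mx_of (prodop (fun i => sigma (ca a i) (cb b i))))) <= eps ->
  r - eta <= \sum_(i < n) n%:R^-1 * cond_chi (emp ca i) (emp cb i) sigma.
Proof.
(* For small [r] the claim is that a negative number is below a nonnegative information; setting it
   aside makes [v] positive and the threshold [t] larger than 1. *)
move=> hs eta0; have [rs|rl] := leP r (eta / 2).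
  exists 1 => //; exists 0%N => n _ n0 ka kb ca cb L _ ka0 kb0 _ _.
  apply: (@le_trans _ _ 0); first by lra.
  apply: sumr_ge0 => i _; rewrite mulr_ge0 ?invr_ge0 ?ler0n //; apply: sumr_ge0 => y _.
  have he := emp_pmf ca i ka0; rewrite mulr_ge0 //; first by case: (emp_pmf cb i kb0).
  exact: chi_ge0.
(* With [t = 2^(n v)] the false-positive term is at most [2^(-n eta/4)]. If the information were
   below [n (r - eta)], the lower bound would exceed [eta / (8 v) = 2 eps], against error plus false
   positives of at most [eps] each. *)
pose v := r - eta / 2; have v0 : 0 < v by rewrite subr_gt0.
pose eps := eta / (16 * v); have e0 : 0 < eps by rewrite divr_gt0 ?mulr_gt0.
have h4 : - (eta / 4) < 0 by rewrite oppr_lt0 divr_gt0.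
have [N hN] := eventually_expr (powR2_lt1 h4) e0.
have c0 : 0 < (ln 2)^-1 :> R by rewrite invr_gt0.
pose N' := Num.truncn (4 * (ln 2)^-1 / eta).
exists eps => //; exists (maxn N N'.+1) => n.
rewrite geq_max => /andP[/hN hn hn'] n0 ka kb ca cb L hL ka0 kb0 hka herr.
have nR : 0 < n%:R :> R by rewrite ltr0n.
have hc : (ln 2)^-1 <= n%:R * (eta / 4).
  have : 4 * (ln 2)^-1 / eta < n%:R.
    by apply: lt_le_trans (truncnS_gt _) _; rewrite ler_nat.
  rewrite ltr_pdivrMr // => h; move: h; rewrite mulrA ler_pdivlMr // mulrC => /ltW.
  by [].
rewrite -mulr_sumr leNgt; apply/negP; rewrite ltr_pdivrMl // => hI.
have t1 : 1 < 2 `^ (n%:R * v) :> R.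
  by rewrite ltr_powR2 // /log2 ln1 mul0r mulr_gt0.
have := one_shot_converse ca cb hs hL ka0 kb0 t1; rewrite log2_powR.
set err := (_ * _)^-1 * _ in herr *; set I := \sum_i _ in hI *.
have ht : 2 `^ (n%:R * v) / ka%:R <= eps.
  apply: le_trans hn; rewrite -powR2_nat ler_pdivrMr ?ltr0n //.
  apply: le_trans (_ : 2 `^ (n%:R * - (eta / 4)) * 2 `^ (n%:R * (r - eta / 4)) <= _); last first.
    by rewrite ler_pM2l // powR_gt0.
  rewrite -powRD ?pnatr_eq0 ?implybT // -mulrDr le_eqVlt; apply/orP; left; apply/eqP.
  by congr (_ `^ (_ * _)); rewrite /v; field.
clearbody err I; apply/negP; rewrite -ltNge.
apply: (@le_lt_trans _ _ (eps + eps)); first exact: lerD.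
have -> : eps + eps = 2^-1 * (eta / 4 / v).
  by rewrite /eps; field; rewrite gt_eqF.
rewrite ltr_pM2l ?invr_gt0 // ltrBrDr -ltrBrDl ltr_pdivrMr ?mulr_gt0 // mulrBl mul1r.
have -> : eta / 4 / v * (n%:R * v) = n%:R * (eta / 4) by field; rewrite gt_eqF.
move: hI; rewrite /v !mulrBr => hI.
have E : n%:R * (eta / 2) = n%:R * (eta / 4) + n%:R * (eta / 4) by field.
have E' : n%:R * eta = n%:R * (eta / 2) + n%:R * (eta / 2) by field.
move: hI; rewrite E' E; move: (n%:R * r) (n%:R * (eta / 4)) hc => x y; lra.
Qed.

End Relative.

(** * Achievable pairs, reduced by any slack, lie in the region *)

Section Converse.
Variable R : realType.
Variables (X1 X2 B1 B2 : finType) (rho : X1 -> X2 -> Op R (B1 * B2)%type).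
Hypothesis hrho : forall x1 x2, density (rho x1 x2).

Lemma achievable_vsi_region (r : R * R) (eta : R) : 0 < eta -> achievable rho r ->
  vsi_region rho (r.1 - eta, r.2 - eta).
Proof.
case: r => r1 r2 eta0 hr /=.
pose sg1 x1 x2 := ptr1 (rho x1 x2); pose sg2 x2 x1 := ptr2 (rho x1 x2).
have hs1 x1 x2 : density (sg1 x1 x2) by exact: density_ptr1.
have hs2 x2 x1 : density (sg2 x2 x1) by exact: density_ptr2.
have [e1 e10 [N1 hN1]] := receiver_converse r1 hs1 eta0.
have [e2 e20 [N2 hN2]] := receiver_converse r2 hs2 eta0.
have e0 : 0 < Num.min e1 e2 by rewrite lt_min e10 e20.
have d0 : 0 < eta / 4 by rewrite divr_gt0.
have [N hN] := hr _ _ e0 d0.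
(* A single block length suffices; the successor makes it positive, so that the uniform law on
   ['I_n] exists. *)
pose n := (maxn N (maxn N1 N2)).+1.
have nN : (N <= n)%N by rewrite leqW // leq_maxl.
have nN1 : (N1 <= n)%N by rewrite leqW // !leq_max leqnn orbT.
have nN2 : (N2 <= n)%N by rewrite leqW // !leq_max leqnn !orbT.
have := hN n nN; rewrite /=.
move: (nmsg_gt0 n (r1 - eta / 4)) (nmsg_ge n (r1 - eta / 4)).
move: (nmsg_gt0 n (r2 - eta / 4)) (nmsg_ge n (r2 - eta / 4)).
move: (nmsg n (r1 - eta / 4)) (nmsg n (r2 - eta / 4)) => k1 k2 k20 k2ge k10 k1ge.
move=> [c1 [c2 [L [G [hL [hG herr]]]]]].
have {}hN1 := hN1 n nN1 isT _ _ c1 c2 _ (proj1 (povm_povmm _) hL) k10 k20 k1ge.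
have {}hN2 := hN2 n nN2 isT _ _ c2 c1 _ (proj1 (povm_povmm _) hG) k20 k10 k2ge.
have errR m1 m2 := op_tr_mul (err_psd (proj1 hL m1) (proj1 hG m2) (povm_compl m1 hL) (povm_compl m2 hG))
  (psd_chan hrho (c1 m1) (c2 m2)).
move: herr; under eq_bigr => m1 _ do under eq_bigr => m2 _ do rewrite errR.
under eq_bigr => m1 _ do rewrite -rmorph_sum.
rewrite -rmorph_sum -!(rmorph_nat (real_complex R)) -rmorphM -fmorphV -rmorphM lecR le_min => /andP[herr1 herr2].
exists 'I_n, (fun=> n%:R^-1), (emp R c1), (emp R c2); split.
- by split=> [_|]; [rewrite invr_ge0 ler0n|rewrite sum_const_ord mulfV // pnatr_eq0].
- by move=> i; exact: emp_pmf.
- by move=> i; exact: emp_pmf.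
- rewrite I_X1B1_X2QE //; last 3 first.
    + by split=> [_|]; [rewrite invr_ge0 ler0n|rewrite sum_const_ord mulfV // pnatr_eq0].
    + by move=> i; exact: emp_pmf.
    + by move=> i; exact: emp_pmf.
  apply: hN1; apply: le_trans herr1; rewrite ler_pM2l ?invr_gt0 ?mulr_gt0 ?ltr0n //.
  apply: ler_sum => m1 _; apply: ler_sum => m2 _.
  apply: le_trans (err_ge1 (proj1 hL m1) (povm_compl m2 hG) (psd_chan hrho (c1 m1) (c2 m2))).
  by rewrite trop_compl ptr1_chan.
rewrite I_X2B2_X1QE //; last 3 first.
  + by split=> [_|]; [rewrite invr_ge0 ler0n|rewrite sum_const_ord mulfV // pnatr_eq0].
  + by move=> i; exact: emp_pmf.
  + by move=> i; exact: emp_pmf.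
apply: hN2; apply: le_trans herr2; rewrite (mulrC k2%:R) ler_pM2l ?invr_gt0 ?mulr_gt0 ?ltr0n //.
rewrite exchange_big; apply: ler_sum => m1 _; apply: ler_sum => m2 _.
apply: le_trans (err_ge2 (povm_compl m1 hL) (proj1 hG m2) (psd_chan hrho (c1 m1) (c2 m2))).
by rewrite trop_compl ptr2_chan.
Qed.

End Converse.

(** * Closedness of the region *)

Section Caratheodory.
Variable R : realType.

(** More than three rows [(1, v1 i, v2 i)] are linearly dependent, and a nonzero relation whose
    coefficients sum to zero has a positive one. *)
Lemma affine_dependence m (v1 v2 : 'I_m -> R) : (3 < m)%N ->
  exists c : 'I_m -> R, [/\ \sum_i c i = 0, \sum_i c i * v1 i = 0,
    \sum_i c i * v2 i = 0 & exists i, 0 < c i].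
Proof.
move=> m3; pose A : 'M[R]_(m, 3) := \matrix_(i, j)
  if j == 0 :> nat then 1 else if j == 1 :> nat then v1 i else v2 i.
have : kermx A != 0.
  rewrite kermx_eq0 /row_free; apply: contraTneq m3 => h.
  by rewrite -h -leqNgt rank_leq_col.
case/rowV0Pn => u /sub_kermxP uA u0.
have uAj j : \sum_i u 0 i * A i j = 0 by have /matrixP/(_ 0 j) := uA; rewrite !mxE.
have e0 : \sum_i u 0 i = 0.
  by rewrite -[RHS](uAj 0); apply: eq_bigr => i _; rewrite !mxE /= mulr1.
have e1 : \sum_i u 0 i * v1 i = 0.
  by rewrite -[RHS](uAj 1); apply: eq_bigr => i _; rewrite !mxE.
have e2 : \sum_i u 0 i * v2 i = 0.
  by rewrite -[RHS](uAj (inord 2)); apply: eq_bigr => i _; rewrite !mxE inordK.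
exists (u 0); split=> //; apply: contrapT => hn.
have un i : u 0 i <= 0 by rewrite leNgt; apply/negP => ui; apply: hn; exists i.
case/negP: u0; apply/eqP/rowP => i; rewrite mxE; apply/eqP; rewrite -oppr_eq0.
have /allP : all (fun i => true ==> (- u 0 i == 0)) (index_enum 'I_m).
  rewrite -psumr_eq0 => [|j _]; first by rewrite sumrN e0 oppr0.
  by rewrite oppr_ge0.
by move/(_ i (mem_index_enum i)).
Qed.

Lemma sum_lift m (i0 : 'I_m.+1) (F : 'I_m.+1 -> R) : F i0 = 0 ->
  \sum_i F i = \sum_(j < m) F (lift i0 j).
Proof. by move=> F0; rewrite (bigD1_ord i0) //= F0 add0r. Qed.

(** Three constraints are kept: total mass and the two mean values. The support has exactly the
    index type ['I_3], with zero weights if fewer points exist, so that all laws share one parameter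
    space. *)
Lemma caratheodory_ord m (p v1 v2 : 'I_m -> R) : is_pmf p ->
  exists (p' : 'I_3 -> R) (s : 'I_3 -> 'I_m), [/\ is_pmf p',
    \sum_i p' i * v1 (s i) = \sum_i p i * v1 i & \sum_i p' i * v2 (s i) = \sum_i p i * v2 i].
Proof.
elim: m p v1 v2 => [|m IH] p v1 v2 [p0 p1].
  by move/eqP: p1; rewrite big_ord0 eq_sym oner_eq0.
have [m3|m3] := leqP m.+1 3.
  pose q (i : 'I_3) : R := if (i < m.+1)%N then p (inord i) else 0.
  have E (F : 'I_m.+1 -> R) : \sum_i q i * F (inord i) = \sum_i p i * F i.
    transitivity (\sum_(i < m.+1) p (inord i) * F (inord i)).
      rewrite (big_ord_widen 3 (fun i => p (inord i) * F (inord i))) // [RHS]big_mkcond.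
      by apply: eq_bigr => i _; rewrite /q; case: ifP => // _; rewrite mul0r.
    by apply: eq_bigr => i _; rewrite inord_val.
  exists q, (fun i => inord i); split=> //; split.
    by move=> i; rewrite /q; case: ifP.
  have := E (fun=> 1); under eq_bigr => i _ do rewrite mulr1.
  by under [in RHS]eq_bigr => i _ do rewrite mulr1; rewrite p1.
have [c [c0 c1 c2 [j cj]]] := affine_dependence v1 v2 m3.
(* The minimal ratio is the longest move along the relation that keeps all weights nonnegative; it
   empties [i0], which is then removed. *)
case: (arg_minP (P := fun i => 0 < c i) (fun i => p i / c i) cj) => i0 ci0 imin.
pose t := p i0 / c i0; have t0 : 0 <= t by rewrite divr_ge0 // ltW.
pose q i := p i - t * c i.
have q0 i : 0 <= q i.
  rewrite subr_ge0; have [ci|ci] := leP (c i) 0.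
    by apply: le_trans (p0 i); rewrite mulr_ge0_le0.
  by rewrite -ler_pdivlMr //; exact: imin.
have qi0 : q i0 = 0 by rewrite /q /t mulfVK ?subrr // gt_eqF.
have qE (F : 'I_m.+1 -> R) : \sum_i c i * F i = 0 -> \sum_i q i * F i = \sum_i p i * F i.
  move=> cF; under eq_bigr => i _ do rewrite mulrBl -mulrA.
  by rewrite sumrB -mulr_sumr cF mulr0 subr0.
have q1 : \sum_i q i = 1 by rewrite sumrB -mulr_sumr c0 mulr0 subr0.
have [|p' [s [hp' s1 s2]]] := IH (fun j => q (lift i0 j)) (fun j => v1 (lift i0 j)) (fun j => v2 (lift i0 j)).
  by split=> //; rewrite -sum_lift.
exists p', (fun i => lift i0 (s i)); split=> //.
  by rewrite s1 -(qE v1) // (@sum_lift m i0) // qi0 mul0r.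
by rewrite s2 -(qE v2) // (@sum_lift m i0) // qi0 mul0r.
Qed.

Lemma caratheodory (Q : finType) (p v1 v2 : Q -> R) : is_pmf p ->
  exists (p' : 'I_3 -> R) (s : 'I_3 -> Q), [/\ is_pmf p',
    \sum_i p' i * v1 (s i) = \sum_q p q * v1 q & \sum_i p' i * v2 (s i) = \sum_q p q * v2 q].
Proof.
move=> [p0 p1].
have [|p' [s [hp' s1 s2]]] := @caratheodory_ord #|Q| (fun i => p (enum_val i))
  (fun i => v1 (enum_val i)) (fun i => v2 (enum_val i)).
  by split=> //; rewrite big_enum_valT.
exists p', (fun i => enum_val (s i)); split=> //.
  by rewrite s1 (big_enum_valT (fun q => p q * v1 q)).
by rewrite s2 (big_enum_valT (fun q => p q * v2 q)).
Qed.

End Caratheodory.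

(** * Semicontinuity of the informations and passage to the limit *)

Section Closed.
Variable R : realType.

Let ln2_pos : 0 < ln (2 : R) := ln2_gt0 R.

(** [log2_gap] summed over the overlaps of the eigenbasis of [A] with [V]. The weights [s] need not
    sum to 1; the last term corrects for their mass. *)
Lemma entropy_le_linear (J T : finType) (A B : Op R T) (mu : J -> R) V (s : J -> R) :
  density A -> eigd B mu V -> (forall j, 0 < s j) ->
  entropy A <= - (\sum_j tre (colv V j *m (colv V j)^t* *m mx_of A) * log2 (s j))
     + (\sum_j s j - 1) / ln 2.
Proof.
move=> hA hV s0; have [lam [U [hU l1]]] := density_eigd hA.
have lam0 l : 0 <= lam l by case: hU.
rewrite (entropy_log2 hU).
have : \sum_l \sum_j (lam l * overlap U V l j - s j * overlap U V l j) / ln 2 <=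
    \sum_l \sum_j lam l * overlap U V l j * (log2 (lam l) - log2 (s j)).
  apply: ler_sum => l _; apply: ler_sum => j _.
  have o0 := overlap_ge0 U V l j.
  have [->|ln0] := eqVneq (lam l) 0.
    by rewrite !mul0r sub0r mulNr oppr_le0 divr_ge0 ?mulr_ge0 ?(ltW (ln2_gt0 _)) ?(ltW (s0 j)).
  rewrite -mulrBl mulrAC [leRHS]mulrAC ler_wpM2r //; apply: log2_gap => //.
  by rewrite lt_neqAle eq_sym ln0 lam0.
have -> : \sum_l \sum_j (lam l * overlap U V l j - s j * overlap U V l j) / ln 2 =
    (1 - \sum_j s j) / ln 2.
  under eq_bigr => l _ do rewrite -mulr_suml sumrB -mulr_sumr (sum_overlap_r l hU hV) mulr1.
  rewrite -mulr_suml sumrB l1 exchange_big.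
  by under eq_bigr => j _ do rewrite -mulr_sumr (sum_overlap_l j hU hV) mulr1.
have -> : \sum_l \sum_j lam l * overlap U V l j * (log2 (lam l) - log2 (s j)) =
    \sum_l lam l * log2 (lam l) - \sum_j tre (colv V j *m (colv V j)^t* *m mx_of A) * log2 (s j).
  under eq_bigr => l _ do under eq_bigr => j _ do rewrite mulrBr.
  under eq_bigr => l _ do rewrite sumrB -mulr_suml -mulr_sumr (sum_overlap_r l hU hV) mulr1.
  rewrite sumrB exchange_big; congr (_ - _); apply: eq_bigr => j _.
  by rewrite -mulr_suml (sum_lam_overlap _ _ hU).
rewrite -[1 - _]opprB mulNr; move: (_ / ln 2) (\sum_l lam l * _) (\sum_j _ * log2 (s j)) => x y z; lra.
Qed.

(* Klein's inequality against the mixture at [p0] bounds the entropy by a function linear in [p];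
   the zero eigenvalues of that mixture are raised to [d], whence the error [e]. *)
Lemma chi_supergradient (X T : finType) (tau : X -> Op R T) (p0 : X -> R) (e : R) :
  (forall x, density (tau x)) -> is_pmf p0 -> 0 < e ->
  exists al : X -> R, (forall p, is_pmf p -> chi p tau <= \sum_x p x * al x) /\
    \sum_x p0 x * al x <= chi p0 tau + e.
Proof.
move=> ht hp0 e0; have hm := density_mix hp0 ht.
have [mu [V [hV m1]]] := density_eigd hm.
have mu0 j : 0 <= mu j by case: hV.
(* At most [#|T|] eigenvalues are raised from zero, adding mass at most [e * ln 2], hence at most
   [e] to the bound. *)
pose d := e * ln 2 / #|T|.+1%:R.
have d0 : 0 < d by rewrite divr_gt0 ?mulr_gt0 ?ltr0n.
pose s j := if mu j == 0 then d else mu j.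
have s0 j : 0 < s j by rewrite /s; case: eqP => // /eqP h; rewrite lt_neqAle eq_sym h mu0.
pose c := (\sum_j s j - 1) / ln 2.
pose be x := - (\sum_j tre (colv V j *m (colv V j)^t* *m mx_of (tau x)) * log2 (s j)).
have lin (p : X -> R) j : tre (colv V j *m (colv V j)^t* *m mx_of (mixop p tau)) =
   \sum_x p x * tre (colv V j *m (colv V j)^t* *m mx_of (tau x)).
  rewrite (_ : mx_of (mixop p tau) = avgop p (fun x => mx_of (tau x))) ?tre_avgop //.
  by apply/matrixP => i k; rewrite /avgop summxE !mxE; apply: eq_bigr => x _; rewrite !mxE.
have sumE (p : X -> R) : is_pmf p -> \sum_x p x * (be x + c - entropy (tau x)) =
    - (\sum_j tre (colv V j *m (colv V j)^t* *m mx_of (mixop p tau)) * log2 (s j)) + c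
    - \sum_x p x * entropy (tau x).
  move=> [_ p1]; under eq_bigr => x _ do rewrite mulrBr mulrDr.
  rewrite sumrB big_split /= -mulr_suml p1 mul1r; congr (_ + _ - _).
  under [in RHS]eq_bigr => j _ do rewrite lin mulr_suml.
  rewrite exchange_big -sumrN; apply: eq_bigr => x _ /=; rewrite /be mulrN mulr_sumr.
  by congr (- _); apply: eq_bigr => j _; rewrite mulrA.
exists (fun x => be x + c - entropy (tau x)); split.
  move=> p hp; rewrite sumE // lerD2r; apply: entropy_le_linear hV s0.
  exact: density_mix.
rewrite sumE // /chi [leRHS]addrAC lerD2r.
have -> : \sum_j tre (colv V j *m (colv V j)^t* *m mx_of (mixop p0 tau)) * log2 (s j) =
    - entropy (mixop p0 tau).
  rewrite (entropy_log2 hV) opprK; apply: eq_bigr => j _.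
  rewrite (tre_ketbra_eigm j (eigd_eigm hV)) /s; case: eqP => // ->; by rewrite !mul0r.
rewrite opprK lerD2l /c ler_pdivrMr // lerBlDr -[X in _ <= _ + X]m1.
apply: (@le_trans _ _ (\sum_j (d + mu j))).
  by apply: ler_sum => j _; rewrite /s; case: eqP => [->|_]; rewrite ?addr0 // lerDr ltW.
rewrite big_split /= lerD2r sumr_const -[leLHS]mulr_natl.
rewrite [leLHS]mulrC -mulrA ler_piMr ?mulr_ge0 ?(ltW e0) ?(ltW (ln2_gt0 _)) //.
by rewrite mulrC ler_pdivrMr ?ltr0n // mul1r ler_nat.
Qed.

Lemma continuous_sumr (I : finType) (T : topologicalType) (F : I -> T -> R) :
  (forall i, continuous (F i)) -> continuous (fun x => \sum_i F i x).
Proof.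
move=> h x; apply: (cvg_big (op := +%R)) => [|i _]; last exact: h.
exact: add_continuous.
Qed.

Section Compactness.
Variables (X Y T1 T2 : finType).
Variables (s1 : X -> Y -> Op R T1) (s2 : Y -> X -> Op R T2).
Hypothesis (h1 : forall x y, density (s1 x y)) (h2 : forall y x, density (s2 y x)).

(** All weights of the three families are coordinates of one row vector, so compactness of the unit
    cube applies. *)
Let W : finType := ('I_3 + ('I_3 * X + 'I_3 * Y))%type.
Let V := 'rV[R]_#|W|.
Let get (w : W) (v : V) : R := v ord0 (enum_rank w).
Let gQ (v : V) (q : 'I_3) := get (inl q) v.
Let g1 (v : V) (q : 'I_3) (x : X) := get (inr (inl (q, x))) v.
Let g2 (v : V) (q : 'I_3) (y : Y) := get (inr (inr (q, y))) v.

Let gQ_cont q : continuous (gQ^~ q).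
Proof. exact: coord_continuous. Qed.

Let g1_cont q x : continuous (fun v => g1 v q x).
Proof. exact: coord_continuous. Qed.

Let g2_cont q y : continuous (fun v => g2 v q y).
Proof. exact: coord_continuous. Qed.

(** A conditional information with the Holevo quantities replaced by linear bounds: a polynomial in
    the parameters, hence continuous. *)
Let poly (al : 'I_3 -> Y -> X -> R) (v : V) : R :=
  \sum_q \sum_y \sum_x gQ v q * (g2 v q y * (g1 v q x * al q y x)).

Let poly_cont al : continuous (poly al).
Proof.
do 3![apply: continuous_sumr => ?] => v.
apply: continuousM; first exact: gQ_cont.
apply: continuousM; first exact: g2_cont.
by apply: continuousM; [exact: g1_cont|exact: cst_continuous].
Qed.

Definition two_user_infos (Q : finType) (pQ : Q -> R) (p1 : Q -> X -> R) (p2 : Q -> Y -> R) (r1 r2 : R) :=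
  [/\ is_pmf pQ, (forall q, is_pmf (p1 q)), (forall q, is_pmf (p2 q)),
     r1 <= \sum_q pQ q * cond_chi (p1 q) (p2 q) s1 & r2 <= \sum_q pQ q * cond_chi (p2 q) (p1 q) s2].

Lemma two_user_infos_limit (r1 r2 : R) :
  (forall eta, 0 < eta -> exists (Q : finType) (pQ : Q -> R) p1 p2,
     two_user_infos pQ p1 p2 (r1 - eta) (r2 - eta)) ->
  exists (Q : finType) (pQ : Q -> R) p1 p2, two_user_infos pQ p1 p2 r1 r2.
Proof.
move=> hr.
have hv (n : nat) : exists v : V, two_user_infos (gQ v) (g1 v) (g2 v) (r1 - n.+1%:R^-1) (r2 - n.+1%:R^-1).
  have [|Q [pQ [p1 [p2 [hQ hp1 hp2 hr1 hr2]]]]] := hr n.+1%:R^-1; first by rewrite invr_gt0 ltr0n.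
  have [p' [s [hp' e1 e2]]] := caratheodory (fun q => cond_chi (p1 q) (p2 q) s1)
    (fun q => cond_chi (p2 q) (p1 q) s2) hQ.
  pose f (w : W) : R := match w with inl q => p' q | inr (inl (q, x)) => p1 (s q) x
    | inr (inr (q, y)) => p2 (s q) y end.
  exists (\row_i f (enum_val i)).
  set v := \row_i _; have getE w : get w v = f w by rewrite /get mxE enum_rankK.
  have -> : gQ v = p' by apply/funext => q; exact: getE.
  have -> : g1 v = fun q => p1 (s q) by apply/funext => q; apply/funext => x; exact: getE.
  have -> : g2 v = fun q => p2 (s q) by apply/funext => q; apply/funext => x; exact: getE.
  by split=> //; rewrite ?e1 ?e2.
have {hr hv}[u hu] := choice hv.
pose K : set V := [set v : V | forall i, `[0, 1]%classic (v ord0 i)]%classic.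
have cK : compact K.
  apply: (@rV_compact R _ (fun=> `[0, 1]%classic)) => i; exact: segment_compact.
have pmf1 (Z : finType) (p : Z -> R) : is_pmf p -> forall z, `[0, 1]%classic (p z).
  move=> [z0 z1] z; rewrite /= in_itv /= z0 -z1 (bigD1 z) //= lerDl.
  by apply: sumr_ge0 => y _.
have uK n : K (u n).
  move=> i; have [hQ hp1 hp2 _ _] := hu n.
  rewrite -(enum_valK i); change (`[0, 1]%classic (get (enum_val i) (u n))).
  case: (enum_val i) => [q|[[q x]|[q y]]]; [exact: (pmf1 _ _ hQ)|exact: (pmf1 _ _ (hp1 q))|exact: (pmf1 _ _ (hp2 q))].
have uF : (u @ \oo)%classic K by exists 0%N => // n _; exact: uK.
(* A cluster point replaces a convergent subsequence: every closed condition that holds eventually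
   along [u] holds at [v]. *)
have [v [_ vc]] := cK _ _ uF.
have lim (D : set V) (N : nat) : closed D -> (forall n, (N <= n)%N -> D (u n)) -> D v.
  move=> cD hD; rewrite (closure_id D).1 //; move: vc; rewrite clusterE; apply.
  by exists N => // n; exact: hD.
have limge N c (f : V -> R) : continuous f -> (forall n, (N <= n)%N -> c <= f (u n)) -> c <= f v.
  move=> /continuous_closedP cf; apply: (lim [set v | c <= f v]%classic).
  exact: (cf _ (@closed_ge _ c)).
have limeq (f : V -> R) c : continuous f -> (forall n, f (u n) = c) -> f v = c.
  move=> /continuous_closedP cf h; apply: (lim [set v | f v = c]%classic 0%N) => [|n _]; last exact: h.
  exact: (cf _ (@closed_eq _ c)).
have vQ : is_pmf (gQ v).
  split=> [q|].
    by apply: (limge 0%N 0 _ (@gQ_cont q)) => n _; case: (hu n) => -[].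
  apply: (limeq _ 1 (continuous_sumr (@gQ_cont))) => n.
  by case: (hu n) => -[].
have v1 q : is_pmf (g1 v q).
  split=> [x|].
    apply: (limge 0%N 0 _ (@g1_cont q x)) => n _.
    by case: (hu n) => _ /(_ q)[].
  apply: (limeq _ 1 (continuous_sumr (@g1_cont q))) => n.
  by case: (hu n) => _ /(_ q)[].
have v2 q : is_pmf (g2 v q).
  split=> [x|].
    apply: (limge 0%N 0 _ (@g2_cont q x)) => n _.
    by case: (hu n) => _ _ /(_ q)[].
  apply: (limeq _ 1 (continuous_sumr (@g2_cont q))) => n.
  by case: (hu n) => _ _ /(_ q)[].
have inv_lt (d : R) : 0 < d -> exists N : nat, forall n, (N <= n)%N -> n.+1%:R^-1 <= d.
  move=> d0; exists (Num.truncn d^-1) => n hn.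
  rewrite invf_ple ?posrE ?ltr0n //; apply: ltW; apply: lt_le_trans (truncnS_gt _) _.
  by rewrite ler_nat.
exists 'I_3, (gQ v), (g1 v), (g2 v); split=> //.
- apply/ler_addgt0Pr => e e0.
  have e2 : 0 < e / 2 by rewrite divr_gt0.
  (* The linear bounds are taken at the limit [v]. They dominate the Holevo quantities along the
     whole sequence and exceed them by at most [e / 2] at [v]; the other [e / 2] covers the slack of
     the approximants. *)
  have [al hal] := choice (fun z : 'I_3 * Y => @chi_supergradient _ _ (s1^~ z.2) (g1 v z.1) (e / 2)
    (fun x => h1 x z.2) (v1 z.1) e2).
  have [N hN] := inv_lt _ e2.
  have hlim : r1 - e / 2 <= poly (fun q y x => al (q, y) x) v.
    apply: (limge N _ _ (@poly_cont _)) => n hn; have [[nQ _] n1 n2 nr1 _] := hu n.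
    apply: (@le_trans _ _ (r1 - n.+1%:R^-1)); first by rewrite lerD2l lerN2 hN.
    apply: le_trans nr1 _; apply: ler_sum => q _; rewrite /cond_chi mulr_sumr.
    apply: ler_sum => y _; rewrite -mulr_sumr -mulr_sumr ler_wpM2l //.
    rewrite ler_wpM2l //; first by case: (n2 q).
    by case: (hal (q, y)) => + _; apply.
  move: hlim; rewrite lerBlDr => hlim; apply: le_trans hlim _.
  rewrite [e in leRHS]splitr addrA lerD2r.
  have -> : e / 2 = \sum_q gQ v q * \sum_y g2 v q y * (e / 2).
    under eq_bigr => q _ do rewrite -mulr_suml (proj2 (v2 q)) mul1r.
    by rewrite -mulr_suml (proj2 vQ) mul1r.
  rewrite -big_split /=; apply: ler_sum => q _; rewrite -mulrDr.
  under [leLHS]eq_bigr => y _ do rewrite -!mulr_sumr.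
  rewrite -mulr_sumr ler_wpM2l //; first by case: vQ.
  rewrite -big_split /=; apply: ler_sum => y _; rewrite -mulrDr ler_wpM2l //; first by case: (v2 q).
  by case: (hal (q, y)).
- apply/ler_addgt0Pr => e e0.
  have e2 : 0 < e / 2 by rewrite divr_gt0.
  have [al hal] := choice (fun z : 'I_3 * X => @chi_supergradient _ _ (s2^~ z.2) (g2 v z.1) (e / 2)
    (fun y => h2 y z.2) (v2 z.1) e2).
  have [N hN] := inv_lt _ e2.
  (* For the second user the roles of the inputs are exchanged; reordering the sums lets the same
     [poly] serve. *)
  have E (w : V) : poly (fun q y x => al (q, x) y) w =
      \sum_q gQ w q * \sum_x g1 w q x * \sum_y g2 w q y * al (q, x) y.
    apply: eq_bigr => q _; rewrite exchange_big mulr_sumr; apply: eq_bigr => x _.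
    by rewrite !mulr_sumr; apply: eq_bigr => y _; ring.
  have hlim : r2 - e / 2 <= poly (fun q y x => al (q, x) y) v.
    apply: (limge N _ _ (@poly_cont _)) => n hn; have [[nQ _] n1 n2 _ nr2] := hu n.
    apply: (@le_trans _ _ (r2 - n.+1%:R^-1)); first by rewrite lerD2l lerN2 hN.
    rewrite E; apply: le_trans nr2 _; apply: ler_sum => q _; rewrite ler_wpM2l //.
    apply: ler_sum => x _; rewrite ler_wpM2l //; first by case: (n1 q).
    by case: (hal (q, x)) => + _; apply.
  move: hlim; rewrite lerBlDr E => hlim; apply: le_trans hlim _.
  rewrite [e in leRHS]splitr addrA lerD2r.
  have -> : e / 2 = \sum_q gQ v q * \sum_x g1 v q x * (e / 2).
    under eq_bigr => q _ do rewrite -mulr_suml (proj2 (v1 q)) mul1r.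
    by rewrite -mulr_suml (proj2 vQ) mul1r.
  rewrite -big_split /=; apply: ler_sum => q _; rewrite -mulrDr ler_wpM2l //; first by case: vQ.
  rewrite -big_split /=; apply: ler_sum => x _; rewrite -mulrDr ler_wpM2l //; first by case: (v1 q).
  by case: (hal (q, x)).
Qed.

End Compactness.
End Closed.

Theorem theorem3 (R : realType) (X1 X2 B1 B2 : finType)
    (rho : X1 -> X2 -> Op R (B1 * B2)%type) :
  (forall (x1 : X1) (x2 : X2), density (rho x1 x2)) ->
  very_strong_interference rho ->
  capacity_region rho = vsi_region rho.
Proof.
move=> hrho hvsi; rewrite /capacity_region; apply/seteqP; split; last first.
  by move=> r hr; apply: subset_closure; exact: vsi_region_achievable.
move=> [r1 r2] hr.
pose s1 x1 x2 := ptr1 (rho x1 x2); pose s2 x2 x1 := ptr2 (rho x1 x2).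
have h1 x1 x2 : density (s1 x1 x2) by exact: density_ptr1.
have h2 x2 x1 : density (s2 x2 x1) by exact: density_ptr2.
have [|Q [pQ [p1 [p2 [hQ hp1 hp2 hr1 hr2]]]]] := two_user_infos_limit h1 h2 (r1 := r1) (r2 := r2).
  (* Half of [eta] is spent on the distance to an achievable pair, half on the slack of the
     converse. *)
  move=> eta eta0; have e2 : 0 < eta / 2 by rewrite divr_gt0.
  have [[t1 t2] [ht []]] := hr _ (nbhsx_ballx (r1, r2) (eta / 2) e2).
  rewrite /= /ball /= !ltr_distlC => /andP[b1 _] /andP[b2 _].
  have [Q [pQ [p1 [p2 [hQ hp1 hp2 /= ht1 ht2]]]]] := achievable_vsi_region hrho e2 ht.
  exists Q, pQ, p1, p2; split=> //.
    by rewrite -I_X1B1_X2QE //; apply: le_trans ht1; move: b1; clear; lra.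
  by rewrite -I_X2B2_X1QE //; apply: le_trans ht2; move: b2; clear; lra.
by exists Q, pQ, p1, p2; split=> //=; rewrite ?I_X1B1_X2QE ?I_X2B2_X1QE.
Qed.
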